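(* Let $m,n\geqslant1$. Then $LG^{m,n}_K=0$ for every disconnected (i.e. split) multicomponent link $K$, that is, for every oriented link $K=K_1\sqcup K_2$ which is the split (separated) union of two nonempty links $K_1$ and $K_2$.
   Context: **Algebra.** $q$ and $\alpha$ are free (generic) parameters. Grade indices $1\leqslant a\leqslant m+n$ by $[a]=0$ if $a\leqslant m$ and $[a]=1$ if $a>m$; put $q_a=q^{(-1)^{[a]}}$. $U_q[gl(m|n)]$ is the standard quantum superalgebra (distinguished root system) generated by the even Cartan elements $K_a=q_a^{E^a{}_a}$ ($1\leqslant a\leqslant m+n$), with arbitrary powers $K_a^N$ allowed, and simple raising/lowering generators $E^a{}_{a+1},E^{a+1}{}_a$ ($1\leqslant a<m+n$) of parity $[a]+[a+1]$. With the graded commutator $[X,Y]=XY-(-1)^{[X][Y]}YX$, the relations are: the $K_a$ commute; $K_aE^b{}_{b\pm1}=q_a^{\delta^a_b-\delta^a_{b\pm1}}E^b{}_{b\pm1}K_a$; $(E^m{}_{m+1})^2=(E^{m+1}{}_m)^2=0$; $[E^a{}_{a+1},E^{b+1}{}_b]=\delta^a_b\,(K_aK_{a+1}^{-1}-K_a^{-1}K_{a+1})/(q_a-q_a^{-1})$; $E^a{}_{a+1}$ and $E^b{}_{b+1}$ commute for $|a-b|>1$, and likewise the lowering generators; and the standard quantum Serre relations. It is a quasitriangular Hopf superalgebra. Coproduct convention: $\Delta(K_a)=K_a\otimes K_a$ and $\Delta(E)=E\otimes k_a^{-1/2}+k_a^{1/2}\otimes E$ for $E\in\{E^a{}_{a+1},E^{a+1}{}_a\}$,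 where $k_a=K_aK_{a+1}^{-1}$. **Representation.** $\pi$ is the finite-dimensional irreducible (typical) representation on a $\mathbb{Z}_2$-graded space $V$ of highest weight $\Lambda=(0,\dots,0\,|\,\alpha,\dots,\alpha)$ ($m$ zeros, $n$ copies of $\alpha$), i.e. the highest weight vector satisfies $E^a{}_av_+=0$ for $a\leqslant m$ and $E^a{}_av_+=\alpha v_+$ for $a>m$. Fix a homogeneous weight basis $v_1,\dots,v_N$ of $V$. **R matrix.** $\check R$ is the linear map on $V\otimes V$ given by $P\cdot(\pi\otimes\pi)(\mathcal R)$, where $\mathcal R$ is the universal R matrix and $P(v\otimes w)=(-1)^{[v][w]}w\otimes v$; operators act on $V\otimes V$ by $(X\otimes Y)(v\otimes w)=(-1)^{[Y][v]}Xv\otimes Yw$. Any nonzero scalar renormalization of $\check R$ is allowed, and replacing $\check R$ by $\check R^{-1}$ only changes the chirality convention. It is regarded as an ordinary matrix with components given by $\check R(v_d\otimes v_b)=\sum_{c,a}\check R^{ca}_{db}\,v_c\otimes v_a$, and as such it satisfies the ordinary (ungraded) Yang–Baxter equation in braid form. **State model parameters.** Let $q^{h_\rho}=\prod_{i=1}^{m}K_i^{\,m-i}\cdot\prod_{i=m+1}^{m+n}K_i^{\,m+1-i}$, and let $S$ be the diagonal matrix with entries $S^a_a=(-1)^{[v_a]}\,\pi(q^{2h_\rho})^a_a$. Put $X_1=\sum_cS^c_c\check R^{c1}_{c1}$ and $X_2=\sum_cS^c_c(\check R^{-1})^{c1}_{c1}$ (both nonzero), and set $\sigma=X_1^{-1/2}X_2^{1/2}\check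 R$ and $C=X_1^{-1/2}X_2^{-1/2}S$. Then $\sigma$ satisfies the braid relation and $\sum_{c,d}C^d_c\,\sigma^{ca}_{db}=\delta^a_b=\sum_{c,d}C^d_c\,(\sigma^{-1})^{ca}_{db}$ (the first Reidemeister move). **The invariant.** Let an oriented link $K$ be presented as the closure $\hat\beta$ of a braid $\beta$ on $k$ strings. Let $Z_\beta\in\mathrm{End}(V^{\otimes k})$ be the operator representing $\beta$, where a positive crossing of strings $i,i+1$ acts by $\sigma$ on tensor factors $i,i+1$ and a negative crossing by $\sigma^{-1}$. Closing all strings but the last yields the $(1,1)$-tangle form of $K$, to which is associated $$T_K=\mathrm{tr}_{1,\dots,k-1}\big[(C^{\otimes(k-1)}\otimes I)\,Z_\beta\big]\in\mathrm{End}(V),$$ the trace being the ordinary partial trace over the first $k-1$ tensor factors. It is known that $T_K$ is a scalar multiple of the identity and that this scalar depends only on the link $K$, not on the braid presentation. The Links–Gould invariant $LG^{m,n}_K$ is this scalar, i.e. the first diagonal component of $T_K$. (It is thus defined as a $(1,1)$-tangle invariant.) *)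

(* Defs.v *)
From mathcomp Require Import all_boot all_algebra.
From Stdlib Require Import Relation_Operators.

Set Implicit Arguments.
Unset Strict Implicit.
Unset Printing Implicit Defensive.

Import GRing.Theory.
Local Open Scope ring_scope.

(* Matrices indexed by arbitrary (finite) types.  [X i j] is the coefficient
   of the basis vector [i] in the image of the basis vector [j], and the tensor
   product of spaces with bases A and B has basis A * B.  Identities between
   matrices are stated entrywise. *)
Definition mat (F : fieldType) (A B : Type) := A -> B -> F.

Section Mat.
Variable F : fieldType.

Definition mmul (A : Type) (B : finType) (C : Type)
    (X : mat F A B) (Y : mat F B C) : mat F A C :=
  fun i j => \sum_k X i k * Y k j.

Definition mdiag (B : eqType) (d : B -> F) : mat F B B :=
  fun i j => if i == j then d i else 0.

Definition mone (B : eqType) : mat F B B := mdiag (fun _ => 1).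

Definition as_mx (B : finType) (X : mat F B B) : 'M[F]_#|B| :=
  \matrix_(i, j) X (enum_val i) (enum_val j).

Definition minv (B : finType) (X : mat F B B) : mat F B B :=
  fun i j => invmx (as_mx X) (enum_rank i) (enum_rank j).

Definition mapp (B : finType) (X : mat F B B) (v : {ffun B -> F^o}) :
    {ffun B -> F^o} :=
  [ffun i => \sum_j X i j * v j].

End Mat.

Arguments mone F B _ _ : clear implicits.

Infix "**" := mmul (at level 40, left associativity).

(* [qp x] plays the role of q ^ x, for exponents x in the ground field; q itself
   is [qp 1].  Over the complex numbers, qp x = exp (h x). *)
Definition is_qpow (F : fieldType) (qp : F -> F) : Prop :=
  qp 0 = 1 /\ (forall x y, qp (x + y) = qp x * qp y).

(* q and q ^ alpha are algebraically independent over Z; in particular F has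
   characteristic 0 and q is not a root of unity. *)
Definition generic (F : fieldType) (qp : F -> F) (alpha : F) : Prop :=
  forall P : {poly {poly int}},
    (map_poly (map_poly (fun c : int => c%:~R : F)) P).[(qp alpha)%:P].[qp 1] = 0 ->
    P = 0.

(* The two consecutive indices a, a+1 joined by the a-th simple generator. *)
Lemma hi_subproof (N : nat) (a : 'I_N.-1) : (a.+1 < N)%N.
Proof. by rewrite -ltn_predRL. Qed.

Lemma lo_subproof (N : nat) (a : 'I_N.-1) : (a < N)%N.
Proof. exact: ltnW (hi_subproof a). Qed.

Definition lo (N : nat) (a : 'I_N.-1) : 'I_N := Ordinal (lo_subproof a).
Definition hi (N : nat) (a : 'I_N.-1) : 'I_N := Ordinal (hi_subproof a).

(* Finite-dimensional Z_2-graded space with a homogeneous basis of weight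
   vectors: E^a_a acts on the basis vector i as the scalar [wt i a], while
   [up a] and [dn a] are the matrices of E^a_{a+1} and E^{a+1}_a.  Indices are
   shifted by one: a : 'I_(m + n) stands for the index a+1 in 1, .., m+n. *)
Record gmod (F : fieldType) (m n : nat) := Gmod {
  gbasis :> finType;
  par : gbasis -> bool;
  wt : gbasis -> 'I_(m + n) -> F;
  up : 'I_(m + n).-1 -> mat F gbasis gbasis;
  dn : 'I_(m + n).-1 -> mat F gbasis gbasis
}.

Arguments par {F m n} g _.
Arguments wt {F m n} g _ _.
Arguments up {F m n} g _ _ _.
Arguments dn {F m n} g _ _ _.

Section Uq.
Variables (F : fieldType) (qp : F -> F) (m n : nat).
Implicit Types (V W U : gmod F m n) (a b c : 'I_(m + n).-1).

Definition gpar (i : 'I_(m + n)) : bool := (m <= i)%N.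
Definition gsgn (i : 'I_(m + n)) : F := (-1) ^+ gpar i.
Definition spar a : bool := gpar (lo a) (+) gpar (hi a).

(* q_i ^ x *)
Definition qi (i : 'I_(m + n)) (x : F) : F := qp (gsgn i * x).

(* K_i ^ N, where K_i = q_i ^ (E^i_i), and (K_a K_{a+1}^-1) ^ N *)
Definition Kpow V (i : 'I_(m + n)) (N : F) : mat F V V :=
  mdiag (fun v => qi i (N * wt V v i)).
Arguments Kpow : clear implicits.
Definition kpow V a (N : F) : mat F V V :=
  Kpow V (lo a) N ** Kpow V (hi a) (- N).
Arguments kpow : clear implicits.

(* Relations satisfied by one family of simple generators, raising or lowering,
   of U_q[gl(m|n)] among themselves. *)
Record serre V (e : 'I_(m + n).-1 -> mat F V V) : Prop := Serre {
  serre_odd : forall a i j, spar a -> (e a ** e a) i j = 0;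
  serre_far : forall a b i j, (a.+1 < b)%N ->
    (e a ** e b) i j = (e b ** e a) i j;
  serre_cubic : forall a b i j, ~~ spar a ->
    (a.+1 == b)%N || (b.+1 == a)%N ->
    (e a ** e a ** e b) i j - (qp 1 + (qp 1)^-1) * (e a ** e b ** e a) i j
      + (e b ** e a ** e a) i j = 0;
  serre_quartic : forall a b c i j, spar b -> (a.+1 == b)%N -> (b.+1 == c)%N ->
    (e b ** e a ** e b ** e c) i j + (e b ** e c ** e b ** e a) i j
      + (e a ** e b ** e c ** e b) i j + (e c ** e b ** e a ** e b) i j
      - (qp 1 + (qp 1)^-1) * (e b ** e a ** e c ** e b) i j = 0
}.

(* [V] is a representation of U_q[gl(m|n)]; the commutation of the K_i among
   themselves holds by construction. *)
Record is_rep V : Prop := IsRep {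
  rep_up_par : forall a i j, up V a i j != 0 -> par V i = par V j (+) spar a;
  rep_dn_par : forall a i j, dn V a i j != 0 -> par V i = par V j (+) spar a;
  rep_K_up : forall (k : 'I_(m + n)) (N : F) a i j,
    (Kpow V k N ** up V a) i j =
    qi k (N * ((k == lo a)%:R - (k == hi a)%:R)) * (up V a ** Kpow V k N) i j;
  rep_K_dn : forall (k : 'I_(m + n)) (N : F) a i j,
    (Kpow V k N ** dn V a) i j =
    qi k (N * ((k == hi a)%:R - (k == lo a)%:R)) * (dn V a ** Kpow V k N) i j;
  rep_up_dn : forall a b i j,
    (up V a ** dn V b) i j
      - (-1) ^+ (spar a && spar b) * (dn V b ** up V a) i j =
    (a == b)%:R * ((kpow V a 1 i j - kpow V a (-1) i j)
                     / (qi (lo a) 1 - qi (lo a) (-1)));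
  rep_serre_up : serre (up V);
  rep_serre_dn : serre (dn V)
}.

Definition irreducible V : Prop :=
  forall H : {vspace {ffun V -> F^o}},
    (forall v, v \in H ->
       [/\ forall a, mapp (up V a) v \in H,
           forall a, mapp (dn V a) v \in H &
           forall i N, mapp (Kpow V i N) v \in H]) ->
    H = 0%VS \/ H = fullv.

(* V has a highest weight vector of weight (0, .., 0 | alpha, .., alpha). *)
Definition has_highest_weight (alpha : F) V : Prop :=
  exists2 v : {ffun V -> F^o}, v != 0 &
    (forall a, mapp (up V a) v = 0) /\
    (forall (i : 'I_(m + n)) (x : V),
       wt V x i * v x = (if gpar i then alpha else 0) * v x).

(* Action of X (x) Y on V (x) W, where Y has parity y:
   (X (x) Y) (v (x) w) = (-1) ^ ([Y] [v]) X v (x) Y w. *)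
Definition gtens V W (y : bool) (X : mat F V V) (Y : mat F W W) :
    mat F (V * W)%type (V * W)%type :=
  fun s t => (-1) ^+ (y && par V t.1) * (X s.1 t.1 * Y s.2 t.2).

(* Coproduct and opposite coproduct of a simple generator of index a, acting on
   V and W by X and Y.  The k_a being even, the flip introduces no sign. *)
Definition cop V W a (X : mat F V V) (Y : mat F W W) :
    mat F (V * W)%type (V * W)%type :=
  fun s t => gtens false X (kpow W a (- 2%:R^-1)) s t
             + gtens (spar a) (kpow V a 2%:R^-1) Y s t.
Definition cop_op V W a (X : mat F V V) (Y : mat F W W) :
    mat F (V * W)%type (V * W)%type :=
  fun s t => gtens (spar a) (kpow V a (- 2%:R^-1)) Y s t
             + gtens false X (kpow W a 2%:R^-1) s t.

Definition tens V W : gmod F m n :=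
  @Gmod F m n (V * W)%type
    (fun s => par V s.1 (+) par W s.2)
    (fun s i => wt V s.1 i + wt W s.2 i)
    (fun a => cop a (up V a) (up W a))
    (fun a => cop a (dn V a) (dn W a)).

(* Even linear maps V -> V' commuting with the action. *)
Record is_hom V V' (f : mat F V' V) : Prop := IsHom {
  hom_par : forall i j, f i j != 0 -> par V' i = par V j;
  hom_K : forall k N i j, (Kpow V' k N ** f) i j = (f ** Kpow V k N) i j;
  hom_up : forall a i j, (up V' a ** f) i j = (f ** up V a) i j;
  hom_dn : forall a i j, (dn V' a ** f) i j = (f ** dn V a) i j
}.

Definition wform (x y : 'I_(m + n) -> F) : F := \sum_i gsgn i * (x i * y i).

(* x - y is a nonzero sum of simple roots *)
Definition pos_diff (x y : 'I_(m + n) -> F) : Prop :=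
  exists2 c : 'I_(m + n).-1 -> nat, (exists a, c a != 0%N) &
    forall i, x i - y i = \sum_a (c a)%:R * ((i == lo a)%:R - (i == hi a)%:R).

Definition univ_family := forall V W, mat F (V * W)%type (V * W)%type.

(* The universal R matrix lives in a completion of U (x) U; it is the same as
   the natural family of its actions R V W on all V (x) W.
   The first fields are the axioms of a quasitriangular structure:
   R Delta(x) = Delta^op(x) R, (Delta (x) 1) R = R_13 R_23 and
   (1 (x) Delta) R = R_13 R_12.  In R_13 the sign comes from moving the second
   leg of R, which has the parity of the first one, across the middle factor.
   The last two fields select the standard solution for this coproduct,
   R = q ^ (sum_i (-1) ^ [i] E^i_i (x) E^i_i) (1 + lowering (x) raising). *)
Record universal_R (R : univ_family) : Prop := UniversalR {
  uR_even : forall V W, is_rep V -> is_rep W -> forall s t,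
    R V W s t != 0 -> par V s.1 (+) par W s.2 = par V t.1 (+) par W t.2;
  uR_unit : forall V W, is_rep V -> is_rep W -> as_mx (R V W) \in unitmx;
  uR_natural : forall V V' W W' (f : mat F V' V) (g : mat F W' W),
    is_rep V -> is_rep V' -> is_rep W -> is_rep W' ->
    is_hom f -> is_hom g ->
    let fg : mat F (V' * W')%type (V * W)%type :=
      fun s t => f s.1 t.1 * g s.2 t.2 in
    forall s t, (R V' W' ** fg) s t = (fg ** R V W) s t;
  uR_up : forall V W a, is_rep V -> is_rep W -> forall s t,
    (R V W ** cop a (up V a) (up W a)) s t =
    (cop_op a (up V a) (up W a) ** R V W) s t;
  uR_dn : forall V W a, is_rep V -> is_rep W -> forall s t,
    (R V W ** cop a (dn V a) (dn W a)) s t =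
    (cop_op a (dn V a) (dn W a) ** R V W) s t;
  uR_tensl : forall U V W, is_rep U -> is_rep V -> is_rep W ->
    let R13 : mat F (U * V * W)%type (U * V * W)%type := fun s t =>
      if s.1.2 == t.1.2 then
        (-1) ^+ ((par U s.1.1 (+) par U t.1.1) && par V t.1.2)
          * R U W (s.1.1, s.2) (t.1.1, t.2)
      else 0 in
    let R23 : mat F (U * V * W)%type (U * V * W)%type := fun s t =>
      if s.1.1 == t.1.1 then R V W (s.1.2, s.2) (t.1.2, t.2) else 0 in
    forall s t, R (tens U V) W s t = (R13 ** R23) s t;
  uR_tensr : forall U V W, is_rep U -> is_rep V -> is_rep W ->
    let R13 : mat F (U * (V * W))%type (U * (V * W))%type := fun s t =>
      if s.2.1 == t.2.1 then
        (-1) ^+ ((par U s.1 (+) par U t.1) && par V t.2.1)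
          * R U W (s.1, s.2.2) (t.1, t.2.2)
      else 0 in
    let R12 : mat F (U * (V * W))%type (U * (V * W))%type := fun s t =>
      if s.2.2 == t.2.2 then R U V (s.1, s.2.1) (t.1, t.2.1) else 0 in
    forall s t, R U (tens V W) s t = (R13 ** R12) s t;
  uR_cartan : forall V W, is_rep V -> is_rep W -> forall s,
    R V W s s = qp (wform (wt V s.1) (wt W s.2));
  uR_triangular : forall V W, is_rep V -> is_rep W -> forall s t,
    s <> t -> R V W s t != 0 ->
    [/\ pos_diff (wt V t.1) (wt V s.1), pos_diff (wt W s.2) (wt W t.2) &
        forall i, wt V t.1 i - wt V s.1 i = wt W s.2 i - wt W t.2 i]
}.

(* z P (pi (x) pi)(R), with z a scalar renormalization. *)
Definition Rcheck (R : univ_family) V (z : F) : mat F (V * V)%type (V * V)%type :=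
  fun s t => z * ((-1) ^+ (par V s.1 && par V s.2) * R V V (s.2, s.1) t).

(* Exponent of K_i in q ^ h_rho; the index i here is one less than usual. *)
Definition hrho_exp (i : 'I_(m + n)) : F :=
  if gpar i then m%:R - i%:R else m%:R - i.+1%:R.

Definition Sdiag V : V -> F :=
  fun v => (-1) ^+ par V v * \prod_i qi i (2%:R * hrho_exp i * wt V v i).

(* X_1 for X the R matrix, X_2 for X its inverse: the diagonal entry at v1 of
   the partial trace of (S (x) 1) X over the first factor. *)
Definition Xconst V (v1 : V) (X : mat F (V * V)%type (V * V)%type) : F :=
  \sum_c Sdiag c * X (c, v1) (c, v1).

End Uq.

Arguments Kpow {F} qp {m n} V i N _ _.
Arguments kpow {F} qp {m n} V a N _ _.
Arguments Rcheck {F m n} R V z _ _.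

(* A word in the standard generators of the braid group on [pstr + 1] strings.
   The letter (i, true) is a positive crossing of the strings number i and i+1
   (counted from 0), which are [lift ord_max i] and [lift ord0 i]; the letter
   (i, false) is its inverse. *)
Record braid := Braid { pstr : nat; bword : seq ('I_pstr * bool) }.

(* Oriented links up to isotopy are taken to be braids up to conjugation and
   stabilization (theorems of Alexander and Markov). *)
Inductive markov_step : braid -> braid -> Prop :=
| mk_cancel p (u w : seq ('I_p * bool)) i b :
    markov_step (Braid (u ++ [:: (i, b); (i, ~~ b)] ++ w)) (Braid (u ++ w))
| mk_far p (u w : seq ('I_p * bool)) (i j : 'I_p) b c :
    (i.+1 < j)%N ->
    markov_step (Braid (u ++ [:: (i, b); (j, c)] ++ w))
                (Braid (u ++ [:: (j, c); (i, b)] ++ w))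
| mk_braid p (u w : seq ('I_p * bool)) (i j : 'I_p) :
    i.+1 = j ->
    markov_step (Braid (u ++ [:: (i, true); (j, true); (i, true)] ++ w))
                (Braid (u ++ [:: (j, true); (i, true); (j, true)] ++ w))
| mk_conj p (u w : seq ('I_p * bool)) :
    markov_step (Braid (u ++ w)) (Braid (w ++ u))
| mk_stab p (w : seq ('I_p * bool)) b :
    markov_step (Braid w)
      (Braid (rcons [seq (widen_ord (leqnSn p) x.1, x.2) | x <- w] (ord_max, b))).

Definition same_link : braid -> braid -> Prop := clos_refl_sym_trans braid markov_step.

(* Juxtaposition of two braids, of closure the split union of the closures. *)
Definition split_union (b1 b2 : braid) : braid :=
  @Braid ((pstr b1).+1 + pstr b2)
    ([seq (lshift (pstr b2) (widen_ord (leqnSn (pstr b1)) x.1), x.2) | x <- bword b1]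
     ++ [seq (rshift (pstr b1).+1 x.1, x.2) | x <- bword b2]).

(* Operators on V^(x)(p+1), with basis the functions from 'I_p.+1 to a basis B
   of V. *)
Section Tangle.
Variables (F : fieldType) (B : finType).

Definition crossing p (i : 'I_p) (X : mat F (B * B)%type (B * B)%type) :
    mat F {ffun 'I_p.+1 -> B} {ffun 'I_p.+1 -> B} :=
  let l := lift ord_max i in let r := lift ord0 i in
  fun f g => if [forall j, (j != l) && (j != r) ==> (f j == g j)]
             then X (f l, f r) (g l, g r) else 0.

Definition braid_op (X : mat F (B * B)%type (B * B)%type) (b : braid) :
    mat F {ffun 'I_(pstr b).+1 -> B} {ffun 'I_(pstr b).+1 -> B} :=
  foldr (fun x Z => crossing x.1 (if x.2 then X else minv X) ** Z)
        (mone F _) (bword b).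
Arguments braid_op X b _ _ : clear implicits.

Definition extend p (h : {ffun 'I_p -> B}) (x : B) : {ffun 'I_p.+1 -> B} :=
  [ffun j => if unlift ord_max j is Some j' then h j' else x].

(* tr_{1, .., p} [(C^(x)p (x) I) Z], for a diagonal matrix C *)
Definition tangle_op (C : B -> F) (X : mat F (B * B)%type (B * B)%type)
    (b : braid) : mat F B B :=
  let CI := mdiag (fun f : {ffun 'I_(pstr b).+1 -> B} =>
                     \prod_(j < pstr b) C (f (lift ord_max j))) in
  fun x y => \sum_(h : {ffun 'I_(pstr b) -> B})
    (CI ** braid_op X b) (extend h x) (extend h y).

End Tangle.

(* First diagonal component, at the basis vector v1, of the operator of the
   (1,1)-tangle; r1 and r2 are the square roots of X_1 and X_2. *)
Definition LG (F : fieldType) (qp : F -> F) (m n : nat) (R : univ_family F m n)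
    (V : gmod F m n) (v1 : V) (z r1 r2 : F) (b : braid) : F :=
  let sigma := fun s t => r1^-1 * r2 * Rcheck R V z s t in
  let C := fun v => r1^-1 * r2^-1 * Sdiag qp v in
  tangle_op C sigma b v1 v1.

(* Main.v *)
From HB Require Import structures.
Require Import Defs.
From mathcomp Require Import all_boot all_order all_algebra ring zify.
From Stdlib Require Import FunctionalExtensionality.

Set Implicit Arguments.
Unset Strict Implicit.
Unset Printing Implicit Defensive.

Import GRing.Theory Num.Theory.
Local Open Scope ring_scope.

(** Closing a strand of a braid operator on the left uses the diagonal matrix
    C, a multiple of S = (-1)^[v] q^(2 h_rho); closing it on the right uses
    C' = (-1)^[v] q^(-2 h_rho). Given a braid on p + 1 strands with operator Z,
    one may cut open any strand j, closing those before it to the left and those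
    after it to the right; [tau j Y Z] is the pairing of the endomorphism of V
    obtained in this way with an arbitrary matrix Y. The invariant LG is such a
    number with j the last strand. The property that carries the proof is
    [all_cuts_vanish]: whichever strand is cut, the result is zero.

    This property is invariant under the Markov moves, in both directions
    ([same_link_vanish]). Asking it for all strands at once avoids comparing
    the values obtained by cutting different components of the link. The move
    that needs an argument is the conjugation by a crossing that involves the
    cut strand j: it moves the cut to the neighbouring strand ([tau_rot]). To
    see this, add a strand. Passing it across all the others, by
    s_0 s_1 .. s_p, turns Z acting on the first strands into Z acting on the
    last ones ([slides]), and removing the extra strand by a stabilization, on
    the right on one side of this equality and on the left on the other side,
    gives tau (j + 1) (s_0 .. s_(p-1) Z) = tau j (Z s_0 .. s_(p-1)) up to a
    nonzero factor ([tau_pass_all]). Only the braid relations and the two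
    stabilizations enter.

    Cutting a split union leaves one of its two parts entirely closed
    ([split_union_vanish]). On the block of strands of that part, the odd simple
    generators e and f act by their iterated coproducts E and F. They commute
    with Z, they anticommute with the closing matrix, whose sign makes the
    trace a supertrace, and E F + F E = (K - K^-1) / (q - q^-1), with K acting
    by powers of q whose exponents are a positive multiple of alpha plus an
    integer. Since alpha is generic, this is invertible, so that Z is an
    anticommutator up to an invertible factor and its closure vanishes
    ([block_trace0]).

    Three facts on representations are needed. The braid relation
    ([Rcheck_braid]) is the naturality of R on (V (x) V) (x) V with respect to
    the braiding of V with itself; naturality is available once V (x) V is known
    to satisfy the relations of the algebra, Serre relations included
    ([tens_rep]). The partial traces of the braiding and of its inverse, on
    either side, are intertwiners of V ([ptr_comm]), hence scalars by Schur's
    lemma ([schur]). These scalars are not zero: as R is triangular, only one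
    term of the trace contributes on a vector of extremal weight
    ([ptr_left_Rcheck] and its three variants). *)

(** * Matrices *)

Section MatTheory.
Variable F : fieldType.

Lemma matP (A B : Type) (X Y : mat F A B) : (forall i j, X i j = Y i j) -> X = Y.
Proof.
by move=> eqXY; apply: functional_extensionality => i;
   apply: functional_extensionality => j.
Qed.

Lemma mmulA (A : Type) (B C : finType) (D : Type)
    (X : mat F A B) (Y : mat F B C) (Z : mat F C D) : X ** (Y ** Z) = X ** Y ** Z.
Proof.
apply: matP => i j; rewrite /mmul.
under eq_bigr => k _ do rewrite mulr_sumr.
rewrite exchange_big; apply: eq_bigr => l _ /=.
by rewrite mulr_suml; apply: eq_bigr => k _; rewrite mulrA.
Qed.

Lemma mdiag_mull (A : finType) (B : Type) d (X : mat F A B) i j :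
  (mdiag d ** X) i j = d i * X i j.
Proof.
rewrite /mmul (bigD1 i) //= /mdiag eqxx big1 ?addr0 // => k.
by rewrite eq_sym => /negPf ->; rewrite mul0r.
Qed.

Lemma mdiag_mulr (A : Type) (B : finType) d (X : mat F A B) i j :
  (X ** mdiag d) i j = X i j * d j.
Proof.
rewrite /mmul (bigD1 j) //= /mdiag eqxx big1 ?addr0 // => k.
by move=> /negPf ->; rewrite mulr0.
Qed.

Lemma mdiagM (B : finType) (d d' : B -> F) :
  mdiag d ** mdiag d' = mdiag (fun i => d i * d' i).
Proof.
by apply: matP => i j; rewrite mdiag_mull /mdiag; case: eqP => // _; rewrite mulr0.
Qed.

Lemma mul1mat (A : finType) (B : Type) (X : mat F A B) : mone F A ** X = X.
Proof. by apply: matP => i j; rewrite mdiag_mull mul1r. Qed.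

Lemma mulmat1 (A : Type) (B : finType) (X : mat F A B) : X ** mone F B = X.
Proof. by apply: matP => i j; rewrite mdiag_mulr mulr1. Qed.

Lemma as_mxM (B : finType) (X Y : mat F B B) : as_mx (X ** Y) = as_mx X *m as_mx Y.
Proof.
apply/matrixP => i j; rewrite !mxE /mmul (reindex _ (onW_bij _ (@enum_val_bij B))).
by apply: eq_bigr => k _; rewrite !mxE.
Qed.

Lemma as_mx1 (B : finType) : as_mx (mone F B) = 1%:M.
Proof.
apply/matrixP => i j; rewrite !mxE /mone /mdiag (inj_eq enum_val_inj).
by case: eqP.
Qed.

Lemma as_mx_inj (B : finType) : injective (@as_mx F B).
Proof.
move=> X Y /matrixP eqXY; apply: matP => i j.
by have := eqXY (enum_rank i) (enum_rank j); rewrite !mxE !enum_rankK.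
Qed.

Lemma as_mxK (B : finType) (M : 'M[F]_#|B|) :
  as_mx (fun i j => M (enum_rank i) (enum_rank j)) = M.
Proof. by apply/matrixP => i j; rewrite !mxE !enum_valK. Qed.

Lemma mmul1C (B : finType) (X Y : mat F B B) : X ** Y = mone F B -> Y ** X = mone F B.
Proof.
move=> XY1; apply: as_mx_inj; rewrite as_mxM as_mx1; apply: mulmx1C.
by rewrite -as_mxM XY1 as_mx1.
Qed.

Lemma mulmatV (B : finType) (X : mat F B B) :
  as_mx X \in unitmx -> X ** minv X = mone F B.
Proof.
move=> uX; apply: as_mx_inj; rewrite as_mxM as_mx1 /minv as_mxK; exact: mulmxV.
Qed.

Lemma mulVmat (B : finType) (X : mat F B B) :
  as_mx X \in unitmx -> minv X ** X = mone F B.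
Proof. by move/mulmatV/mmul1C. Qed.

Lemma unitmatP (B : finType) (X Y : mat F B B) :
  X ** Y = mone F B -> as_mx X \in unitmx.
Proof.
move=> XY; have: as_mx X *m as_mx Y = 1%:M by rewrite -as_mxM XY as_mx1.
by case/mulmx1_unit.
Qed.

Lemma minv_eq (B : finType) (X Y : mat F B B) : X ** Y = mone F B -> minv X = Y.
Proof.
move=> XY; have uX := unitmatP XY.
by rewrite -[minv X]mulmat1 -XY mmulA (mulVmat uX) mul1mat.
Qed.

Lemma comm_inv (B : finType) (X Xi Y : mat F B B) :
  X ** Xi = mone F B -> X ** Y = Y ** X -> Xi ** Y = Y ** Xi.
Proof.
move=> XXi XY; have XiX := mmul1C XXi.
by rewrite -[LHS]mulmat1 -XXi -mmulA (mmulA Y) -XY -!mmulA (mmulA Xi) XiX mul1mat.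
Qed.

Definition mtr (B : finType) (X : mat F B B) : F := \sum_i X i i.

Lemma mtrC (A B : finType) (X : mat F A B) (Y : mat F B A) :
  mtr (X ** Y) = mtr (Y ** X).
Proof.
rewrite /mtr /mmul exchange_big; apply: eq_bigr => k _; apply: eq_bigr => i _.
by rewrite mulrC.
Qed.

Lemma mdiagC (B : finType) (d d' : B -> F) : mdiag d ** mdiag d' = mdiag d' ** mdiag d.
Proof. by rewrite !mdiagM; congr mdiag; apply: functional_extensionality => i; rewrite mulrC. Qed.

Lemma mdiagV (C : finType) (d : C -> F) : (forall i, d i != 0) ->
  mdiag d ** mdiag (fun i => (d i)^-1) = mone F C.
Proof.
move=> d0; rewrite mdiagM; congr mdiag.
by apply: functional_extensionality => i; rewrite mulfV.
Qed.

(** All the tensor products of operators below are such ordinary products, the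
    signs of the graded convention being absorbed in the factors. *)
Definition kron (A B A' B' : Type) (X : mat F A A') (Y : mat F B B') :
    mat F (A * B)%type (A' * B')%type :=
  fun s t => X s.1 t.1 * Y s.2 t.2.

Lemma kronM (A B : Type) (A' B' : finType) (A'' B'' : Type)
    (X : mat F A A') (Y : mat F B B') (X' : mat F A' A'') (Y' : mat F B' B'') :
  kron X Y ** kron X' Y' = kron (X ** X') (Y ** Y').
Proof.
apply: matP => s t; rewrite /mmul /kron mulr_suml.
rewrite -(pair_bigA _ (fun k l => X s.1 k * Y s.2 l * (X' k t.1 * Y' l t.2))) /=.
apply: eq_bigr => k _; rewrite mulr_sumr; apply: eq_bigr => l _.
by rewrite mulrACA.
Qed.

Lemma kron11 (A B : finType) : kron (mone F A) (mone F B) = mone F (A * B)%type.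
Proof.
apply: matP => -[i1 i2] [j1 j2]; rewrite /kron /mone /mdiag -pair_eqE /pair_eq /=.
by case: eqP; case: eqP => _ _ /=; rewrite ?mulr1 ?mulr0.
Qed.

Lemma sum_pair (A B : finType) (f : A * B -> F) : \sum_p f p = \sum_a \sum_b f (a, b).
Proof. by rewrite pair_bigA; apply: eq_bigr => -[]. Qed.

Definition swapm (A B : Type) (X : mat F (A * B)%type (A * B)%type) :
    mat F (B * A)%type (B * A)%type :=
  fun s t => X (s.2, s.1) (t.2, t.1).

Lemma swapmM (A B : finType) (X Y : mat F (A * B)%type (A * B)%type) :
  swapm X ** swapm Y = swapm (X ** Y).
Proof.
apply: matP => s t; rewrite /mmul /swapm.
rewrite (reindex (fun u : A * B => (u.2, u.1))) /=; first by apply: eq_bigr => -[].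
by exists (fun u : B * A => (u.2, u.1)) => -[].
Qed.

Lemma swapm_kron (A B : Type) (X : mat F A A) (Y : mat F B B) :
  swapm (kron X Y) = kron Y X.
Proof. by apply: matP => s t; rewrite /swapm /kron mulrC. Qed.

End MatTheory.
Arguments matP {F A B X Y}.

(** * Serre relations for sums of skew-commuting families *)

Section MatLinear.
Variables (F : fieldType) (B : finType).
Implicit Types (X Y Z : mat F B B) (c : F).

Definition madd X Y : mat F B B := fun i j => X i j + Y i j.
Definition mscal c X : mat F B B := fun i j => c * X i j.

Lemma mmulDl X Y Z : madd X Y ** Z = madd (X ** Z) (Y ** Z).
Proof.
apply: matP => i j; rewrite /mmul /madd -big_split.
by apply: eq_bigr => k _; rewrite mulrDl.
Qed.

Lemma mmulDr X Y Z : X ** madd Y Z = madd (X ** Y) (X ** Z).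
Proof.
apply: matP => i j; rewrite /mmul /madd -big_split.
by apply: eq_bigr => k _; rewrite mulrDr.
Qed.

Lemma mscalAl c X Y : mscal c X ** Y = mscal c (X ** Y).
Proof.
apply: matP => i j; rewrite /mmul /mscal mulr_sumr.
by apply: eq_bigr => k _; rewrite mulrA.
Qed.

Lemma mscalAr c X Y : X ** mscal c Y = mscal c (X ** Y).
Proof.
apply: matP => i j; rewrite /mmul /mscal mulr_sumr.
by apply: eq_bigr => k _; rewrite mulrCA.
Qed.

Lemma mscal1 X : mscal 1 X = X.
Proof. by apply: matP => i j; rewrite /mscal mul1r. Qed.

Section Skew.
Variables (w : F) (w0 : w != 0) (qq : F) (qqE : qq = w + w^-1).

(** The coproduct of a generator is a sum x + y whose two terms commute up to a
    scalar with those of any other generator. Moving every y to the left turns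
    a mixed monomial into a word in the y followed by a word in the x, and the
    coefficients of each such product cancel, as in
    w ^ 2 - (w + w^-1) * w + 1 = 0. The pure words give the relation for x and
    the relation for y. *)
Lemma cubic_skew (xa xb ya yb : mat F B B) :
  xa ** ya = mscal (w^-1 ^+ 2) (ya ** xa) ->
  xa ** yb = mscal w (yb ** xa) ->
  xb ** ya = mscal w (ya ** xb) ->
  (forall i j, (xa ** xa ** xb) i j - qq * (xa ** xb ** xa) i j
     + (xb ** xa ** xa) i j = 0) ->
  (forall i j, (ya ** ya ** yb) i j - qq * (ya ** yb ** ya) i j
     + (yb ** ya ** ya) i j = 0) ->
  let a := madd xa ya in let b := madd xb yb in
  forall i j, (a ** a ** b) i j - qq * (a ** b ** a) i j + (b ** a ** a) i j = 0.
Proof.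
move=> Saa Sab Sba Hx Hy a b i j; rewrite /a /b.
have aa Z : xa ** (ya ** Z) = mscal (w^-1 ^+ 2) (ya ** (xa ** Z)).
  by rewrite mmulA Saa mscalAl mmulA.
have ab Z : xa ** (yb ** Z) = mscal w (yb ** (xa ** Z)).
  by rewrite mmulA Sab mscalAl mmulA.
have ba Z : xb ** (ya ** Z) = mscal w (ya ** (xb ** Z)).
  by rewrite mmulA Sba mscalAl mmulA.
have := Hx i j; have := Hy i j; rewrite -!mmulA => {}Hy {}Hx.
rewrite !(mmulDl, mmulDr) -?mmulA.
rewrite !(aa, ab, ba, Saa, Sab, Sba, mscalAr) /madd /mscal.
rewrite -[RHS](addr0 0) -{1}Hx -Hy qqE; field; exact: w0.
Qed.

(** Same normal ordering as in [cubic_skew]. The mixed terms cancel once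
    x_b ^ 2 = 0 and x_c x_a = x_a x_c are taken into account in each part; the
    vanishing of the squares is written [mscal 0] to be a rewriting rule like
    the others. *)
Lemma quartic_skew (xa xb xc ya yb yc : mat F B B) :
  xa ** yb = mscal w (yb ** xa) -> xb ** ya = mscal w (ya ** xb) ->
  xc ** yb = mscal w^-1 (yb ** xc) -> xb ** yc = mscal w^-1 (yc ** xb) ->
  xa ** yc = yc ** xa -> xc ** ya = ya ** xc ->
  xb ** yb = mscal (-1) (yb ** xb) ->
  xc ** xa = xa ** xc -> yc ** ya = ya ** yc ->
  xb ** xb = mscal 0 xb -> yb ** yb = mscal 0 yb ->
  (forall i j, (xb ** xa ** xb ** xc) i j + (xb ** xc ** xb ** xa) i j
      + (xa ** xb ** xc ** xb) i j + (xc ** xb ** xa ** xb) i j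
      - qq * (xb ** xa ** xc ** xb) i j = 0) ->
  (forall i j, (yb ** ya ** yb ** yc) i j + (yb ** yc ** yb ** ya) i j
      + (ya ** yb ** yc ** yb) i j + (yc ** yb ** ya ** yb) i j
      - qq * (yb ** ya ** yc ** yb) i j = 0) ->
  let a := madd xa ya in let b := madd xb yb in let c := madd xc yc in
  forall i j, (b ** a ** b ** c) i j + (b ** c ** b ** a) i j
      + (a ** b ** c ** b) i j + (c ** b ** a ** b) i j
      - qq * (b ** a ** c ** b) i j = 0.
Proof.
move=> Sab Sba Scb Sbc Sac Sca Sbb Cx Cy Nx Ny Hx Hy a b c i j.
have assoc (P Q R Z : mat F B B) k : P ** Q = mscal k (Q ** P) ->
    P ** (Q ** Z) = mscal k (Q ** (P ** Z)).
  by move=> S; rewrite mmulA S mscalAl mmulA.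
have assoc1 (P Q R Z : mat F B B) : P ** Q = Q ** P ->
    P ** (Q ** Z) = Q ** (P ** Z).
  by move=> S; rewrite mmulA S mmulA.
have ab Z := assoc _ _ xa Z _ Sab; have ba Z := assoc _ _ xa Z _ Sba.
have cb Z := assoc _ _ xa Z _ Scb; have bc Z := assoc _ _ xa Z _ Sbc.
have bb Z := assoc _ _ xa Z _ Sbb.
have ac Z := assoc1 _ _ xa Z Sac; have ca Z := assoc1 _ _ xa Z Sca.
have cx Z := assoc1 _ _ xa Z Cx; have cy Z := assoc1 _ _ xa Z Cy.
have nx Z : xb ** (xb ** Z) = mscal 0 (xb ** Z) by rewrite mmulA Nx mscalAl.
have ny Z : yb ** (yb ** Z) = mscal 0 (yb ** Z) by rewrite mmulA Ny mscalAl.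
have := Hx i j; have := Hy i j; rewrite -!mmulA => {}Hy {}Hx.
rewrite -[RHS](addr0 0) -{1}Hx -Hy.
rewrite /a /b /c !(mmulDl, mmulDr) -?mmulA.
rewrite !(ab, ba, cb, bc, bb, ac, ca, cx, cy, nx, ny, Sab, Sba, Scb, Sbc, Sac,
  Sca, Sbb, Cx, Cy, Nx, Ny, mscalAr) /madd /mscal.
rewrite qqE; field; exact: w0.
Qed.
End Skew.
End MatLinear.

(** * Weights, roots and the tensor product of representations *)

Section QPow.
Variables (F : fieldType) (qp : F -> F).
Hypothesis Hqp : is_qpow qp.

Lemma qp0 : qp 0 = 1. Proof. by case: Hqp. Qed.
Lemma qpD x y : qp (x + y) = qp x * qp y. Proof. by case: Hqp. Qed.
Lemma qpNK x : qp x * qp (- x) = 1. Proof. by rewrite -qpD subrr qp0. Qed.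
Lemma qp_neq0 x : qp x != 0.
Proof. by apply/eqP => q0; have := qpNK x; rewrite q0 mul0r => /eqP; rewrite eq_sym oner_eq0. Qed.
Lemma qpN x : qp (- x) = (qp x)^-1.
Proof. by apply: (mulfI (qp_neq0 x)); rewrite qpNK mulfV // qp_neq0. Qed.
End QPow.

Section Roots.
Variables (F : fieldType) (m n : nat).
Implicit Types (V W : gmod F m n) (a b c : 'I_(m + n).-1).

Definition sroot a (k : 'I_(m + n)) : F := (k == lo a)%:R - (k == hi a)%:R.

(** The exponent of q in the action of k_a. *)
Definition kwt V a (v : V) : F :=
  gsgn F (lo a) * wt V v (lo a) - gsgn F (hi a) * wt V v (hi a).

Arguments kwt : clear implicits.

(** The form (alpha_a, alpha_b) on the simple roots. *)
Definition cart a b : F :=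
  gsgn F (lo a) * sroot b (lo a) - gsgn F (hi a) * sroot b (hi a).

Lemma gsgn2 (k : 'I_(m + n)) : gsgn F k * gsgn F k = 1.
Proof. by rewrite /gsgn -expr2 sqrr_sign. Qed.

Lemma cart_far a b : (a.+1 < b)%N -> cart a b = 0 /\ cart b a = 0.
Proof.
move=> ab; rewrite /cart /sroot -!val_eqE /=.
have -> : (a == b :> nat) = false by lia. have -> : (a == b.+1 :> nat) = false by lia.
have -> : (a.+1 == b :> nat) = false by lia. have -> : (a.+1 == b.+1 :> nat) = false by lia.
have -> : (b == a :> nat) = false by lia. have -> : (b == a.+1 :> nat) = false by lia.
have -> : (b.+1 == a :> nat) = false by lia. have -> : (b.+1 == a.+1 :> nat) = false by lia.
by split; rewrite /=; ring.
Qed.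

Lemma cart_self a : cart a a = gsgn F (lo a) + gsgn F (hi a).
Proof.
rewrite /cart /sroot -!val_eqE /= !eqxx.
have -> : (a == a.+1 :> nat) = false by lia. have -> : (a.+1 == a :> nat) = false by lia.
by rewrite /=; ring.
Qed.

Lemma lo_next a b : a.+1 == b -> lo b = hi a.
Proof. by move/eqP => ab; apply: val_inj. Qed.

Lemma cart_next a b : a.+1 == b ->
  cart a b = - gsgn F (hi a) /\ cart b a = - gsgn F (hi a).
Proof.
move=> ab; rewrite /cart (lo_next ab) /sroot -!val_eqE /= (eqP ab) !eqxx.
have -> : (a == b :> nat) = false by lia. have -> : (a == b.+1 :> nat) = false by lia.
have -> : (b == b.+1 :> nat) = false by lia. have -> : (b.+1 == b :> nat) = false by lia.
have -> : (b == a :> nat) = false by lia. have -> : (b.+1 == a :> nat) = false by lia.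
by split; rewrite /=; ring.
Qed.

Lemma cart_sym a b : cart a b = cart b a.
Proof.
have [ab | ba | ab] := ltngtP a b; last by rewrite (val_inj ab).
- have [/eqP ab1 | ab1] := eqVneq a.+1 b; first by have [-> ->] := cart_next ab1.
  by have [|-> ->] := @cart_far a b; first by lia.
- have [/eqP ab1 | ab1] := eqVneq b.+1 a; first by have [-> ->] := cart_next ab1.
  by have [|-> ->] := @cart_far b a; first by lia.
Qed.

Lemma spar_far a b : (a.+1 < b)%N -> spar a && spar b = false.
Proof. by rewrite /spar /gpar /=; lia. Qed.

Lemma spar_next a b : a.+1 == b -> spar a && spar b = false.
Proof. by rewrite /spar /gpar /=; lia. Qed.

Lemma gsgn_even a : ~~ spar a -> gsgn F (lo a) = gsgn F (hi a).
Proof. by rewrite /spar negb_add /gsgn => /eqP ->. Qed.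

Lemma gsgn_odd a : spar a -> gsgn F (lo a) = 1 /\ gsgn F (hi a) = -1.
Proof.
rewrite /spar /gsgn /gpar /= => sa.
have -> : (m <= a)%N = false by lia. by have -> : (m <= a.+1)%N by lia.
Qed.

End Roots.
Arguments sroot F {m n} a k.
Arguments cart F {m n} a b.
Arguments cart_next F {m n a b}.
Arguments cart_far F {m n a b}.
Arguments cart_self F {m n} a.
Arguments cart_sym F {m n} a b.
Arguments gsgn_even F {m n a}.
Arguments gsgn_odd F {m n a}.
Arguments kwt {F m n} V a v.

Section Reps.
Variables (F : fieldType) (qp : F -> F) (m n : nat).
Hypothesis Hqp : is_qpow qp.
Hypothesis q_nontriv : qp 1 != 1.
Implicit Types (V W U : gmod F m n) (a b c : 'I_(m + n).-1).

Lemma kpowE V a N : kpow qp V a N = mdiag (fun v => qp (N * kwt V a v)).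
Proof.
rewrite /kpow /Kpow mdiagM; congr mdiag; apply: functional_extensionality => v.
by rewrite /qi -(qpD Hqp) /kwt; congr qp; ring.
Qed.

(** The commutation with the powers of K only compares powers of q. It determines
    the weights because N is arbitrary: a discrepancy d in the weights is ruled
    out by taking N = 1 / d up to sign, for which it would give q = 1. *)
Lemma wt_shift V (e : mat F V V) (s : F) a :
  (forall (k : 'I_(m + n)) N i j, (Kpow qp V k N ** e) i j =
     qi qp k (N * (s * sroot F a k)) * (e ** Kpow qp V k N) i j) ->
  forall i j, e i j != 0 -> forall k, wt V i k = wt V j k + s * sroot F a k.
Proof.
move=> He i j eij k; apply/eqP; rewrite -subr_eq0; apply/negPn/negP.
set d := _ - _ => d0.
have := He k (gsgn F k / d) i j; rewrite mdiag_mull mdiag_mulr /qi (mulrC (e i j)) (mulrA (qp _) (qp _)).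
move/(mulIf eij)/eqP; rewrite -(qpD Hqp).
have -> : gsgn F k * (gsgn F k / d * (wt V i k)) =
  1 + (gsgn F k * (gsgn F k / d * (s * sroot F a k)) + gsgn F k * (gsgn F k / d * wt V j k)).
  rewrite !mulrA gsgn2 -(mulfV d0) /d; field; exact: d0.
rewrite (qpD Hqp 1) -subr_eq0 -[X in _ - X]mul1r -mulrBl mulf_eq0 (negPf (qp_neq0 Hqp _)) orbF.
by rewrite subr_eq0 (negPf q_nontriv).
Qed.

Lemma wt_shiftK V (e : mat F V V) (s : F) a :
  (forall i j, e i j != 0 -> forall k, wt V i k = wt V j k + s * sroot F a k) ->
  forall (k : 'I_(m + n)) N i j, (Kpow qp V k N ** e) i j =
     qi qp k (N * (s * sroot F a k)) * (e ** Kpow qp V k N) i j.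
Proof.
move=> He k N i j; rewrite mdiag_mull mdiag_mulr.
have [-> | eij] := eqVneq (e i j) 0; first by rewrite !(mul0r, mulr0).
rewrite (He _ _ eij) /qi (mulrC (e i j)) (mulrA (qp _) (qp _)) -(qpD Hqp); congr (qp _ * _); ring.
Qed.

Lemma up_wt V a i j : is_rep qp V -> up V a i j != 0 ->
  forall k, wt V i k = wt V j k + 1 * sroot F a k.
Proof.
move=> rV; apply: wt_shift => k N i' j'; rewrite mul1r; exact: rep_K_up.
Qed.

Lemma dn_wt V a i j : is_rep qp V -> dn V a i j != 0 ->
  forall k, wt V i k = wt V j k + -1 * sroot F a k.
Proof.
move=> rV; apply: wt_shift => k N i' j'; rewrite mulN1r opprB; exact: rep_K_dn.
Qed.

Definition homog V (s : F) (e : 'I_(m + n).-1 -> mat F V V) : Prop :=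
  forall a i j, e a i j != 0 ->
    par V i = par V j (+) spar a /\ forall k, wt V i k = wt V j k + s * sroot F a k.

Lemma homog_up V : is_rep qp V -> homog 1 (up V).
Proof. by move=> rV a i j e0; split; [exact: (rep_up_par rV e0) | exact: (up_wt rV e0)]. Qed.

Lemma homog_dn V : is_rep qp V -> homog (-1) (dn V).
Proof. by move=> rV a i j e0; split; [exact: (rep_dn_par rV e0) | exact: (dn_wt rV e0)]. Qed.

Lemma homog_kwt V s e a b i j : @homog V s e -> e a i j != 0 ->
  kwt V b i = kwt V b j + s * cart F b a.
Proof.
by move=> He /He[_ wtE]; rewrite /kwt !wtE /cart; ring.
Qed.

(** The two factors k_a^(-1/2) and k_a^(1/2) of the coproduct, the second one
    together with the sign of moving a generator past the first tensor factor. *)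
Definition kinv V a : mat F V V := mdiag (fun v => qp (- 2%:R^-1 * kwt V a v)).
Definition kpar V a : mat F V V :=
  mdiag (fun v => (-1) ^+ (spar a && par V v) * qp (2%:R^-1 * kwt V a v)).
Arguments kinv : clear implicits.
Arguments kpar : clear implicits.

Lemma copE V W a (X : mat F V V) (Y : mat F W W) :
  cop qp a X Y = madd (kron X (kinv W a)) (kron (kpar V a) Y).
Proof.
apply: matP => s t; rewrite /cop /gtens !kpowE /= mul1r /madd /kron /kinv /kpar mulrA.
congr (_ + _ * _); rewrite /mdiag; case: eqP => [-> | _] //; exact: mulr0.
Qed.

(** The sign comes from the parities of the two generators. The power of q comes
    from moving k_b^(1/2) across e_a in the first factor and k_a^(-1/2) across
    e'_b in the second. *)
Lemma kron_swap V W a b s (e : 'I_(m + n).-1 -> mat F V V) s' e' :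
  homog s e -> @homog W s' e' ->
  kron (e a) (kinv W a) ** kron (kpar V b) (e' b) =
  mscal ((-1) ^+ (spar a && spar b) * qp (- 2%:R^-1 * (s * cart F b a + s' * cart F a b)))
    (kron (kpar V b) (e' b) ** kron (e a) (kinv W a)).
Proof.
move=> He He'; apply: matP => x y.
rewrite /mscal !kronM /kron /kinv /kpar !(mdiag_mull, mdiag_mulr).
have [-> | e1] := eqVneq (e a x.1 y.1) 0; first by rewrite !(mul0r, mulr0).
have [-> | e2] := eqVneq (e' b x.2 y.2) 0; first by rewrite !(mul0r, mulr0).
rewrite (homog_kwt b He e1) (homog_kwt a He' e2) (He _ _ _ e1).1.
move: (kwt V b _) (kwt W a _) (cart F b a) (cart F a b) => h h' c c'.
rewrite !mulrDr !(qpD Hqp) !mulNr !(qpN Hqp).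
set A := qp (_ * h); set B := qp (_ * h').
set C := qp (_ * (s * _)); set D := qp (_ * (s' * _)).
have [A0 B0 C0 D0]: [/\ A != 0, B != 0, C != 0 & D != 0] by rewrite !(qp_neq0 Hqp).
case: (par V y.1) (spar a) (spar b) => [] [] [] /=; field; by rewrite ?A0 ?B0 ?C0 ?D0.
Qed.

(** The relations are homogeneous and the second factors are diagonal: all the
    monomials of a relation have the same second factor. *)
Lemma serre_kronl V W e d : serre qp e ->
  forall (x := fun a => @kron F V W V W (e a) (mdiag (d a))),
  [/\ forall a i j, spar a -> (x a ** x a) i j = 0,
      forall a b i j, (a.+1 < b)%N -> (x a ** x b) i j = (x b ** x a) i j,
      forall a b i j, ~~ spar a -> (a.+1 == b)%N || (b.+1 == a)%N ->
    (x a ** x a ** x b) i j - (qp 1 + (qp 1)^-1) * (x a ** x b ** x a) i j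
      + (x b ** x a ** x a) i j = 0
   & forall a b c i j, spar b -> (a.+1 == b)%N -> (b.+1 == c)%N ->
    (x b ** x a ** x b ** x c) i j + (x b ** x c ** x b ** x a) i j
      + (x a ** x b ** x c ** x b) i j + (x c ** x b ** x a ** x b) i j
      - (qp 1 + (qp 1)^-1) * (x b ** x a ** x c ** x b) i j = 0].
Proof.
case=> S1 S2 S3 S4 x; split.
- by move=> a i j sa; rewrite /x kronM /kron S1 // mul0r.
- by move=> a b i j ab; rewrite /x !kronM /kron S2 // mdiagC.
- move=> a b i j sa ab; have := S3 a b i.1 j.1 sa ab; rewrite /x !kronM /kron.
  rewrite (mdiagC (d b) (d a)) -(mmulA (mdiag (d a)) (mdiag (d b))) (mdiagC (d b) (d a)).
  rewrite mmulA => S; rewrite -[RHS](mul0r ((mdiag (d a) ** mdiag (d a) ** mdiag (d b)) i.2 j.2)).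
  by rewrite -S; ring.
- move=> a b c i j sb ab bc; have := S4 a b c i.1 j.1 sb ab bc; rewrite /x !kronM /kron.
  set D := mdiag (d b) ** _ ** _ ** mdiag (d c).
  have -> : mdiag (d b) ** mdiag (d c) ** mdiag (d b) ** mdiag (d a) = D.
    by rewrite /D !mdiagM; congr mdiag; apply: functional_extensionality => k; ring.
  have -> : mdiag (d a) ** mdiag (d b) ** mdiag (d c) ** mdiag (d b) = D.
    by rewrite /D !mdiagM; congr mdiag; apply: functional_extensionality => k; ring.
  have -> : mdiag (d c) ** mdiag (d b) ** mdiag (d a) ** mdiag (d b) = D.
    by rewrite /D !mdiagM; congr mdiag; apply: functional_extensionality => k; ring.
  have -> : mdiag (d b) ** mdiag (d a) ** mdiag (d c) ** mdiag (d b) = D.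
    by rewrite /D !mdiagM; congr mdiag; apply: functional_extensionality => k; ring.
  by move=> S; rewrite -[RHS](mul0r (D i.2 j.2)) -S; ring.
Qed.

Lemma serre_kronr V W e d : serre qp e ->
  forall (x := fun a => @kron F V W V W (mdiag (d a)) (e a)),
  [/\ forall a i j, spar a -> (x a ** x a) i j = 0,
      forall a b i j, (a.+1 < b)%N -> (x a ** x b) i j = (x b ** x a) i j,
      forall a b i j, ~~ spar a -> (a.+1 == b)%N || (b.+1 == a)%N ->
    (x a ** x a ** x b) i j - (qp 1 + (qp 1)^-1) * (x a ** x b ** x a) i j
      + (x b ** x a ** x a) i j = 0
   & forall a b c i j, spar b -> (a.+1 == b)%N -> (b.+1 == c)%N ->
    (x b ** x a ** x b ** x c) i j + (x b ** x c ** x b ** x a) i j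
      + (x a ** x b ** x c ** x b) i j + (x c ** x b ** x a ** x b) i j
      - (qp 1 + (qp 1)^-1) * (x b ** x a ** x c ** x b) i j = 0].
Proof.
move=> /(@serre_kronl W V e d)[S1 S2 S3 S4] x.
have xE a : x a = swapm (kron (e a) (mdiag (d a))) by rewrite swapm_kron.
split=> *; rewrite !xE !swapmM /swapm; [exact: S1 | exact: S2 | exact: S3 | exact: S4].
Qed.

Hypothesis two0 : 2%:R != 0 :> F.

(** Consecutive generators skew-commute by w = q^(s g), where g is the sign of
    the index they share, and an even generator skew-commutes with itself by
    w^(-2); an odd one anticommutes with itself, and distant ones commute. These are
    the constants of [cubic_skew] and [quartic_skew]. *)
Lemma serre_tens V W s e e' : s = 1 \/ s = -1 ->
  homog s e -> homog s e' -> serre qp e -> serre qp e' ->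
  @serre F qp m n (tens qp V W) (fun a => cop qp a (e a) (e' a)).
Proof.
move=> s1 He He' Se Se'.
have swapE a b := kron_swap a b He He'.
have [X1 X2 X3 X4] := @serre_kronl V W e (fun b v => qp (- 2%:R^-1 * kwt W b v)) Se.
have [Y1 Y2 Y3 Y4] := @serre_kronr V W e'
  (fun a v => (-1) ^+ (spar a && par V v) * qp (2%:R^-1 * kwt V a v)) Se'.
have swap_next a b : a.+1 == b ->
    kron (e a) (kinv W a) ** kron (kpar V b) (e' b) =
      mscal (qp (s * gsgn F (hi a))) (kron (kpar V b) (e' b) ** kron (e a) (kinv W a))
 /\ kron (e b) (kinv W b) ** kron (kpar V a) (e' a) =
      mscal (qp (s * gsgn F (hi a))) (kron (kpar V a) (e' a) ** kron (e b) (kinv W b)).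
  move=> ab; rewrite !swapE [spar b && _]andbC (spar_next ab) !mul1r.
  have [-> ->] := cart_next F ab.
  have -> : - 2%:R^-1 * (s * - gsgn F (hi a) + s * - gsgn F (hi a)) = s * gsgn F (hi a).
    by field; exact: two0.
  by split.
have swap_far a b : cart F a b = 0 -> cart F b a = 0 -> spar a && spar b = false ->
    kron (e a) (kinv W a) ** kron (kpar V b) (e' b) =
    kron (kpar V b) (e' b) ** kron (e a) (kinv W a).
  by move=> ab0 ba0 sab; rewrite swapE ab0 ba0 sab !mulr0 addr0 mulr0 (qp0 Hqp) mulr1 mscal1.
have swap_odd a : spar a ->
    kron (e a) (kinv W a) ** kron (kpar V a) (e' a) =
    mscal (-1) (kron (kpar V a) (e' a) ** kron (e a) (kinv W a)).
  move=> sa; rewrite swapE cart_self; have [-> ->] := gsgn_odd F sa.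
  by rewrite sa subrr !mulr0 addr0 mulr0 (qp0 Hqp) mulr1.
split => /=.
- move=> a i j sa; rewrite !copE !mmulDl !mmulDr (swap_odd _ sa) /madd /mscal.
  by rewrite X1 // Y1 //; ring.
- move=> a b i j ab; rewrite !copE !mmulDl !mmulDr.
  have [c1 c2] := cart_far F ab; have sab := spar_far ab.
  rewrite (swap_far a b) // (swap_far b a) 1?andbC // /madd X2 // Y2 //; ring.
- move=> a b i j sa ab; rewrite !copE.
  have [w [w0 qE saa sab sba]] : exists w, [/\ w != 0, qp 1 + (qp 1)^-1 = w + w^-1,
     kron (e a) (kinv W a) ** kron (kpar V a) (e' a) =
       mscal (w^-1 ^+ 2) (kron (kpar V a) (e' a) ** kron (e a) (kinv W a)),
     kron (e a) (kinv W a) ** kron (kpar V b) (e' b) =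
       mscal w (kron (kpar V b) (e' b) ** kron (e a) (kinv W a))
   & kron (e b) (kinv W b) ** kron (kpar V a) (e' a) =
       mscal w (kron (kpar V a) (e' a) ** kron (e b) (kinv W b))].
    exists (qp (s * gsgn F (lo a))); split; first exact: qp_neq0.
    + have [-> | ->] : s * gsgn F (lo a) = 1 \/ s * gsgn F (lo a) = -1.
        rewrite /gsgn; case: s1 => ->; case: (gpar (lo a)); rewrite ?expr1 ?expr0; [right|left|left|right]; ring.
      * by [].
      * by rewrite (qpN Hqp) invrK addrC.
    + rewrite swapE (negPf sa) mul1r cart_self -(gsgn_even F sa) -(qpN Hqp) expr2 -(qpD Hqp).
      by congr (mscal (qp _) _); field; exact: two0.
    + case/orP: ab => ab; first by have [-> _] := swap_next _ _ ab; rewrite (gsgn_even F sa).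
      by have [_ ->] := swap_next _ _ ab; rewrite (lo_next ab).
    + case/orP: ab => ab; first by have [_ ->] := swap_next _ _ ab; rewrite (gsgn_even F sa).
      by have [-> _] := swap_next _ _ ab; rewrite (lo_next ab).
  apply: (cubic_skew w0 qE saa sab sba) => i' j'; [exact: X3 | exact: Y3].
- move=> a b c i j sb ab bc; rewrite !copE.
  have [gl gh] := gsgn_odd F sb.
  have ac : (a.+1 < c)%N by lia.
  have [c1 c2] := cart_far F ac; have sac := spar_far ac.
  have [ab1 ab2] := swap_next _ _ ab; have [bc1 bc2] := swap_next _ _ bc.
  rewrite -(lo_next ab) gl mulr1 in ab1 ab2; rewrite gh mulrN1 in bc1 bc2.
  rewrite (qpN Hqp) in bc1 bc2.
  have qE : qp 1 + (qp 1)^-1 = qp s + (qp s)^-1.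
    by case: s1 => -> //; rewrite (qpN Hqp) invrK addrC.
  apply: (quartic_skew (qp_neq0 Hqp s) qE ab1 ab2 bc2 bc1).
  + exact: (swap_far _ _ c1 c2 sac).
  + exact: (swap_far _ _ c2 c1 (etrans (andbC _ _) sac)).
  + exact: swap_odd.
  + by apply: matP => x y; rewrite (X2 a c).
  + by apply: matP => x y; rewrite (Y2 a c).
  + by apply: matP => x y; rewrite X1 // /mscal mul0r.
  + by apply: matP => x y; rewrite Y1 // /mscal mul0r.
  + by move=> *; exact: X4.
  + by move=> *; exact: Y4.
Qed.

(** In the relation between raising and lowering generators the mixed terms
    cancel exactly, without any power of q, since the two weights are opposite;
    what remains is (k - k^-1) (x) k^-1 + k (x) (k - k^-1), up to
    q - q^-1. *)
Lemma tens_rep V W : is_rep qp V -> is_rep qp W -> is_rep qp (tens qp V W).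
Proof.
move=> rV rW.
have cop_homog s (e : 'I_(m + n).-1 -> mat F V V) (e' : 'I_(m + n).-1 -> mat F W W) :
  homog s e -> homog s e' -> @homog (tens qp V W) s (fun a => cop qp a (e a) (e' a)).
  move=> He He' a [i1 i2] [j1 j2]; rewrite copE /madd /kron /kinv /kpar /mdiag /=.
  have [-> | e1] := eqVneq (e a i1 j1) 0; have [-> | e2] := eqVneq (e' a i2 j2) 0.
  - by rewrite mul0r mulr0 addr0 eqxx.
  - rewrite mul0r add0r; case: (eqVneq i1 j1) => [<- _ | _]; last by rewrite mul0r eqxx.
    have [-> w2] := He' _ _ _ e2; split=> [|k]; first by rewrite addbA.
    by rewrite w2 addrA.
  - rewrite mulr0 addr0; case: (eqVneq i2 j2) => [<- _ | _]; last by rewrite mulr0 eqxx.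
    have [-> w1] := He _ _ _ e1; split=> [|k]; first by rewrite addbAC.
    by rewrite w1 addrAC.
  - case: (eqVneq i2 j2) => [<- _ | _].
      have [-> w1] := He _ _ _ e1; split=> [|k]; first by rewrite addbAC.
      by rewrite w1 addrAC.
    rewrite mulr0 add0r; case: (eqVneq i1 j1) => [<- _ | _]; last by rewrite mul0r eqxx.
    have [-> w2] := He' _ _ _ e2; split=> [|k]; first by rewrite addbA.
    by rewrite w2 addrA.
have Hu := cop_homog _ _ _ (homog_up rV) (homog_up rW).
have Hd := cop_homog _ _ _ (homog_dn rV) (homog_dn rW).
split.
- by move=> a i j /Hu[].
- by move=> a i j /Hd[].
- move=> k N a i j; rewrite (@wt_shiftK (tens qp V W) _ 1 a) ?mul1r //.
  by move=> i' j' /Hu[].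
- move=> k N a i j; rewrite (@wt_shiftK (tens qp V W) _ (-1) a) ?mulN1r ?opprB //.
  by move=> i' j' /Hd[].
- move=> a b i j.
  rewrite [up (tens qp V W) a]copE [dn (tens qp V W) b]copE !mmulDl !mmulDr.
  rewrite (kron_swap a b (homog_up rV) (homog_dn rW)).
  have := kron_swap b a (homog_dn rV) (homog_up rW).
  rewrite (cart_sym F a b) mulN1r mul1r subrr addNr mulr0 (qp0 Hqp) mulr1 [spar b && _]andbC.
  set c := (-1) ^+ _ => swE.
  have c2 : c * c = 1 by rewrite -expr2 sqrr_sign.
  have := rep_up_dn rV a b i.1 j.1; have := rep_up_dn rW a b i.2 j.2.
  rewrite swE /madd /mscal !kronM /kron -/c.
  rewrite /kinv /kpar (mdiagC (fun v => _ * qp (_ * kwt V b v))).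
  rewrite [mdiag (fun v => qp (_ * kwt W b v)) ** mdiag _]mdiagC.
  set D := mdiag _ ** mdiag _; set D' := mdiag _ ** mdiag _.
  move=> HW HV; rewrite -[RHS]addr0.
  transitivity (((up V a ** dn V b) i.1 j.1 - c * (dn V b ** up V a) i.1 j.1) * D i.2 j.2
    + D' i.1 j.1 * ((up W a ** dn W b) i.2 j.2 - c * (dn W b ** up W a) i.2 j.2)).
    ring: c2.
  rewrite HV HW {}/D {}/D' !mdiagM.
  have [<- | _] := eqVneq a b; last by rewrite !mul0r mulr0 add0r.
  have kt N : kpow qp (tens qp V W) a N i j = kpow qp V a N i.1 j.1 * kpow qp W a N i.2 j.2.
    rewrite !kpowE /mdiag -pair_eqE /pair_eq.
    have -> : kwt (tens qp V W) a i = kwt V a i.1 + kwt W a i.2 by rewrite /kwt /=; ring.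
    by rewrite mulrDr (qpD Hqp); case: eqP; case: eqP => _ _ /=; rewrite ?mulr0 ?mul0r.
  have -> : mdiag (fun v => qp (- 2%:R^-1 * kwt W a v) * qp (- 2%:R^-1 * kwt W a v))
      = kpow qp W a (-1).
    rewrite kpowE; congr mdiag; apply: functional_extensionality => v.
    by rewrite -(qpD Hqp); congr qp; field; exact: two0.
  have -> : mdiag (fun v => (-1) ^+ (spar a && par V v) * qp (2%:R^-1 * kwt V a v) *
        ((-1) ^+ (spar a && par V v) * qp (2%:R^-1 * kwt V a v))) = kpow qp V a 1.
    rewrite kpowE; congr mdiag; apply: functional_extensionality => v.
    rewrite mulrACA -signr_addb addbb expr0 !mul1r -(qpD Hqp); congr qp; field; exact: two0.
  rewrite !kt; ring.
- by apply: (@serre_tens V W 1 _ _ (or_introl erefl) (homog_up rV) (homog_up rW));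
    apply: rep_serre_up.
- by apply: (@serre_tens V W (-1) _ _ (or_intror erefl) (homog_dn rV) (homog_dn rW));
    apply: rep_serre_dn.
Qed.

End Reps.
Arguments kinv {F} qp {m n} V a _ _.
Arguments kpar {F} qp {m n} V a _ _.

(** * Genericity *)

Section Generic.
Variables (F : fieldType) (qp : F -> F) (alpha : F).
Hypothesis Hqp : is_qpow qp.
Hypothesis Hgen : generic qp alpha.

Lemma qpMn x k : qp (x * k%:R) = qp x ^+ k.
Proof.
elim: k => [|k IH]; first by rewrite mulr0 (qp0 Hqp).
by rewrite -addn1 natrD mulrDr mulr1 (qpD Hqp) IH exprD.
Qed.

Lemma generic_eval (P : {poly {poly int}}) : P != 0 ->
  (map_poly (map_poly (fun c : int => c%:~R : F)) P).[(qp alpha)%:P].[qp 1] != 0.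
Proof. by apply: contraNneq => /Hgen ->. Qed.

Lemma generic_neq a b c : 'X^a * ('X^b)%:P - ('X^c)%:P != 0 :> {poly {poly int}} ->
  qp alpha ^+ a * qp 1 ^+ b != qp 1 ^+ c.
Proof.
move=> /generic_eval.
suff -> : (map_poly (map_poly (fun c : int => c%:~R : F))
    ('X^a * ('X^b)%:P - ('X^c)%:P)).[(qp alpha)%:P].[qp 1] =
  qp alpha ^+ a * qp 1 ^+ b - qp 1 ^+ c by rewrite subr_eq0.
rewrite rmorphB rmorphM /= map_polyXn !map_polyC /= !map_polyXn.
by rewrite !hornerE /= ?hornerE.
Qed.

Lemma generic_char (k : int) : k != 0 -> k%:~R != 0 :> F.
Proof.
move=> k0; have := @generic_eval k%:P%:P; rewrite !polyC_eq0 => /(_ k0).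
by rewrite !map_polyC /= map_polyC /= !hornerC.
Qed.

Lemma generic_natr k : (0 < k)%N -> k%:R != 0 :> F.
Proof. by move=> k0; have := @generic_char k%:Z; rewrite -pmulrn; apply; lia. Qed.

Lemma generic_qk k : (0 < k)%N -> qp k%:R != 1.
Proof.
move=> k0; have H : 'X^0 * ('X^k)%:P - ('X^0)%:P != 0 :> {poly {poly int}}.
  rewrite !expr0 mul1r -polyCB polyC_eq0; apply/eqP => /(congr1 (fun p => p.[0])).
  by rewrite !hornerE expr0n -[k]prednK.
by have := generic_neq H; rewrite !expr0 mul1r -qpMn mul1r.
Qed.

Lemma generic_q1 : qp 1 != 1.
Proof. exact: (@generic_qk 1). Qed.

Lemma generic_qsym : qp 1 - qp (-1) != 0.
Proof.
apply: contra (@generic_qk 2 isT); rewrite subr_eq0 => /eqP q1.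
have -> : 2%:R = 1 + 1 :> F by ring.
by rewrite (qpD Hqp) {1}q1 -(qpD Hqp) addNr (qp0 Hqp).
Qed.

(** The polynomial relation expressing that this power of q is 1 is nonzero for
    either sign of b, since only one of its two terms involves q ^ alpha. *)
Lemma generic_alpha a (b : int) : (0 < a)%N -> qp (alpha * a%:R + b%:~R) != 1.
Proof.
move=> a0; rewrite (qpD Hqp) qpMn.
have Pn0 (R : comNzRingType) (c d : R) : d != 0 -> 'X^a * c%:P - d%:P != 0 :> {poly R}.
  move=> d0; apply/eqP => /(congr1 (fun p => p.[0])); rewrite !hornerE expr0n.
  by rewrite -[a]prednK //= ?mul0r ?mulr0 ?sub0r => /eqP; rewrite oppr_eq0 (negPf d0).
case: b => b.
  have H := Pn0 _ ('X^b) 1 (oner_neq0 {poly int}).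
  by have := @generic_neq a b 0 H; rewrite expr0 -(qpMn 1) mul1r -pmulrn.
rewrite NegzE rmorphN /= (qpN Hqp) -pmulrn -[b.+1%:R]mul1r qpMn.
have H : 'X^(b.+1) != 0 :> {poly int} by rewrite expf_neq0 // polyX_eq0.
apply: contra (@generic_neq a 0 b.+1 (Pn0 _ 1 _ H)); rewrite expr0 mulr1.
by move=> /eqP/(canRL (mulfVK _)) ->; rewrite ?mul1r // expf_neq0 // (qp_neq0 Hqp).
Qed.

End Generic.

(** * Irreducible representations *)

Section Mapp.
Variables (F : fieldType) (B : finType).
Implicit Types (X Y : mat F B B) (v : {ffun B -> F^o}).

Lemma mapp_linear X : linear (mapp X).
Proof.
move=> c u v; apply/ffunP => i; rewrite !ffunE scaler_sumr -big_split.
by apply: eq_bigr => j _; rewrite !ffunE mulrDr mulrCA.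
Qed.
HB.instance Definition _ X :=
  GRing.isLinear.Build F {ffun B -> F^o} {ffun B -> F^o} _ (mapp X) (mapp_linear X).

Lemma mappM X Y v : mapp (X ** Y) v = mapp X (mapp Y v).
Proof.
apply/ffunP => i; rewrite !ffunE /mmul.
under eq_bigr => j _ do rewrite mulr_suml.
rewrite exchange_big; apply: eq_bigr => k _; rewrite ffunE mulr_sumr.
by apply: eq_bigr => j _; rewrite mulrA.
Qed.

Lemma mapp_diag d v i : mapp (mdiag d) v i = d i * v i.
Proof.
rewrite ffunE (bigD1 i) //= /mdiag eqxx big1 ?addr0 // => j.
by rewrite eq_sym => /negPf ->; rewrite mul0r.
Qed.

Definition delta (x : B) : {ffun B -> F^o} := [ffun y => (y == x)%:R].

Lemma mapp_delta X x : mapp X (delta x) = [ffun i => X i x].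
Proof.
apply/ffunP => i; rewrite !ffunE (bigD1 x) //= ffunE eqxx mulr1 big1 ?addr0 // => j.
by rewrite ffunE => /negPf ->; rewrite mulr0.
Qed.

Lemma delta_neq0 x : delta x != 0.
Proof. by apply/eqP => /ffunP/(_ x)/eqP; rewrite !ffunE eqxx oner_eq0. Qed.
End Mapp.

Section Irreducible.
Variables (F : fieldType) (qp : F -> F) (m n : nat) (V : gmod F m n).
Hypothesis irrV : irreducible qp V.

(** The kernel of M is a subrepresentation. *)
Lemma irreducible_kernel (M : mat F V V) (v0 : {ffun V -> F^o}) :
  (forall v a, mapp M v = 0 -> mapp M (mapp (up V a) v) = 0) ->
  (forall v a, mapp M v = 0 -> mapp M (mapp (dn V a) v) = 0) ->
  (forall v i N, mapp M v = 0 -> mapp M (mapp (Kpow qp V i N) v) = 0) ->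
  v0 != 0 -> mapp M v0 = 0 -> forall i j, M i j = 0.
Proof.
move=> Mu Md MK v00 Mv0 i j; pose H := lker (linfun (mapp M)).
have inH v : (v \in H) = (mapp M v == 0) by rewrite memv_ker lfunE.
have [v | H0 | HT] := irrV (H := H).
- rewrite inH => /eqP Mv; split=> [a|a|k N]; rewrite inH; apply/eqP;
    [exact: Mu | exact: Md | exact: MK].
- have : v0 \in H by rewrite inH Mv0.
  by rewrite H0 memv0 (negPf v00).
- have : delta F j \in H by rewrite HT memvf.
  by rewrite inH mapp_delta => /eqP/ffunP/(_ i); rewrite !ffunE.
Qed.

(** The known eigenvector, the basis vector x, replaces the assumption that F be
    algebraically closed. *)
Lemma schur (T : mat F V V) (t : F) (x : V) :
  (forall a, T ** up V a = up V a ** T) -> (forall a, T ** dn V a = dn V a ** T) ->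
  (forall i N, T ** Kpow qp V i N = Kpow qp V i N ** T) ->
  (forall y, T y x = (y == x)%:R * t) -> T = mdiag (fun _ => t).
Proof.
move=> Tu Td TK Tx; pose M : mat F V V := fun i j => T i j - mdiag (fun _ => t) i j.
have comm X v : T ** X = X ** T -> mapp M v = 0 -> mapp M (mapp X v) = 0.
  move=> TX Mv; rewrite -mappM; have -> : M ** X = X ** M; last by rewrite mappM Mv linear0.
  have ME : M = madd T (mscal (-1) (mdiag (fun _ => t))).
    by apply: matP => i j; rewrite /madd /mscal mulN1r.
  rewrite ME mmulDl mmulDr TX mscalAl mscalAr; congr (madd _ (mscal _ _)).
  by apply: matP => i j; rewrite mdiag_mull mdiag_mulr mulrC.
have M0 := @irreducible_kernel M (delta F x) (fun v a => comm _ v (Tu a))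
  (fun v a => comm _ v (Td a)) (fun v i N => comm _ v (TK i N)) (delta_neq0 F x).
apply: matP => i j; apply/eqP; rewrite -subr_eq0; apply/eqP/M0.
apply/ffunP => k; rewrite mapp_delta !ffunE /M Tx /mdiag.
by case: eqP; rewrite ?mul1r ?mul0r subrr.
Qed.

Hypothesis Hqp : is_qpow qp.
Hypothesis repV : is_rep qp V.
Variable alpha : F.
Hypothesis Hgen : generic qp alpha.
Hypothesis hwV : has_highest_weight alpha V.

Let arrow (x y : V) := [exists a, (up V a y x != 0) || (dn V a y x != 0)].

Let nontriv : qp 1 != 1 := generic_q1 Hqp Hgen.

(** The basis vectors reachable from x0 span a subrepresentation. *)
Lemma weight_connected x0 x : connect arrow x0 x.
Proof.
pose M : mat F V V := mdiag (fun y => (~~ connect arrow x0 y)%:R).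
have ker v : (mapp M v = 0) <-> (forall y, ~~ connect arrow x0 y -> v y = 0).
  split=> [/ffunP Mv y ny | vS].
    by have := Mv y; rewrite mapp_diag ffunE ny mul1r.
  apply/ffunP => y; rewrite mapp_diag ffunE.
  by case cy: (connect _ _ _); rewrite ?mul0r // vS ?mulr0 // cy.
have step (X : mat F V V) v : (forall y z, X y z != 0 -> connect arrow z y) ->
    mapp M v = 0 -> mapp M (mapp X v) = 0.
  move=> XA /ker vS; apply/ker => y ny; rewrite ffunE big1 // => z _.
  have [-> | Xyz] := eqVneq (X y z) 0; first by rewrite mul0r.
  rewrite vS ?mulr0 //; apply: contra ny => /connect_trans; apply; exact: XA.
suff /(_ x x) : forall i j, M i j = 0.
  by rewrite /M /mdiag eqxx; case: (connect _ _ _) => //= /eqP; rewrite oner_eq0.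
apply: (@irreducible_kernel M (delta F x0)).
- move=> v a; apply: step => y z uyz; apply/connect1/existsP; exists a; by rewrite uyz.
- move=> v a; apply: step => y z uyz; apply/connect1/existsP; exists a; by rewrite uyz orbT.
- move=> v i N; apply: step => y z; rewrite /Kpow /mdiag; case: (y =P z) => [-> // | _].
  by rewrite eqxx.
- exact: delta_neq0.
- by apply/ker => y; rewrite ffunE; case: eqP => // ->; rewrite connect0.
Qed.

Lemma weight_int x0 x : exists c : 'I_(m + n) -> int,
  forall k, wt V x k = wt V x0 k + (c k)%:~R.
Proof.
have /connectP[p] := weight_connected x0 x; elim: p x0 => [|y p IH] x0 /=.
  by move=> _ ->; exists (fun _ => 0) => k; rewrite addr0.
case/andP=> /existsP[a xy] /IH{}IH /IH[c cE].
suff [s sE] : exists s : int, forall k, wt V y k = wt V x0 k + s%:~R * sroot F a k.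
  exists (fun k => s * ((k == lo a)%:R - (k == hi a)%:R) + c k) => k.
  by rewrite cE sE rmorphD rmorphM rmorphB /= !rmorph_nat addrA.
by case/orP: xy => e0; [exists 1 | exists (-1)] => k;
  [rewrite (up_wt Hqp nontriv repV e0) | rewrite (dn_wt Hqp nontriv repV e0)];
  rewrite ?rmorphN rmorph1.
Qed.

Lemma highest_basis : exists x0 : V, forall k, wt V x0 k = if gpar k then alpha else 0.
Proof.
have [v v0 [_ wv]] := hwV.
have [x vx] : exists x, v x != 0.
  apply/existsP; apply: contraR v0; rewrite negb_exists => /forallP v0.
  by apply/eqP/ffunP => x; rewrite ffunE; apply/eqP; have := v0 x; rewrite negbK.
by exists x => k; apply: (mulIf vx).
Qed.

Lemma kwt_odd a : spar a -> forall x, exists c : int, kwt V a x = alpha + c%:~R.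
Proof.
move=> sa x; have [x0 x0E] := highest_basis; have [c cE] := weight_int x0 x.
rewrite /kwt !cE !x0E; have [-> ->] := gsgn_odd F sa.
have [-> ->] : gpar (lo a) = false /\ gpar (hi a).
  by move: sa; rewrite /spar /gpar /=; lia.
by exists (c (lo a) + c (hi a)); rewrite rmorphD /=; ring.
Qed.

(** A linear form equal to 1 on each simple root. *)
Let height (w : 'I_(m + n) -> F) : F := - \sum_(k < m + n) (k : nat)%:R * w k.

Lemma height_pos_diff w w' : pos_diff w w' ->
  exists2 c : int, 0 < c & height w = height w' + c%:~R.
Proof.
case=> c [a0 ca0] wE; exists (\sum_a c a : nat)%:Z.
  rewrite ltz_nat lt0n; apply: contra ca0; rewrite sum_nat_eq0 => /forallP/(_ a0).
  by [].
have deltaE (l : 'I_(m + n)) : \sum_(k < m + n) (k : nat)%:R * (k == l)%:R = (l : nat)%:R :> F.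
  by rewrite (bigD1 l) //= eqxx mulr1 big1 ?addr0 // => k /negPf ->; rewrite mulr0.
have rootE (a : 'I_(m + n).-1) :
    \sum_(k < m + n) (k : nat)%:R * ((k == lo a)%:R - (k == hi a)%:R) = -1 :> F.
  under eq_bigr => k _ do rewrite mulrBr.
  by rewrite sumrB !deltaE /= -[a.+1]addn1 natrD; ring.
apply: (addIr (- height w')); rewrite addrAC subrr add0r.
rewrite /height -opprD -sumrB.
transitivity (- \sum_(k < m + n) \sum_a (c a)%:R * ((k : nat)%:R * ((k == lo a)%:R - (k == hi a)%:R)) : F).
  congr (- _); apply: eq_bigr => k _; rewrite -mulrBr wE mulr_sumr.
  by apply: eq_bigr => a _; rewrite mulrCA.
rewrite exchange_big -sumrN /= -pmulrn natr_sum; apply: eq_bigr => a _.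
by rewrite -mulr_sumr rootE mulrN1 opprK.
Qed.

(** Heights live in F, which is not ordered; their differences on V are
    integers, and this is enough to compare them. *)
Lemma relative_height : exists h : V -> int, forall x y c,
  height (wt V x) = height (wt V y) + c%:~R -> h x = h y + c.
Proof.
have [x0 _] := highest_basis.
have hP x : exists c : int, height (wt V x) == height (wt V x0) + c%:~R.
  have [c cE] := weight_int x0 x; exists (- \sum_(k < m + n) (k : nat)%:R * c k).
  rewrite /height rmorphN rmorph_sum /= -opprD -big_split; apply/eqP; congr (- _).
  by apply: eq_bigr => k _; rewrite cE rmorphM /= rmorph_nat mulrDr.
exists (fun x => xchoose (hP x)) => x y c.
have := eqP (xchooseP (hP x)); have := eqP (xchooseP (hP y)).
move: (xchoose (hP x)) (xchoose (hP y)) => hx hy -> ->; rewrite -addrA -rmorphD => /addrI/eqP.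
rewrite -subr_eq0 -rmorphB /=; apply: contraTeq; rewrite -subr_eq0.
by move=> h0; apply: (generic_char Hgen h0).
Qed.

Lemma exists_maximal : exists x : V, forall y, ~ pos_diff (wt V y) (wt V x).
Proof.
have [x0 _] := highest_basis; have [h hP] := relative_height.
case: (@Order.TotalTheory.arg_maxP _ _ _ x0 predT h isT) => x _ hx.
exists x => y /height_pos_diff[c c0 /hP hy].
by have := hx y isT; rewrite hy; lia.
Qed.

Lemma exists_minimal : exists x : V, forall y, ~ pos_diff (wt V x) (wt V y).
Proof.
have [x0 _] := highest_basis; have [h hP] := relative_height.
case: (@Order.TotalTheory.arg_minP _ _ _ x0 predT h isT) => x _ hx.
exists x => y /height_pos_diff[c c0 /hP hy].
by have := hx y isT; rewrite hy; lia.
Qed.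
End Irreducible.

(** * Partial traces *)

Section PartialTrace.
Variables (F : fieldType) (A B : finType).
Implicit Types (M N : mat F A A) (Y : mat F B B) (X : mat F (A * B)%type (A * B)%type).

(** The trace over the first factor of (M (x) 1) X. *)
Definition ptr M X : mat F B B := fun i j => \sum_c \sum_d M c d * X (d, i) (c, j).

Lemma kronl_mul N X s t : (kron N (mone F B) ** X) s t = \sum_d N s.1 d * X (d, s.2) t.
Proof.
rewrite /mmul sum_pair.
apply: eq_bigr => d _; rewrite (bigD1 s.2) //= /kron /mone /mdiag /= eqxx mulr1.
by rewrite big1 ?addr0 // => k; rewrite eq_sym => /negPf ->; rewrite mulr0 mul0r.
Qed.

Lemma kronl_mulr N X s t : (X ** kron N (mone F B)) s t = \sum_d X s (d, t.2) * N d t.1.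
Proof.
rewrite /mmul sum_pair.
apply: eq_bigr => d _; rewrite (bigD1 t.2) //= /kron /mone /mdiag /= eqxx mulr1.
by rewrite big1 ?addr0 // => k /negPf ->; rewrite !mulr0.
Qed.

Lemma kronr_mul Y X s t : (kron (mone F A) Y ** X) s t = \sum_k Y s.2 k * X (s.1, k) t.
Proof.
rewrite /mmul sum_pair.
rewrite (bigD1 s.1) //= [X in _ + X]big1 ?addr0 => [|d].
  by apply: eq_bigr => k _; rewrite /kron /mone /mdiag eqxx mul1r.
rewrite eq_sym => /negPf ds; apply: big1 => k _.
by rewrite /kron /mone /mdiag /= ds !mul0r.
Qed.

Lemma kronr_mulr Y X s t : (X ** kron (mone F A) Y) s t = \sum_k X s (t.1, k) * Y k t.2.
Proof.
rewrite /mmul sum_pair.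
rewrite (bigD1 t.1) //= [X in _ + X]big1 ?addr0 => [|d].
  by apply: eq_bigr => k _; rewrite /kron /mone /mdiag eqxx mul1r.
move=> /negPf ds; apply: big1 => k _.
by rewrite /kron /mone /mdiag /= ds mul0r mulr0.
Qed.

Lemma ptr_mull M N X : ptr M (kron N (mone F B) ** X) = ptr (M ** N) X.
Proof.
apply: matP => i j; rewrite /ptr; apply: eq_bigr => c _.
under eq_bigr => d _ do rewrite kronl_mul mulr_sumr.
rewrite exchange_big; apply: eq_bigr => d _; rewrite /mmul mulr_suml.
by apply: eq_bigr => k _; rewrite mulrA.
Qed.

Lemma ptr_mulr M N X : ptr M (X ** kron N (mone F B)) = ptr (N ** M) X.
Proof.
apply: matP => i j; rewrite /ptr exchange_big [RHS]exchange_big.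
apply: eq_bigr => d _ /=.
under eq_bigr => c _ do rewrite kronl_mulr mulr_sumr.
rewrite exchange_big; apply: eq_bigr => c _; rewrite /mmul mulr_suml.
by apply: eq_bigr => k _; ring.
Qed.

Lemma ptr_kronr_mul M Y X : Y ** ptr M X = ptr M (kron (mone F A) Y ** X).
Proof.
apply: matP => i j; rewrite [LHS]/mmul /ptr.
under eq_bigr => k _ do rewrite mulr_sumr.
rewrite exchange_big; apply: eq_bigr => c _.
under eq_bigr => k _ do rewrite mulr_sumr.
rewrite exchange_big; apply: eq_bigr => d _.
by rewrite kronr_mul mulr_sumr; apply: eq_bigr => k _; rewrite mulrCA.
Qed.

Lemma ptr_kronr_mulr M Y X : ptr M X ** Y = ptr M (X ** kron (mone F A) Y).
Proof.
apply: matP => i j; rewrite [LHS]/mmul /ptr.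
under eq_bigr => k _ do rewrite mulr_suml.
rewrite exchange_big; apply: eq_bigr => c _.
under eq_bigr => k _ do rewrite mulr_suml.
rewrite exchange_big; apply: eq_bigr => d _.
by rewrite kronr_mulr mulr_sumr; apply: eq_bigr => k _; rewrite mulrA.
Qed.

Lemma ptrD M X X' : ptr M (madd X X') = madd (ptr M X) (ptr M X').
Proof.
apply: matP => i j; rewrite /madd /ptr -big_split; apply: eq_bigr => c _.
by rewrite -big_split; apply: eq_bigr => d _; rewrite mulrDr.
Qed.

Lemma kron_split (N : mat F A A) Y : kron N Y = kron N (mone F B) ** kron (mone F A) Y.
Proof. by rewrite kronM mulmat1 mul1mat. Qed.

Lemma kron_splitr (N : mat F A A) Y : kron N Y = kron (mone F A) Y ** kron N (mone F B).
Proof. by rewrite kronM mulmat1 mul1mat. Qed.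

(** The quantum partial trace of an intertwiner X is an intertwiner. To move e'
    across the trace, write 1 (x) e' as h^-1 (x) 1 times the difference of the
    coproduct e (x) g + h (x) e', which commutes with X, and of e (x) g. The
    terms in e cancel by cyclicity in the first factor, after g has been moved
    to the other side at the expense of gt. The condition that gt D / h be
    constant along the nonzero entries of e is what makes them cancel; closing
    matrices are chosen to satisfy it. *)
Lemma ptr_comm (e : mat F A A) (e' : mat F B B) (D h gt : A -> F) (g : B -> F) X :
  (forall i, h i != 0) -> (forall i, gt i != 0) ->
  (forall i j, e i j != 0 -> gt i * (D i / h i) = gt j * (D j / h j)) ->
  X ** kron (mdiag gt) (mdiag g) = kron (mdiag gt) (mdiag g) ** X ->
  X ** madd (kron e (mdiag g)) (kron (mdiag h) e') =
    madd (kron e (mdiag g)) (kron (mdiag h) e') ** X ->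
  ptr (mdiag D) X ** e' = e' ** ptr (mdiag D) X.
Proof.
move=> h0 gt0 De XG XE.
set hi := mdiag (fun i => (h i)^-1); set gi := mdiag (fun i => (gt i)^-1).
have hV : mdiag h ** hi = mone F A := mdiagV h0.
have Vh := mmul1C hV.
have gV : mdiag gt ** gi = mone F A := mdiagV gt0.
pose E := mdiag D ** hi.
have hD : hi ** mdiag D = E by rewrite /E mdiagC.
have lhs : ptr (mdiag D) X ** e' = ptr E (X ** kron (mdiag h) e').
  rewrite -hD -ptr_mulr -mmulA kronM mulmat1 hV; exact: ptr_kronr_mulr.
have rhs : e' ** ptr (mdiag D) X = ptr E (kron (mdiag h) e' ** X).
  rewrite /E -ptr_mull mmulA kronM mul1mat Vh; exact: ptr_kronr_mul.
have eg1 : ptr E (kron e (mdiag g) ** X) = mdiag g ** ptr (E ** e) X.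
  by rewrite kron_split -mmulA ptr_mull -ptr_kronr_mul.
have eg2 : ptr E (X ** kron e (mdiag g)) = ptr (e ** E) X ** mdiag g.
  by rewrite kron_splitr mmulA ptr_mulr -ptr_kronr_mulr.
have shift M : ptr M X ** mdiag g = mdiag g ** ptr (gi ** M ** mdiag gt) X.
  have -> : ptr M X ** mdiag g = ptr M (kron (mdiag gt) (mdiag g) ** X ** kron gi (mone F B)).
    by rewrite -XG -mmulA kronM gV mulmat1 -ptr_kronr_mulr.
  by rewrite ptr_mulr kron_split -(mmulA (kron _ _)) ptr_mull -ptr_kronr_mul.
have EE : gi ** (e ** E) ** mdiag gt = E ** e.
  apply: matP => i j; rewrite mdiag_mulr mdiag_mull /E mdiagM mdiag_mull mdiag_mulr.
  have [-> | e0] := eqVneq (e i j) 0; first by rewrite !(mul0r, mulr0).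
  apply: (mulfI (gt0 i)); rewrite [RHS]mulrA (De _ _ e0).
  by field; rewrite h0 gt0.
have : ptr E (X ** madd (kron e (mdiag g)) (kron (mdiag h) e')) =
       ptr E (madd (kron e (mdiag g)) (kron (mdiag h) e') ** X) by rewrite XE.
rewrite mmulDl mmulDr !ptrD -lhs -rhs eg1 eg2 shift EE => XE'.
apply: matP => i j; have := congr1 (fun Z : mat F B B => Z i j) XE'.
by rewrite /madd => /addrI.
Qed.
End PartialTrace.

Section Triple.
Variables (F : fieldType) (B : finType).
Definition on12 (X : mat F (B * B)%type (B * B)%type) :
  mat F (B * B * B)%type (B * B * B)%type := kron X (mone F B).
Definition on23 (X : mat F (B * B)%type (B * B)%type) :
    mat F (B * B * B)%type (B * B * B)%type :=
  fun s t => if s.1.1 == t.1.1 then X (s.1.2, s.2) (t.1.2, t.2) else 0.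
End Triple.

(** * The braiding of V with itself *)

Section RMatrix.
Variables (F : fieldType) (qp : F -> F) (alpha : F) (m n : nat).
Variables (R : univ_family F m n) (V : gmod F m n) (z : F).
Arguments R : clear implicits.
Hypotheses (Hqp : is_qpow qp) (Hgen : generic qp alpha) (HR : universal_R qp R).
Hypotheses (repV : is_rep qp V) (z0 : z != 0).

Let X := Rcheck R V z.
Let sg (s : V * V) : F := (-1) ^+ (par V s.1 && par V s.2).
Let sw (s : V * V) : V * V := (s.2, s.1).

Let swK s : sw (sw s) = s. Proof. by case: s. Qed.
Let sgK s : sg s * sg s = 1. Proof. by rewrite /sg -signr_addb addbb. Qed.
Let sg_sw s : sg (sw s) = sg s. Proof. by rewrite /sg /= andbC. Qed.

Lemma RcheckE s t : X s t = z * (sg s * R V V (sw s) t). Proof. by []. Qed.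

Lemma Rcheck_neq0 s t : X s t != 0 -> R V V (sw s) t != 0.
Proof. by apply: contraNneq => R0; rewrite RcheckE R0 !mulr0. Qed.

Lemma Rcheck_par s t : X s t != 0 -> par V s.1 (+) par V s.2 = par V t.1 (+) par V t.2.
Proof. by move/Rcheck_neq0/(uR_even HR repV repV) => <- /=; rewrite addbC. Qed.

Lemma Rcheck_wt s t : X s t != 0 ->
  forall k, wt V s.1 k + wt V s.2 k = wt V t.1 k + wt V t.2 k.
Proof.
move/Rcheck_neq0 => R0 k; have [<- | st] := eqVneq (sw s) t; first by rewrite addrC.
have [_ _ /(_ k) /= wE] := uR_triangular HR repV repV (elimN eqP st) R0.
by rewrite -[wt V t.1 k](subrK (wt V s.2 k)) wE; ring.
Qed.

(** R exchanges the coproduct with the opposite one, and so does the graded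
    flip. *)
Lemma Rcheck_cop a (e : mat F V V) :
  (forall i j, e i j != 0 -> par V i = par V j (+) spar a) ->
  (forall s t, (R V V ** cop qp a e e) s t = (cop_op qp a e e ** R V V) s t) ->
  X ** cop qp a e e = cop qp a e e ** X.
Proof.
move=> pe RE; apply: matP => s t.
transitivity (z * (sg s * (R V V ** cop qp a e e) (sw s) t)).
  by rewrite /mmul !mulr_sumr; apply: eq_bigr => u _; rewrite RcheckE; ring.
rewrite RE {1}/mmul [RHS](reindex sw) /=; last by exists sw => u _; rewrite swK.
rewrite !mulr_sumr; apply: eq_bigr => u _; rewrite RcheckE sg_sw swK.
suff -> : cop_op qp a e e (sw s) u = sg s * (cop qp a e e s (sw u) * sg u).
  by rewrite -[RHS]mul1r -(sgK s); ring.
rewrite /cop_op /cop /gtens /sg /sw /= !mul1r mulrDl mulrDr; congr (_ + _).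
- rewrite kpowE // /mdiag; case: eqP => [-> | _]; last by rewrite !(mul0r, mulr0).
  have [-> | e0] := eqVneq (e s.1 u.2) 0; first by rewrite !(mul0r, mulr0).
  rewrite (pe _ _ e0); set c := qp _.
  by case: (par V u.1) (par V u.2) (spar a) => [] [] []; rewrite /=; ring.
- rewrite kpowE // /mdiag; case: eqP => [-> | _]; last by rewrite !(mul0r, mulr0).
  have [-> | e0] := eqVneq (e s.2 u.1) 0; first by rewrite !(mul0r, mulr0).
  rewrite (pe _ _ e0); set c := qp _.
  by case: (par V u.1) (par V u.2) (spar a) => [] [] []; rewrite /=; ring.
Qed.

Lemma Rcheck_up a : X ** cop qp a (up V a) (up V a) = cop qp a (up V a) (up V a) ** X.
Proof. by apply: Rcheck_cop => [i j|s t]; [exact: (rep_up_par repV) | exact: (uR_up HR)]. Qed.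

Lemma Rcheck_dn a : X ** cop qp a (dn V a) (dn V a) = cop qp a (dn V a) (dn V a) ** X.
Proof. by apply: Rcheck_cop => [i j|s t]; [exact: (rep_dn_par repV) | exact: (uR_dn HR)]. Qed.

Definition Rcheck_inv : mat F (V * V)%type (V * V)%type :=
  fun s t => z^-1 * (minv (R V V) s (sw t) * sg t).

Lemma Rcheck_invP : X ** Rcheck_inv = mone F (V * V)%type.
Proof.
have RV := mulmatV (uR_unit HR repV repV).
apply: matP => s t; transitivity (sg s * sg t * mone F (V * V)%type (sw s) (sw t)).
  rewrite -RV /mmul mulr_sumr; apply: eq_bigr => u _; rewrite RcheckE /Rcheck_inv.
  by field; exact: z0.
rewrite /mone /mdiag (can_eq swK); case: eqP => [-> | _]; last by rewrite mulr0.
by rewrite mulr1 sgK.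
Qed.

Lemma minv_Rcheck : minv X = Rcheck_inv. Proof. exact: minv_eq Rcheck_invP. Qed.

Lemma Rcheck_hom : @is_hom F qp m n (tens qp V V) (tens qp V V) X.
Proof.
split.
- by move=> s t /Rcheck_par.
- move=> k N s t; rewrite mdiag_mull mdiag_mulr.
  have [-> | x0] := eqVneq (X s t) 0; first by rewrite mulr0 mul0r.
  by rewrite /= (Rcheck_wt x0) mulrC.
- by move=> a s t; rewrite /= Rcheck_up.
- by move=> a s t; rewrite /= Rcheck_dn.
Qed.

Let rot (s : V * V * V) : V * V * V := (s.1.2, s.2, s.1.1).
Let rotV (s : V * V * V) : V * V * V := (s.2, s.1.1, s.1.2).
Let rotK s : rotV (rot s) = s. Proof. by case: s => -[]. Qed.
Let rotVK s : rot (rotV s) = s. Proof. by case: s => -[]. Qed.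
Let eps (s : V * V * V) : F := (-1) ^+ (par V s.1.1 && (par V s.1.2 (+) par V s.2)).

(** By quasitriangularity, R on (V (x) V) (x) V followed by the flip is the third
    strand passed across the first two. The sign [eps] is that of the flip; it
    matches the signs of the two braidings because R is even. *)
Lemma Rcheck_on12_on23 s t :
  (on12 X ** on23 X) s t = z ^+ 2 * (eps s * R (tens qp V V) V (rot s) t).
Proof.
rewrite (uR_tensl HR repV repV repV) /mmul !sum_pair /=.
transitivity (\sum_w on12 X s (t.1.1, w, s.2) * on23 X (t.1.1, w, s.2) t).
  rewrite (bigD1 t.1.1) //= [X in _ + X]big1 ?addr0; last first.
    by move=> x /negPf xt; apply: big1 => y _; apply: big1 => w _; rewrite /on23 /= xt mulr0.
  apply: eq_bigr => y _; rewrite (bigD1 s.2) //= [X in _ + X]big1 ?addr0 // => w /negPf ws.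
  by rewrite /on12 /kron /mone /mdiag /= eq_sym ws mulr0 mul0r.
symmetry; rewrite (bigD1 t.1.1) //= [X in _ + X]big1 ?addr0; last first.
  by move=> x /negPf xt; apply: big1 => y _; apply: big1 => w _; rewrite /= xt mulr0.
rewrite (bigD1 s.2) //= [X in _ + X]big1 ?addr0; last first.
  by move=> y /negPf ys; apply: big1 => w _; rewrite /= eq_sym ys mul0r.
rewrite !mulr_sumr; apply: eq_bigr => w _.
rewrite /on12 /on23 /kron /mone /mdiag /= !eqxx mulr1 !RcheckE /sw /=.
have [-> | R0] := eqVneq (R V V (s.1.2, s.1.1) (t.1.1, w)) 0.
  by rewrite !(mul0r, mulr0).
have := uR_even HR repV repV R0; rewrite /= /sg /eps /=.
by case: (par V s.1.1) (par V s.1.2) (par V s.2) (par V t.1.1) (par V w) =>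
  [] [] [] [] [] //= _; ring.
Qed.

(** The naturality of R on (V (x) V) (x) V for the intertwiner Rcheck (x) 1. *)
Lemma Rcheck_braid : on12 X ** on23 X ** on12 X = on23 X ** on12 X ** on23 X.
Proof.
have two0 : 2%:R != 0 :> F := generic_natr Hgen (isT : (0 < 2)%N).
have rVV := tens_rep Hqp (generic_q1 Hqp Hgen) two0 repV repV.
have id_hom : @is_hom F qp m n V V (mone F V).
  split=> [i j | k N i j | a i j | a i j]; rewrite ?mul1mat ?mulmat1 //.
  by rewrite /mone /mdiag; case: (i =P j) => [-> // | _]; rewrite eqxx.
have nat12 s t : (R (tens qp V V) V ** on12 X) s t = (on12 X ** R (tens qp V V) V) s t.
  exact: (uR_natural HR rVV rVV repV repV Rcheck_hom id_hom).
have mE (T : finType) (A B : mat F T T) s t : (A ** B) s t = \sum_u A s u * B u t by [].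
apply: matP => s t; rewrite -mmulA.
transitivity (z ^+ 2 * (eps s * (R (tens qp V V) V ** on12 X) (rot s) t)).
  rewrite mmulA [LHS]mE [in RHS]mE !mulr_sumr; apply: eq_bigr => u _.
  by rewrite Rcheck_on12_on23; ring.
rewrite nat12 -[in RHS]mmulA [RHS]mE [in LHS]mE (reindex rot) /=; last first.
  by exists rotV => u _; rewrite ?rotK ?rotVK.
rewrite !mulr_sumr; apply: eq_bigr => u _; rewrite Rcheck_on12_on23.
rewrite /on12 /on23 /kron /mone /mdiag /=.
case: eqP => [su | _]; last by rewrite !(mul0r, mulr0).
have [-> | x0] := eqVneq (X (s.1.2, s.2) (u.1.2, u.2)) 0.
  by rewrite !(mul0r, mulr0).
by rewrite /eps su (Rcheck_par x0) /=; ring.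
Qed.

End RMatrix.
Arguments Rcheck_inv {F m n} R V z _ _.

(** * The partial traces of the braiding *)

Section Rho.
Variables (F : fieldType) (m n : nat) (V : gmod F m n).

Definition rho2 (v : V) : F := \sum_k gsgn F k * (2%:R * hrho_exp F k * wt V v k).

(** The defining property (2 rho, alpha_a) = (alpha_a, alpha_a). *)
Lemma rho2_shift s (e : 'I_(m + n).-1 -> mat F V V) a i j : homog s e -> e a i j != 0 ->
  rho2 i = rho2 j + s * cart F a a.
Proof.
move=> He /He[_ wE]; rewrite cart_self /rho2.
under eq_bigr => k _ do rewrite wE mulrDr mulrDr.
rewrite big_split /=; congr (_ + _).
have sumE (f : 'I_(m + n) -> F) (l : 'I_(m + n)) : \sum_k f k * (k == l)%:R = f l.
  by rewrite (bigD1 l) //= eqxx mulr1 big1 ?addr0 // => k /negPf ->; rewrite mulr0.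
transitivity (\sum_k (gsgn F k * (2%:R * hrho_exp F k * s)) * (k == lo a)%:R
   - \sum_k (gsgn F k * (2%:R * hrho_exp F k * s)) * (k == hi a)%:R).
  by rewrite -sumrB; apply: eq_bigr => k _; rewrite /sroot; ring.
rewrite !sumE /gsgn /hrho_exp /gpar /=.
have [ma | am] := leqP m a.
  have -> : (m <= a.+1)%N by lia.
  by rewrite -[a.+1]addn1 natrD; ring.
have [ma | am'] := leqP m a.+1.
  have -> : a.+1%:R = m%:R :> F by congr (_%:R); lia.
  by rewrite /=; ring.
by rewrite -[a.+2]addn1 natrD /=; ring.
Qed.

End Rho.

Section Scalars.
Variables (F : fieldType) (qp : F -> F) (alpha : F) (m n : nat).
Variables (R : univ_family F m n) (V : gmod F m n) (z : F).
Arguments R : clear implicits.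
Hypotheses (Hqp : is_qpow qp) (Hgen : generic qp alpha) (HR : universal_R qp R).
Hypotheses (repV : is_rep qp V) (z0 : z != 0).
Hypotheses (irrV : irreducible qp V) (hwV : has_highest_weight alpha V).

Let X := Rcheck R V z.
Let nontriv : qp 1 != 1 := generic_q1 Hqp Hgen.

(** The matrices closing a strand: u = 1 on the left, u = -1 on the right. *)
Definition rdiag (u : F) (v : V) : F := (-1) ^+ par V v * qp (u * rho2 v).

Lemma SdiagE : Sdiag qp (V := V) = rdiag 1.
Proof.
apply: functional_extensionality => v; rewrite /Sdiag /rdiag mul1r /rho2; congr (_ * _).
rewrite /qi (big_morph qp (qpD Hqp) (qp0 Hqp)); apply: eq_bigr => k _; by congr qp; ring.
Qed.

Lemma rdiag_neq0 u v : rdiag u v != 0.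
Proof. by rewrite mulf_neq0 ?signr_eq0 ?(qp_neq0 Hqp). Qed.

(** Along the a-th generator, 2 rho and k_a contribute the same power of q, and
    for an odd generator the sign of [rdiag] compensates the one of [kpar]: this
    is the condition of [ptr_comm]. *)
Lemma rdiag_shift s (e : 'I_(m + n).-1 -> mat F V V) a i j u : homog s e -> e a i j != 0 ->
  (-1) ^+ (spar a && par V i) * (rdiag u i * qp (- u * kwt V a i)) =
  (-1) ^+ (spar a && par V j) * (rdiag u j * qp (- u * kwt V a j)).
Proof.
move=> He e0; have [pE _] := He _ _ _ e0.
rewrite /rdiag -!mulrA -!(qpD Hqp) (rho2_shift He e0) (homog_kwt a He e0) pE.
have -> : u * (rho2 j + s * cart F a a) + - u * (kwt V a j + s * cart F a a) =
          u * rho2 j + - u * kwt V a j by ring.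
by case: (spar a) (par V j) => [] [] /=; ring.
Qed.

Lemma Rcheck_diag d : (forall s t, X s t != 0 -> d s.1 * d s.2 = d t.1 * d t.2) ->
  X ** kron (mdiag d) (mdiag d) = kron (mdiag d) (mdiag d) ** X.
Proof.
move=> Hd; have -> : kron (mdiag d) (mdiag d) = mdiag (fun s : V * V => d s.1 * d s.2).
  apply: matP => -[i1 i2] [j1 j2]; rewrite /kron /mdiag -pair_eqE /pair_eq /=.
  by case: eqP; case: eqP => _ _ /=; rewrite ?mulr0 ?mul0r.
apply: matP => s t; rewrite mdiag_mulr mdiag_mull.
have [-> | x0] := eqVneq (X s t) 0; first by rewrite mulr0 mul0r.
by rewrite (Hd _ _ x0) mulrC.
Qed.

Lemma Rcheck_kwt s t a : X s t != 0 -> kwt V a s.1 + kwt V a s.2 = kwt V a t.1 + kwt V a t.2.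
Proof.
move=> x0; have wE := Rcheck_wt HR repV x0; rewrite /kwt.
transitivity (gsgn F (lo a) * (wt V s.1 (lo a) + wt V s.2 (lo a))
  - gsgn F (hi a) * (wt V s.1 (hi a) + wt V s.2 (hi a))); first by ring.
by rewrite !wE; ring.
Qed.

Lemma Rcheck_rdiag u : X ** kron (mdiag (rdiag u)) (mdiag (rdiag u)) =
   kron (mdiag (rdiag u)) (mdiag (rdiag u)) ** X.
Proof.
apply: Rcheck_diag => s t x0; rewrite /rdiag mulrACA [RHS]mulrACA -!signr_addb.
rewrite (Rcheck_par HR repV x0) -!(qpD Hqp) -!mulrDr; congr (_ * qp (_ * _)).
rewrite /rho2 -!big_split; apply: eq_bigr => k _ /=.
rewrite -!mulrDr; congr (_ * (_ * _)); exact: (Rcheck_wt HR repV x0).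
Qed.

Lemma Rcheck_kinv a : X ** kron (kinv qp V a) (kinv qp V a) = kron (kinv qp V a) (kinv qp V a) ** X.
Proof.
by apply: Rcheck_diag => s t x0; rewrite -!(qpD Hqp) -!mulrDr (Rcheck_kwt _ x0).
Qed.

Lemma Rcheck_kpar a : X ** kron (kpar qp V a) (kpar qp V a) = kron (kpar qp V a) (kpar qp V a) ** X.
Proof.
apply: Rcheck_diag => s t x0; rewrite mulrACA [RHS]mulrACA -!signr_addb.
by rewrite -!(qpD Hqp) -!mulrDr (Rcheck_kwt _ x0) -!andb_addr (Rcheck_par HR repV x0).
Qed.

Lemma Rcheck_Kpow k N : X ** kron (Kpow qp V k N) (Kpow qp V k N) =
   kron (Kpow qp V k N) (Kpow qp V k N) ** X.
Proof.
apply: Rcheck_diag => s t x0; rewrite /qi -!(qpD Hqp) -!mulrDr.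
by rewrite (Rcheck_wt HR repV x0).
Qed.

(** Intertwining properties of the braiding pass to its inverse in this form. *)
Definition natural (A : mat F (V * V)%type (V * V)%type) :=
  forall Y, X ** Y = Y ** X -> A ** Y = Y ** A.

Lemma natural_Rcheck : natural X. Proof. by []. Qed.
Lemma natural_Rcheck_inv : natural (Rcheck_inv R V z).
Proof. move=> Y; exact: comm_inv (Rcheck_invP HR repV z0). Qed.

Lemma ptr_Kpow D (A : mat F (V * V)%type (V * V)%type) k N :
  A ** kron (Kpow qp V k N) (Kpow qp V k N) = kron (Kpow qp V k N) (Kpow qp V k N) ** A ->
  ptr (mdiag D) A ** Kpow qp V k N = Kpow qp V k N ** ptr (mdiag D) A.
Proof.
move=> AK; apply: (@ptr_comm _ _ _ (fun _ _ => 0) _ D (fun v => qi qp k (N * wt V v k)) (fun _ => 1) (fun _ => 1) A _ _ _ _ _).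
- by move=> v; exact: (qp_neq0 Hqp).
- by move=> v; rewrite oner_eq0.
- by move=> i j; rewrite eqxx.
- by rewrite kron11 mulmat1 mul1mat.
- have k0 (Y : mat F V V) : kron (fun _ _ : V => 0 : F) Y = mscal 0 (mone F (V * V)%type).
    by apply: matP => s t; rewrite /kron /mscal !mul0r.
  by rewrite k0 mmulDl mmulDr mscalAl mscalAr mulmat1 mul1mat AK.
Qed.

Lemma ptr_left_comm A s (e : 'I_(m + n).-1 -> mat F V V) a : natural A -> homog s e ->
  X ** cop qp a (e a) (e a) = cop qp a (e a) (e a) ** X ->
  ptr (mdiag (rdiag 1)) A ** e a = e a ** ptr (mdiag (rdiag 1)) A.
Proof.
move=> HA He Xe; apply: (@ptr_comm _ _ _ (e a) (e a) (rdiag 1)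
  (fun v => (-1) ^+ (spar a && par V v) * qp (2%:R^-1 * kwt V a v))
  (fun v => qp (- 2%:R^-1 * kwt V a v)) (fun v => qp (- 2%:R^-1 * kwt V a v)) A _ _ _ (HA _ (Rcheck_kinv a))).
- by move=> v; rewrite mulf_neq0 ?signr_eq0 ?(qp_neq0 Hqp).
- by move=> v; exact: (qp_neq0 Hqp).
- move=> i j e0; have := rdiag_shift 1 He e0.
  have E (v : V) : qp (- 2%:R^-1 * kwt V a v) * (rdiag 1 v /
      ((-1) ^+ (spar a && par V v) * qp (2%:R^-1 * kwt V a v))) =
    (-1) ^+ (spar a && par V v) * (rdiag 1 v * qp (- 1 * kwt V a v)).
    rewrite invfM invr_sign -(qpN Hqp).
    have -> : qp (-1 * kwt V a v) = qp (- 2%:R^-1 * kwt V a v) * qp (- (2%:R^-1 * kwt V a v)).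
      rewrite -(qpD Hqp); congr qp; field; exact: (generic_natr Hgen (isT : (0 < 2)%N)).
    by ring.
  by rewrite !E.
- by apply: HA; rewrite -copE.
Qed.

(** Exchanging the two tensor factors turns the coproduct into
    e (x) k^(1/2) + k^(-1/2) (x) e, with the sign on the first term, so that
    [kinv] and [kpar] change roles and the closing matrix involves q^(-2 rho)
    instead of q^(2 rho). *)
Lemma ptr_right_comm A s (e : 'I_(m + n).-1 -> mat F V V) a : natural A -> homog s e ->
  X ** cop qp a (e a) (e a) = cop qp a (e a) (e a) ** X ->
  ptr (mdiag (rdiag (-1))) (swapm A) ** e a = e a ** ptr (mdiag (rdiag (-1))) (swapm A).
Proof.
move=> HA He Xe.
have swapC Y : X ** Y = Y ** X -> swapm A ** swapm Y = swapm Y ** swapm A.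
  by move/HA => AY; rewrite !swapmM AY.
have XK := swapC _ (Rcheck_kpar a); rewrite swapm_kron in XK.
apply: (@ptr_comm _ _ _ (e a) (e a) (rdiag (-1))
  (fun v => qp (- 2%:R^-1 * kwt V a v))
  (fun v => (-1) ^+ (spar a && par V v) * qp (2%:R^-1 * kwt V a v))
  (fun v => (-1) ^+ (spar a && par V v) * qp (2%:R^-1 * kwt V a v)) (swapm A) _ _ _ XK).
- by move=> v; exact: (qp_neq0 Hqp (- 2%:R^-1 * kwt V a v)).
- by move=> v; rewrite mulf_neq0 ?signr_eq0 ?(qp_neq0 Hqp).
- move=> i j e0; have := rdiag_shift (-1) He e0.
  have E (v : V) : ((-1) ^+ (spar a && par V v) * qp (2%:R^-1 * kwt V a v)) *
     (rdiag (-1) v / qp (- 2%:R^-1 * kwt V a v)) =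
    (-1) ^+ (spar a && par V v) * (rdiag (-1) v * qp (- (-1) * kwt V a v)).
    rewrite -(qpN Hqp).
    have -> : qp (- (-1) * kwt V a v) = qp (2%:R^-1 * kwt V a v) * qp (- (- 2%:R^-1 * kwt V a v)).
      rewrite -(qpD Hqp); congr qp; field; exact: (generic_natr Hgen (isT : (0 < 2)%N)).
    by ring.
  by rewrite !E.
- have := swapC _ Xe; rewrite copE //.
  have -> : swapm (madd (kron (e a) (kinv qp V a)) (kron (kpar qp V a) (e a))) =
     madd (kron (e a) (kpar qp V a)) (kron (kinv qp V a) (e a)).
    by apply: matP => i j; rewrite /swapm /madd /kron addrC [in LHS]mulrC [X in _ + X]mulrC.
  by [].
Qed.

Let Xu a := Rcheck_up z Hqp HR repV a.
Let Xd a := Rcheck_dn z Hqp HR repV a.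

Lemma ptr_left_scalar A x t : natural A ->
  (forall y, ptr (mdiag (rdiag 1)) A y x = (y == x)%:R * t) ->
  ptr (mdiag (rdiag 1)) A = mdiag (fun _ => t).
Proof.
move=> HA; apply: (schur irrV) => [a | a | k N].
- exact: (ptr_left_comm HA (homog_up Hqp nontriv repV)).
- exact: (ptr_left_comm HA (homog_dn Hqp nontriv repV)).
- apply: ptr_Kpow; exact/HA/Rcheck_Kpow.
Qed.

Lemma ptr_right_scalar A x t : natural A ->
  (forall y, ptr (mdiag (rdiag (-1))) (swapm A) y x = (y == x)%:R * t) ->
  ptr (mdiag (rdiag (-1))) (swapm A) = mdiag (fun _ => t).
Proof.
move=> HA; apply: (schur irrV) => [a | a | k N].
- exact: (ptr_right_comm HA (homog_up Hqp nontriv repV)).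
- exact: (ptr_right_comm HA (homog_dn Hqp nontriv repV)).
- apply: ptr_Kpow; have := HA _ (Rcheck_Kpow k N) => AK.
  by rewrite -(swapm_kron (Kpow qp V k N)) !swapmM AK.
Qed.

Lemma ptr_diag_col (D : V -> F) (A : mat F (V * V)%type (V * V)%type) x r :
  (forall c y, A (c, y) (c, x) = ((y, c) == (x, x))%:R * r) ->
  forall y, ptr (mdiag D) A y x = (y == x)%:R * (D x * r).
Proof.
move=> HA y; rewrite /ptr (bigD1 x) //= [X in _ + X]big1 ?addr0 => [|c cx].
  rewrite (bigD1 x) //= [X in _ + X]big1 ?addr0 => [|d dx].
    by rewrite HA /mdiag eqxx xpair_eqE eqxx andbT mulrCA.
  by rewrite /mdiag eq_sym (negPf dx) mul0r.
apply: big1 => d _; rewrite /mdiag; case: eqP => [<- | _]; last by rewrite mul0r.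
by rewrite HA xpair_eqE (negPf cx) andbF mul0r mulr0.
Qed.

Let r0 x := qp (wform (wt V x) (wt V x)).

(** R raises the weight of the second factor and lowers that of the first one, so
    that it acts as a scalar on a vector whose second factor has maximal weight,
    or whose first factor has minimal weight. *)
Lemma R_col_maximal x t : (forall y, ~ pos_diff (wt V y) (wt V x)) -> t.2 = x ->
  forall s, R V V s t = (s == t)%:R * qp (wform (wt V t.1) (wt V t.2)).
Proof.
move=> xmax tx s; case: eqP => [-> | st]; first by rewrite (uR_cartan HR) // mul1r.
rewrite mul0r; apply/eqP/negPn/negP => R0.
have [_ pd _] := uR_triangular HR repV repV st R0.
by apply: (xmax s.2); rewrite -tx.
Qed.

Lemma R_col_minimal x t : (forall y, ~ pos_diff (wt V x) (wt V y)) -> t.1 = x ->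
  forall s, R V V s t = (s == t)%:R * qp (wform (wt V t.1) (wt V t.2)).
Proof.
move=> xmin tx s; case: eqP => [-> | st]; first by rewrite (uR_cartan HR) // mul1r.
rewrite mul0r; apply/eqP/negPn/negP => R0.
have [pd _ _] := uR_triangular HR repV repV st R0.
by apply: (xmin s.1); rewrite -tx.
Qed.

Lemma minv_col (B : finType) (M : mat F B B) t r : as_mx M \in unitmx -> r != 0 ->
  (forall s, M s t = (s == t)%:R * r) -> forall s, minv M s t = (s == t)%:R * r^-1.
Proof.
move=> uM rn0 Mt s; have := congr1 (fun Z : mat F B B => Z s t) (mulVmat uM).
rewrite {1}/mmul (bigD1 t) //= big1 ?addr0 => [|u /negPf ut]; last first.
  by rewrite Mt ut mul0r mulr0.
rewrite Mt eqxx mul1r /mone /mdiag => /(canRL (mulfK rn0)) ->.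
by case: eqP.
Qed.

(** The diagonal entry at x of the trace involves the columns (c, x) of R for the
    left closure of the braiding and (x, c) for the right one; for the inverse,
    which applies R^-1 after the flip, these are exchanged. The extremal vector
    is chosen accordingly. *)
Lemma ptr_left_Rcheck : exists2 t, t != 0 & ptr (mdiag (rdiag 1)) X = mdiag (fun _ => t).
Proof.
have [x xmax] := exists_maximal irrV Hqp repV Hgen hwV.
exists (rdiag 1 x * (z * ((-1) ^+ par V x * r0 x))).
  by rewrite !mulf_neq0 ?rdiag_neq0 ?signr_eq0 ?(qp_neq0 Hqp).
apply: (ptr_left_scalar natural_Rcheck); apply: ptr_diag_col => c y.
rewrite /X RcheckE (R_col_maximal xmax) //= !xpair_eqE; case: (y =P c) => [-> | yc] /=.
  by case: (c =P x) => [-> | _] /=; rewrite ?andbb ?mul0r ?mulr0 // !mul1r.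
rewrite mul0r !mulr0; case: (y =P x) => [yx | _] /=; last by rewrite mul0r.
by case: (c =P x) => [cx | _] /=; rewrite ?mul0r //; case: yc; rewrite yx cx.
Qed.

Lemma ptr_right_Rcheck : exists2 t, t != 0 & ptr (mdiag (rdiag (-1))) (swapm X) = mdiag (fun _ => t).
Proof.
have [x xmin] := exists_minimal irrV Hqp repV Hgen hwV.
exists (rdiag (-1) x * (z * ((-1) ^+ par V x * r0 x))).
  by rewrite !mulf_neq0 ?rdiag_neq0 ?signr_eq0 ?(qp_neq0 Hqp).
apply: (ptr_right_scalar natural_Rcheck); apply: ptr_diag_col => c y.
rewrite /swapm /X RcheckE (R_col_minimal xmin) //= !xpair_eqE [(c == x) && (y == c)]andbC; case: (y =P c) => [-> | yc] /=.
  by case: (c =P x) => [-> | _] /=; rewrite ?andbb ?mul0r ?mulr0 // !mul1r.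
rewrite mul0r !mulr0; case: (y =P x) => [yx | _] /=; last by rewrite mul0r.
by case: (c =P x) => [cx | _] /=; rewrite ?mul0r //; case: yc; rewrite yx cx.
Qed.

Lemma ptr_left_Rcheck_inv : exists2 t, t != 0 &
  ptr (mdiag (rdiag 1)) (Rcheck_inv R V z) = mdiag (fun _ => t).
Proof.
have [x xmin] := exists_minimal irrV Hqp repV Hgen hwV.
exists (rdiag 1 x * (z^-1 * ((r0 x)^-1 * (-1) ^+ par V x))).
  by rewrite !mulf_neq0 ?rdiag_neq0 ?signr_eq0 ?invr_neq0 ?(qp_neq0 Hqp).
apply: (ptr_left_scalar natural_Rcheck_inv); apply: ptr_diag_col => c y.
rewrite /Rcheck_inv (minv_col (uR_unit HR repV repV) (qp_neq0 Hqp _) (R_col_minimal xmin _)) //=.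
rewrite !xpair_eqE [(c == x) && (y == c)]andbC; case: (y =P c) => [-> | yc] /=.
  by case: (c =P x) => [-> | _] /=; rewrite ?andbb ?mul0r ?mulr0 // !mul1r.
rewrite !mul0r !mulr0; case: (y =P x) => [yx | _] /=; last by rewrite mul0r.
by case: (c =P x) => [cx | _] /=; rewrite ?mul0r //; case: yc; rewrite yx cx.
Qed.

Lemma ptr_right_Rcheck_inv : exists2 t, t != 0 &
  ptr (mdiag (rdiag (-1))) (swapm (Rcheck_inv R V z)) = mdiag (fun _ => t).
Proof.
have [x xmax] := exists_maximal irrV Hqp repV Hgen hwV.
exists (rdiag (-1) x * (z^-1 * ((r0 x)^-1 * (-1) ^+ par V x))).
  by rewrite !mulf_neq0 ?rdiag_neq0 ?signr_eq0 ?invr_neq0 ?(qp_neq0 Hqp).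
apply: (ptr_right_scalar natural_Rcheck_inv); apply: ptr_diag_col => c y.
rewrite /swapm /Rcheck_inv (minv_col (uR_unit HR repV repV) (qp_neq0 Hqp _) (R_col_maximal xmax _)) //=.
rewrite !xpair_eqE; case: (y =P c) => [-> | yc] /=.
  by case: (c =P x) => [-> | _] /=; rewrite ?andbb ?mul0r ?mulr0 // !mul1r.
rewrite !mul0r !mulr0; case: (y =P x) => [yx | _] /=; last by rewrite mul0r.
by case: (c =P x) => [cx | _] /=; rewrite ?mul0r //; case: yc; rewrite yx cx.
Qed.

End Scalars.

(** * Operators on several strands *)

Section Lens.
Variables (F : fieldType) (W A : finType) (view : W -> A) (upd : W -> A -> W).
Hypotheses (view_upd : forall f a, view (upd f a) = a)
  (upd_view : forall f, upd f (view f) = f)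
  (upd_upd : forall f a b, upd (upd f a) b = upd f b).

(** [view] extracts from a basis vector f of a tensor product the part on which
    T acts; [upd] changes this part and keeps the rest. *)
Definition on_view (T : mat F A A) : mat F W W :=
  fun f g => if upd f (view g) == g then T (view f) (view g) else 0.

Lemma on_view_mul T (Z : mat F W W) f g :
  (on_view T ** Z) f g = \sum_a T (view f) a * Z (upd f a) g.
Proof.
rewrite /mmul (bigID (fun h => upd f (view h) == h)) /= [X in _ + X]big1 ?addr0; last first.
  by move=> h /negPf fh; rewrite /on_view fh mul0r.
rewrite (reindex_onto (upd f) view) /=; last by move=> h /eqP.
apply: eq_big => [a | a _]; first by rewrite !view_upd !eqxx.
by rewrite /on_view view_upd eqxx.
Qed.

Lemma on_view_mulr T (Z : mat F W W) f g :
  (Z ** on_view T) f g = \sum_a Z f (upd g a) * T a (view g).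
Proof.
rewrite /mmul (bigID (fun h => upd h (view g) == g)) /= [X in _ + X]big1 ?addr0; last first.
  by move=> h /negPf fh; rewrite /on_view fh mulr0.
rewrite (reindex_onto (upd g) view) /=; last first.
  by move=> h /eqP {1}<-; rewrite upd_upd upd_view.
apply: eq_big => [a | a _]; first by rewrite view_upd upd_upd upd_view !eqxx.
by rewrite /on_view view_upd upd_upd upd_view eqxx.
Qed.

Lemma on_viewM T T' : on_view T ** on_view T' = on_view (T ** T').
Proof.
apply: matP => f g; rewrite on_view_mul /on_view.
under eq_bigr => a _ do rewrite upd_upd view_upd.
by case: eqP => _ //; rewrite big1 // => a _; rewrite mulr0.
Qed.

Lemma on_view1 : on_view (mone F A) = mone F W.
Proof.
apply: matP => f g; rewrite /on_view /mone /mdiag.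
case: (f =P g) => [-> | fg]; first by rewrite upd_view !eqxx.
by case: eqP => // ug; case: eqP => // vfg; case: fg; rewrite -ug -vfg upd_view.
Qed.
End Lens.

Section Sites.
Variables (F : fieldType) (B I : finType).
Notation Omega := {ffun I -> B}.
Implicit Types (X Y : mat F (B * B)%type (B * B)%type) (f g : Omega).

Definition on_sites (l r : I) X : mat F Omega Omega :=
  fun f g => if [forall j, (j != l) && (j != r) ==> (f j == g j)]
             then X (f l, f r) (g l, g r) else 0.

Definition view2 l r f := (f l, f r).
Definition upd2 l r f (a : B * B) : Omega :=
  [ffun j => if j == l then a.1 else if j == r then a.2 else f j].
Definition view3 l k r f := (f l, f k, f r).
Definition upd3 l k r f (a : B * B * B) : Omega :=
  [ffun j => if j == l then a.1.1 else if j == k then a.1.2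
             else if j == r then a.2 else f j].

Lemma view2_upd l r : l != r -> forall f a, view2 l r (upd2 l r f a) = a.
Proof. by move=> /negPf lr f [a b]; rewrite /view2 !ffunE !eqxx eq_sym lr. Qed.
Lemma upd2_view l r f : upd2 l r f (view2 l r f) = f.
Proof. by apply/ffunP => j; rewrite ffunE; case: eqP => [-> // | _]; case: eqP => [-> |]. Qed.
Lemma upd2_upd l r f a b : upd2 l r (upd2 l r f a) b = upd2 l r f b.
Proof. by apply/ffunP => j; rewrite !ffunE; case: eqP => // _; case: eqP. Qed.

Lemma view3_upd l k r : l != k -> l != r -> k != r ->
  forall f a, view3 l k r (upd3 l k r f a) = a.
Proof.
move=> /negPf lk /negPf lr /negPf kr f [[a b] c].
by rewrite /view3 !ffunE !eqxx eq_sym lk eq_sym lr eq_sym kr.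
Qed.
Lemma upd3_upd l k r f a b : upd3 l k r (upd3 l k r f a) b = upd3 l k r f b.
Proof. by apply/ffunP => j; rewrite !ffunE; do 2?[case: eqP => // _]; case: eqP. Qed.

Lemma on_sitesE l r X : on_sites l r X = on_view (view2 l r) (upd2 l r) X.
Proof.
apply: matP => f g; rewrite /on_sites /on_view; congr (if _ then _ else _).
apply/forallP/eqP => [fg | <- j].
  apply/ffunP => j; rewrite ffunE /=; case: eqP => [-> // | /eqP jl].
  case: eqP => [-> // | /eqP jr]; by have := fg j; rewrite jl jr => /eqP.
by apply/implyP => /andP[/negPf jl /negPf jr]; rewrite ffunE jl jr.
Qed.

Lemma on_sitesM l r X Y : l != r -> on_sites l r X ** on_sites l r Y = on_sites l r (X ** Y).
Proof.
by move=> lr; rewrite !on_sitesE on_viewM //;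
   [exact: view2_upd | exact: upd2_upd].
Qed.

Lemma on_sites1 l r : on_sites l r (mone F (B * B)%type) = mone F Omega.
Proof. by rewrite on_sitesE on_view1 //; exact: upd2_view. Qed.

Lemma on_sites_swap l r X : l != r -> on_sites l r X = on_sites r l (swapm X).
Proof.
move=> lr; apply: matP => f g; rewrite /on_sites /swapm /=; congr (if _ then _ else _).
by apply: eq_forallb => j; rewrite andbC.
Qed.

Lemma on_sites12 l k r X : l != k -> l != r -> k != r ->
  on_sites l k X = on_view (view3 l k r) (upd3 l k r) (on12 X).
Proof.
move=> lk lr kr; apply: matP => f g; rewrite /on_sites /on_view /on12 /kron /mone /mdiag /=.
case: ifP => [/forallP fg | /forallP fg].
  have fr : f r = g r by have := fg r; rewrite eq_sym lr eq_sym kr => /eqP.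
  rewrite fr eqxx mulr1 ifT //; apply/eqP/ffunP => j; rewrite ffunE /=.
  case: (j =P l) => [-> // | /eqP jl]; case: (j =P k) => [-> // | /eqP jk].
  by case: (j =P r) => [-> // | _]; have := fg j; rewrite jl jk => /eqP.
case: eqP => // ug; case: eqP => fr; last by rewrite mulr0.
case: fg => j; apply/implyP => /andP[/negPf jl /negPf jk].
have := congr1 (fun h : Omega => h j) ug; rewrite ffunE jl jk /= => <-.
by case: (j =P r) => [-> |]; rewrite ?fr.
Qed.

Lemma on_sites23 l k r X : l != k -> l != r -> k != r ->
  on_sites k r X = on_view (view3 l k r) (upd3 l k r) (on23 X).
Proof.
move=> lk lr kr; apply: matP => f g; rewrite /on_sites /on_view /on23 /=.
case: ifP => [/forallP fg | /forallP fg].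
  have fr : f l = g l by have := fg l; rewrite lk lr => /eqP.
  rewrite fr eqxx ifT //; apply/eqP/ffunP => j; rewrite ffunE /=.
  case: (j =P l) => [-> // | _]; case: (j =P k) => [-> // | /eqP jk].
  by case: (j =P r) => [-> // | /eqP jr]; have := fg j; rewrite jk jr => /eqP.
case: eqP => // ug; case: eqP => fr //.
case: fg => j; apply/implyP => /andP[/negPf jk /negPf jr].
have := congr1 (fun h : Omega => h j) ug; rewrite ffunE jk jr /= => <-.
by case: (j =P l) => [-> |]; rewrite ?fr.
Qed.

Lemma on_sites_braid l k r X : l != k -> l != r -> k != r ->
  on12 X ** on23 X ** on12 X = on23 X ** on12 X ** on23 X ->
  on_sites l k X ** on_sites k r X ** on_sites l k X = on_sites k r X ** on_sites l k X ** on_sites k r X.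
Proof.
move=> lk lr kr XB; rewrite (on_sites12 _ lk lr kr) (on_sites23 _ lk lr kr).
by rewrite !on_viewM ?XB //; first [exact: view3_upd | exact: upd3_upd].
Qed.

Lemma on_sites_disjoint l r l' r' X Y : l != r -> l' != r' ->
  l != l' -> l != r' -> r != l' -> r != r' -> forall f g,
  (on_sites l r X ** on_sites l' r' Y) f g =
  if [forall j, [&& j != l, j != r, j != l' & j != r'] ==> (f j == g j)]
  then X (f l, f r) (g l, g r) * Y (f l', f r') (g l', g r') else 0.
Proof.
move=> lr lr' ll' lr1 rl' rr' f g.
rewrite {1}on_sitesE on_view_mul; [|exact: view2_upd].
have [e1 e2] : [/\ (l' == l) = false & (l' == r) = false].
  by rewrite ![l' == _]eq_sym (negPf ll') (negPf rl').
have [e3 e4] : [/\ (r' == l) = false & (r' == r) = false].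
  by rewrite ![r' == _]eq_sym (negPf lr1) (negPf rr').
have rl : (r == l) = false by rewrite eq_sym (negPf lr).
rewrite (bigD1 (g l, g r)) //= big1 ?addr0.
  rewrite /on_sites !ffunE e1 e2 e3 e4 /view2.
  set P := [forall j, _]; set Q := [forall j, _]; suff -> : P = Q.
    by case: Q => //; rewrite mulr0.
  apply/forallP/forallP => H j; apply/implyP.
    case/and4P=> /negPf jl /negPf jr jl' jr'.
    by have := H j; rewrite jl' jr' ffunE jl jr.
  move=> /andP[jl' jr']; rewrite ffunE; case: (j =P l) => [-> // | /eqP jl].
  by case: (j =P r) => [-> // | /eqP jr]; have := H j; rewrite jl jr jl' jr'.
move=> a aN; rewrite /on_sites ifF ?mulr0 //; apply/negP => /forallP H; case/negP: aN.
have := H l; have := H r; rewrite ll' lr1 rl' rr' !ffunE !eqxx rl /=.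
by case: a {H} => a b /= /eqP -> /eqP ->.
Qed.

Lemma on_sites_far l r l' r' X Y : l != r -> l' != r' ->
  l != l' -> l != r' -> r != l' -> r != r' ->
  on_sites l r X ** on_sites l' r' Y = on_sites l' r' Y ** on_sites l r X.
Proof.
move=> lr lr' a b c d; apply: matP => f g.
rewrite on_sites_disjoint // on_sites_disjoint //; first last; try by rewrite eq_sym.
rewrite mulrC; congr (if _ then _ else _); apply: eq_forallb => j.
by congr (_ ==> _); case: (j != l) (j != r) (j != l') (j != r') => [] [] [] [].
Qed.

Definition tensor_op (M : I -> mat F B B) : mat F Omega Omega :=
  fun f g => \prod_j M j (f j) (g j).

Lemma tensor_opM M M' : tensor_op M ** tensor_op M' = tensor_op (fun j => M j ** M' j).
Proof.
apply: matP => f g; rewrite /mmul /tensor_op bigA_distr_bigA /=.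
by apply: eq_bigr => h _; rewrite big_split.
Qed.

(** The contribution of the sites other than l and r to a tensor product. *)
Let rest l r (M : I -> mat F B B) f g : F :=
  \prod_(j | (j != l) && (j != r)) M j (f j) (g j).

Lemma tensor_op_split l r (M : I -> mat F B B) f g : l != r ->
  tensor_op M f g = M l (f l) (g l) * M r (f r) (g r) * rest l r M f g.
Proof.
move=> lr; rewrite /tensor_op (bigD1 l) //= (bigD1 r) /=; last by rewrite eq_sym.
by rewrite mulrA.
Qed.

Lemma on_sites_tensor l r X M f g : l != r ->
  (on_sites l r X ** tensor_op M) f g =
  (X ** kron (M l) (M r)) (f l, f r) (g l, g r) * rest l r M f g.
Proof.
move=> lr; rewrite on_sitesE on_view_mul; last exact: view2_upd.
rewrite [in RHS]/mmul mulr_suml; apply: eq_bigr => a _.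
rewrite (tensor_op_split _ _ _ lr) !ffunE !eqxx eq_sym (negPf lr) /kron /= -!mulrA.
congr (_ * (_ * (_ * _))); apply: eq_bigr => j /andP[/negPf jl /negPf jr].
by rewrite ffunE jl jr.
Qed.

Lemma tensor_on_sites l r X M f g : l != r ->
  (tensor_op M ** on_sites l r X) f g =
  (kron (M l) (M r) ** X) (f l, f r) (g l, g r) * rest l r M f g.
Proof.
move=> lr; rewrite on_sitesE on_view_mulr.
- rewrite [in RHS]/mmul mulr_suml; apply: eq_bigr => a _.
  rewrite (tensor_op_split _ _ _ lr) !ffunE !eqxx eq_sym (negPf lr) /kron /= [RHS]mulrAC.
  congr (_ * _ * _); apply: eq_bigr => j /andP[/negPf jl /negPf jr].
  by rewrite ffunE jl jr.
- exact: view2_upd.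
- exact: upd2_view.
- exact: upd2_upd.
Qed.

Lemma on_sites_tensor_comm l r X M : l != r ->
  X ** kron (M l) (M r) = kron (M l) (M r) ** X ->
  on_sites l r X ** tensor_op M = tensor_op M ** on_sites l r X.
Proof. by move=> lr XM; apply: matP => f g; rewrite on_sites_tensor // tensor_on_sites // XM. Qed.
End Sites.

(** * Adding a strand *)

Section Idle.
Variables (F : fieldType) (B : finType) (n : nat) (h : 'I_n.+1).
Notation Omega := {ffun 'I_n -> B}.
Notation Omega' := {ffun 'I_n.+1 -> B}.
Implicit Types (Z : mat F Omega Omega) (W : mat F Omega' Omega').

Definition ext (c : B) (a : Omega) : Omega' :=
  [ffun j => if unlift h j is Some i then a i else c].
Definition res (f : Omega') : Omega := [ffun i => f (lift h i)].

Lemma ext_lift c a i : ext c a (lift h i) = a i.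
Proof. by rewrite ffunE liftK. Qed.
Lemma ext_at c a : ext c a h = c.
Proof. by rewrite ffunE unlift_none. Qed.
Lemma res_ext c a : res (ext c a) = a.
Proof. by apply/ffunP => i; rewrite ffunE ext_lift. Qed.
Lemma ext_res (f : Omega') : ext (f h) (res f) = f.
Proof. by apply/ffunP => j; rewrite ffunE; case: unliftP => [i|] ->; rewrite ?ffunE. Qed.

Lemma sum_ext (G : Omega' -> F) : \sum_f G f = \sum_c \sum_a G (ext c a).
Proof.
rewrite (reindex (fun p : B * Omega => ext p.1 p.2)) /=; first by rewrite sum_pair.
exists (fun f : Omega' => (f h, res f)) => [[c a]|f] _ /=; last exact: ext_res.
by rewrite ext_at res_ext.
Qed.

(** Z acting on all the sites but h. *)
Definition idle Z : mat F Omega' Omega' :=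
  fun f g => if f h == g h then Z (res f) (res g) else 0.

Lemma idle_mull Z W c a g : (idle Z ** W) (ext c a) g = \sum_b Z a b * W (ext c b) g.
Proof.
rewrite /mmul sum_ext (bigD1 c) //= [X in _ + X]big1 ?addr0 => [|c' /negPf cc'].
  by apply: eq_bigr => b _; rewrite /idle !ext_at !res_ext eqxx.
by apply: big1 => b _; rewrite /idle !ext_at eq_sym cc' mul0r.
Qed.

Lemma idle_mulr Z W c a g : (W ** idle Z) g (ext c a) = \sum_b W g (ext c b) * Z b a.
Proof.
rewrite /mmul sum_ext (bigD1 c) //= [X in _ + X]big1 ?addr0 => [|c' /negPf cc'].
  by apply: eq_bigr => b _; rewrite /idle !ext_at !res_ext eqxx.
by apply: big1 => b _; rewrite /idle !ext_at cc' mulr0.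
Qed.

Lemma idleM Z Z' : idle (Z ** Z') = idle Z ** idle Z'.
Proof.
apply: matP => f g; rewrite -(ext_res f) -(ext_res g) idle_mull.
rewrite /idle !ext_at !res_ext; case: eqP => [-> | /eqP/negPf fg].
  by apply: eq_bigr => b _; rewrite !ext_at !res_ext eqxx.
by rewrite big1 // => b _; rewrite !ext_at fg mulr0.
Qed.

Lemma idle1 : idle (mone F Omega) = mone F Omega'.
Proof.
apply: matP => f g; rewrite /idle /mone /mdiag.
case: (f =P g) => [-> | fg]; first by rewrite !eqxx.
case: eqP => // fgh; case: eqP => // frg; case: fg.
by rewrite -(ext_res f) -(ext_res g) fgh frg.
Qed.

Lemma on_sites_idle l r X : on_sites (lift h l) (lift h r) X = idle (on_sites l r X).
Proof.
apply: matP => f g; rewrite /on_sites /idle !ffunE.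
case: (f h =P g h) => [fgh | fgh]; last first.
  rewrite ifF //; apply/negP => /forallP/(_ h).
  by rewrite !neq_lift => /eqP.
congr (if _ then _ else _); apply/forallP/forallP => H j.
  by have := H (lift h j); rewrite !ffunE !(inj_eq lift_inj).
case: (unliftP h j) => [i|] ->; last by rewrite fgh eqxx implybT.
by have := H i; rewrite !ffunE !(inj_eq lift_inj).
Qed.

(** The partial trace over the site h, weighted by d. *)
Definition site_tr (d : B -> F) W : mat F Omega Omega :=
  fun a b => \sum_c d c * W (ext c a) (ext c b).

Lemma site_tr_idle d Z W Z' :
  site_tr d (idle Z ** (W ** idle Z')) = Z ** (site_tr d W ** Z').
Proof.
apply: matP => a b; rewrite /site_tr.
under eq_bigr => c _ do rewrite idle_mull mulr_sumr.
rewrite exchange_big; apply: eq_bigr => a' _ /=.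
rewrite [in RHS]/mmul /site_tr.
under eq_bigr => c _ do rewrite idle_mulr.
under [in RHS]eq_bigr => b' _ do rewrite mulr_suml.
rewrite [in RHS]exchange_big mulr_sumr; apply: eq_bigr => c _ /=.
by rewrite !mulr_sumr; apply: eq_bigr => b' _; ring.
Qed.

Lemma site_tr_on_sites d k X t : ptr (mdiag d) X = mdiag (fun _ => t) ->
  site_tr d (on_sites h (lift h k) X) = mscal t (mone F Omega).
Proof.
move=> Xt; apply: matP => a b; rewrite /site_tr /on_sites.
under eq_bigr => c _ do rewrite !ext_at !ext_lift.
rewrite /mscal /mone /mdiag; case: (a =P b) => [-> | ab].
  have := congr1 (fun Y : mat F B B => Y (b k) (b k)) Xt; rewrite /mdiag eqxx mulr1 => <-.
  apply: eq_bigr => c _; rewrite (bigD1 c) //= big1 ?addr0 => [|c' cc'].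
    rewrite eqxx ifT //; apply/forallP => j; apply/implyP => /andP[jh _].
    by case: (unliftP h j) jh => [i|] -> ; rewrite ?ext_lift ?eqxx.
  by rewrite eq_sym (negPf cc') mul0r.
rewrite mulr0.
have [abk | abk] := eqVneq (a k) (b k).
  apply: big1 => c _; rewrite ifF ?mulr0 //; apply/negP => /forallP H; case: ab.
  apply/ffunP => i; have [-> // | ik] := eqVneq i k.
  by have := H (lift h i); rewrite !ext_lift eq_sym neq_lift (inj_eq lift_inj) ik => /eqP.
have [H | H] := boolP [forall i, (i != k) ==> (a i == b i)].
  have := congr1 (fun Y : mat F B B => Y (a k) (b k)) Xt; rewrite /mdiag (negPf abk) => E; rewrite -[RHS]E.
  apply: eq_bigr => c _; rewrite (bigD1 c) //= big1 ?addr0 => [|c' cc'].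
    rewrite eqxx ifT //; apply/forallP => j; apply/implyP => /andP[jh jk].
    case: (unliftP h j) jh jk => [i|] -> ; rewrite ?ext_lift ?eqxx // => _.
    by rewrite (inj_eq lift_inj) => ik; have /forallP/(_ i) := H; rewrite ik.
  by rewrite eq_sym (negPf cc') mul0r.
apply: big1 => c _; rewrite ifF ?mulr0 //; apply/negP => /forallP H'.
case/negP: H; apply/forallP => i; apply/implyP => ik.
by have := H' (lift h i); rewrite !ext_lift eq_sym neq_lift (inj_eq lift_inj) ik.
Qed.

Lemma tensor_op_ext (M : 'I_n.+1 -> mat F B B) c a c' a' :
  tensor_op M (ext c a) (ext c' a') = M h c c' * tensor_op (fun i => M (lift h i)) a a'.
Proof.
rewrite /tensor_op (bigD1_ord h) //= !ext_at; congr (_ * _).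
by apply: eq_bigr => i _; rewrite !ext_lift.
Qed.

Lemma mtr_site (M : 'I_n.+1 -> mat F B B) d W : M h = mdiag d ->
  mtr (tensor_op M ** W) = mtr (tensor_op (fun i => M (lift h i)) ** site_tr d W).
Proof.
move=> Mh; rewrite /mtr sum_ext exchange_big; apply: eq_bigr => a _ /=.
under eq_bigr => c _ do rewrite /mmul sum_ext.
rewrite [in RHS]/mmul /site_tr.
under [in RHS]eq_bigr => b _ do rewrite mulr_sumr.
rewrite [in RHS]exchange_big; apply: eq_bigr => c _ /=.
rewrite (bigD1 c) //= [X in _ + X]big1 ?addr0 => [|c' cc'].
  by apply: eq_bigr => b _; rewrite tensor_op_ext Mh /mdiag eqxx; ring.
by apply: big1 => b _; rewrite tensor_op_ext Mh /mdiag eq_sym (negPf cc') !mul0r.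
Qed.

(** A strand h that meets the others in a single crossing can be closed first;
    this closes a kink, worth the scalar t. *)
Lemma mtr_stab (M : 'I_n.+1 -> mat F B B) d k X t Z Z' : M h = mdiag d ->
  ptr (mdiag d) X = mdiag (fun _ => t) ->
  mtr (tensor_op M ** (idle Z ** (on_sites h (lift h k) X ** idle Z'))) =
  t * mtr (tensor_op (fun i => M (lift h i)) ** (Z ** Z')).
Proof.
move=> Mh Xt; rewrite (mtr_site _ Mh) site_tr_idle (site_tr_on_sites _ Xt).
by rewrite mscalAl mul1mat !mscalAr /mtr mulr_sumr.
Qed.
End Idle.

(** * Invariance under the Markov moves *)

Lemma braid_inv (F : fieldType) (W : finType) (a b a' b' : mat F W W) :
  a' ** a = mone F W -> b' ** b = mone F W ->
  a' ** b' ** a' = b' ** a' ** b' -> a ** b ** a = b ** a ** b.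
Proof.
move=> ia ib pos.
have inv x y x' y' : x' ** x = mone F W -> y' ** y = mone F W ->
    (x' ** y' ** x') ** (x ** y ** x) = mone F W.
  by move=> xx yy; rewrite -!mmulA (mmulA x' x) xx mul1mat (mmulA y' y) yy mul1mat.
have E1 := inv _ _ _ _ ia ib; have E2 := inv _ _ _ _ ib ia.
by rewrite -[LHS]mul1mat -(mmul1C E2) -(mmulA (b ** a ** b)) -pos E1 mulmat1.
Qed.

(** In this section X is a solution of the braid equation with inverse Xi, and C,
    C' are the closing matrices for the left and for the right. A boolean E
    selects positive or negative crossings, [tl E] and [tr E] being the values
    of the kinks on the left and on the right. *)
Section Markov.
Variables (F : fieldType) (B : finType).
Variables (X Xi : mat F (B * B)%type (B * B)%type) (C C' : B -> F).
Hypothesis XXi : X ** Xi = mone F (B * B)%type.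
Hypothesis X_braid : on12 X ** on23 X ** on12 X = on23 X ** on12 X ** on23 X.
Hypothesis X_CC : X ** kron (mdiag C) (mdiag C) = kron (mdiag C) (mdiag C) ** X.
Hypothesis X_CC' : X ** kron (mdiag C') (mdiag C') = kron (mdiag C') (mdiag C') ** X.

Notation XE E := (if E then X else Xi).
Variables (tl tr : bool -> F).
Hypotheses (tl0 : forall E, tl E != 0) (tr0 : forall E, tr E != 0).
Hypothesis ptr_l : forall E, ptr (mdiag C) (XE E) = mdiag (fun _ => tl E).
Hypothesis ptr_r : forall E, ptr (mdiag C') (swapm (XE E)) = mdiag (fun _ => tr E).

Notation op p := (mat F {ffun 'I_p.+1 -> B} {ffun 'I_p.+1 -> B}).

(** Crossings are numbered by natural numbers, so that products of consecutive
    ones run over [iota]; only k < p is meaningful. *)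
Definition gen p (k : nat) (E : bool) : op p := on_sites (inord k) (inord k.+1) (XE E).
Arguments gen : clear implicits.

Lemma inord_neq p k k' : (k <= p)%N -> (k' <= p)%N -> k != k' ->
  inord k != inord k' :> 'I_p.+1.
Proof. by move=> kp k'p; rewrite -val_eqE /= !inordK. Qed.

Lemma XE_inv E : XE E ** XE (~~ E) = mone F (B * B)%type.
Proof. by case: E => //=; exact: mmul1C XXi. Qed.

Lemma gen_inv p k E : (k < p)%N -> gen p k E ** gen p k (~~ E) = mone F _.
Proof.
move=> kp; rewrite /gen on_sitesM; last by apply: inord_neq; lia.
by rewrite XE_inv on_sites1.
Qed.

Lemma gen_far p k k' E E' : (k.+1 < k')%N -> (k' < p)%N ->
  gen p k E ** gen p k' E' = gen p k' E' ** gen p k E.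
Proof. by move=> kk' kp; apply: on_sites_far; apply: inord_neq; lia. Qed.

Lemma gen_braid p k E : (k.+1 < p)%N ->
  gen p k E ** gen p k.+1 E ** gen p k E = gen p k.+1 E ** gen p k E ** gen p k.+1 E.
Proof.
move=> kp.
have pos : gen p k true ** gen p k.+1 true ** gen p k true =
           gen p k.+1 true ** gen p k true ** gen p k.+1 true.
  by apply: on_sites_braid => //; apply: inord_neq; lia.
case: E => //.
have kp' : (k < p)%N by lia.
exact: braid_inv (gen_inv true kp') (gen_inv true kp) pos.
Qed.

Lemma gen_idle_max p k E : (k < p)%N -> gen p.+1 k E = idle ord_max (gen p k E).
Proof.
move=> kp; rewrite /gen -on_sites_idle; congr on_sites; apply: val_inj; rewrite /= !inordK /bump; lia.
Qed.

Lemma gen_idle0 p k E : (k < p)%N -> gen p.+1 k.+1 E = idle ord0 (gen p k E).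
Proof.
move=> kp; rewrite /gen -on_sites_idle; congr on_sites; apply: val_inj; rewrite /= !inordK /bump; lia.
Qed.

Definition prodg p E (s : seq nat) : op p :=
  foldr (fun k Z => gen p k E ** Z) (mone F _) s.
Arguments prodg : clear implicits.

Lemma prodg_cat p E s s' : prodg p E (s ++ s') = prodg p E s ** prodg p E s'.
Proof. by elim: s => [|k s IH] /=; rewrite ?mul1mat // IH mmulA. Qed.

Lemma prodg_idle_max p E s : all (fun k => k < p)%N s ->
  prodg p.+1 E s = idle ord_max (prodg p E s).
Proof.
elim: s => [|k s IH] /=; first by rewrite idle1.
by case/andP=> kp sp; rewrite IH // gen_idle_max // idleM.
Qed.

Lemma prodg_idle0 p E s : all (fun k => k < p)%N s ->
  prodg p.+1 E [seq k.+1 | k <- s] = idle ord0 (prodg p E s).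
Proof.
elim: s => [|k s IH] /=; first by rewrite idle1.
by case/andP=> kp sp; rewrite IH // gen_idle0 // idleM.
Qed.

Lemma prodg_comm p E s (Z : op p) : (forall k, k \in s -> gen p k E ** Z = Z ** gen p k E) ->
  prodg p E s ** Z = Z ** prodg p E s.
Proof.
elim: s => [|k s IH] H /=; first by rewrite mul1mat mulmat1.
rewrite -mmulA IH ?mmulA ?H ?mem_head // => k' ks; apply: H.
by rewrite inE ks orbT.
Qed.

(** The last strand passed across all the others. *)
Definition pass_all p E : op p := prodg p E (iota 0 p).
Arguments pass_all : clear implicits.

(** Moving a strand from one side of Z to the other, over it or under it
    according to E. *)
Definition slides p (Z : op p) := forall E,
  pass_all p.+1 E ** idle ord_max Z = idle ord0 Z ** pass_all p.+1 E.

Lemma slides1 p : slides (mone F {ffun 'I_p.+1 -> B}).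
Proof. by move=> E; rewrite !idle1 mul1mat mulmat1. Qed.

Lemma slidesM p (Z Z' : op p) : slides Z -> slides Z' -> slides (Z ** Z').
Proof. by move=> HZ HZ' E; rewrite !idleM mmulA HZ -(mmulA _ (pass_all _ _)) HZ' mmulA. Qed.

(** Only the factors k and k + 1 of s_0 .. s_p do not commute with the crossing;
    there one uses x y x = y x y or its consequence x y x^-1 = y^-1 x y. *)
Lemma slides_gen p k b : (k < p)%N -> slides (gen p k b).
Proof.
move=> kp E; rewrite -gen_idle_max // -gen_idle0 // /pass_all.
have -> : iota 0 p.+1 = iota 0 k ++ [:: k; k.+1] ++ iota k.+2 (p.+1 - k.+2).
  have {1}-> : p.+1 = (k + (2 + (p.+1 - k.+2)))%N by lia.
  by rewrite !iotaD add0n addn2.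
rewrite !prodg_cat /= mulmat1.
set A := prodg _ _ (iota 0 k); set D := prodg _ _ (iota k.+2 _).
set x := gen p.+1 k E; set y := gen p.+1 k.+1 E.
have AC : A ** gen p.+1 k.+1 b = gen p.+1 k.+1 b ** A.
  by apply: prodg_comm => l; rewrite mem_iota => lk; apply: gen_far; lia.
have DC : D ** gen p.+1 k b = gen p.+1 k b ** D.
  by apply: prodg_comm => l; rewrite mem_iota => lk; symmetry; apply: gen_far; lia.
have br : x ** y ** x = y ** x ** y by apply: gen_braid; lia.
suff core : x ** y ** gen p.+1 k b = gen p.+1 k.+1 b ** (x ** y).
  by rewrite -!mmulA DC !mmulA -(mmulA A) -(mmulA A) core mmulA AC !mmulA.
have [-> | /negPf bE] := eqVneq b E; first by rewrite mmulA.
have -> : b = ~~ E by case: (b) (E) bE => [] [].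
have xi : x ** gen p.+1 k (~~ E) = mone F _ by apply: gen_inv; lia.
have iy : gen p.+1 k.+1 (~~ E) ** y = mone F _ by apply: mmul1C; apply: gen_inv; lia.
rewrite -[LHS]mul1mat -iy -!mmulA (mmulA x y) (mmulA y) (mmulA y) -br.
by rewrite -!mmulA xi mulmat1.
Qed.

(** What is inserted at each site when the strand j is cut open. *)
Definition sites p j (Y : mat F B B) (i : 'I_p.+1) : mat F B B :=
  if (i < j)%N then mdiag C else if i == j :> nat then Y else mdiag C'.

(** For Y a matrix unit, this is an entry of the endomorphism of V obtained by
    closing all the strands of Z but the j-th. *)
Definition tau p j Y (Z : op p) : F := mtr (tensor_op (sites j Y) ** Z).

Lemma XE_comm Y E : X ** Y = Y ** X -> XE E ** Y = Y ** XE E.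
Proof. by case: E => //; exact: comm_inv XXi. Qed.

(** A crossing of two strands closed on the same side commutes with the closing
    matrices. *)
Lemma tau_cyc p j Y k E (Z : op p) : (k < p)%N -> (k.+1 < j)%N || (j < k)%N ->
  tau j Y (gen p k E ** Z) = tau j Y (Z ** gen p k E).
Proof.
move=> kp jk; have G : gen p k E ** tensor_op (sites j Y) = tensor_op (sites j Y) ** gen p k E.
  apply: on_sites_tensor_comm; first by apply: inord_neq; lia.
  apply: XE_comm; rewrite /sites !inordK; try lia.
  case/orP: jk => jk; first by rewrite !ifT //; lia.
  by rewrite !ifF //; lia.
by rewrite /tau mmulA -G -mmulA mtrC mmulA.
Qed.

Lemma tau_prodg p j Y E s (Z : op p) :
  (forall k, k \in s -> (k < p)%N && ((k.+1 < j)%N || (j < k)%N)) ->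
  tau j Y (prodg p E s ** Z) = tau j Y (Z ** prodg p E s).
Proof.
elim: s Z => [|k s IH] Z H /=; first by rewrite mul1mat mulmat1.
have /andP[kp kj] := H k (mem_head _ _).
rewrite -mmulA tau_cyc // -mmulA IH ?mmulA // => l ls; apply: H.
by rewrite inE ls orbT.
Qed.

Lemma sites_max p j Y (i : 'I_p.+1) : sites j Y (lift ord_max i) = sites j Y i.
Proof. by rewrite /sites lift_max. Qed.

Lemma tau_stab_max p j Y E (Z Z' : op p) : (j <= p)%N ->
  tau j Y (idle ord_max Z ** (gen p.+1 p E ** idle ord_max Z')) = tr E * tau j Y (Z ** Z').
Proof.
move=> jp; rewrite /tau.
have -> : gen p.+1 p E = on_sites ord_max (lift ord_max (inord p : 'I_p.+1)) (swapm (XE E)).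
  rewrite /gen on_sites_swap; last by apply: inord_neq; lia.
  by congr on_sites; apply: val_inj; rewrite /= ?inordK /bump; lia.
rewrite (@mtr_stab _ _ _ _ _ C' _ _ (tr E)) //.
  by congr (_ * mtr (tensor_op _ ** _)); apply: functional_extensionality => i; exact: sites_max.
by rewrite /sites !ifF //=; lia.
Qed.

Lemma tau_stab_0 p j Y E (Z Z' : op p) :
  tau j.+1 Y (idle ord0 Z ** (gen p.+1 0 E ** idle ord0 Z')) = tl E * tau j Y (Z ** Z').
Proof.
rewrite /tau.
have -> : gen p.+1 0 E = on_sites ord0 (lift ord0 (inord 0 : 'I_p.+1)) (XE E).
  by rewrite /gen; congr on_sites; apply: val_inj; rewrite /= ?inordK /bump; lia.
rewrite (@mtr_stab _ _ _ _ _ C _ _ (tl E)) //.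
Qed.

(** The two ways of reading s_0 .. s_p Z = Z' s_0 .. s_p, where Z' is Z shifted
    by one strand: on the left, the crossing s_p is a kink on the right of
    s_0 .. s_(p-1) Z; on the right, the crossing s_0 is a kink on the left of
    Z s_0 .. s_(p-1), shifted by one strand. *)
Lemma tau_pass_all p j Y E (Z : op p) : slides Z -> (j < p)%N ->
  tr E * tau j.+1 Y (pass_all p E ** Z) = tl E * tau j Y (Z ** pass_all p E).
Proof.
move=> HZ jp; rewrite -tau_stab_max // -tau_stab_0 //.
have lt_p : all (fun k => k < p)%N (iota 0 p).
  by apply/allP => k; rewrite mem_iota; lia.
have iota_max : iota 0 p.+1 = iota 0 p ++ [:: p] by rewrite -addn1 iotaD.
have iota_0 : iota 0 p.+1 = [:: 0%N] ++ [seq k.+1 | k <- iota 0 p].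
  by rewrite /= (iotaDl 1 0).
congr tau; rewrite /pass_all -prodg_idle_max // -prodg_idle0 //.
have := HZ E; rewrite /pass_all {1}iota_max iota_0 !prodg_cat /= !mulmat1 -mmulA => ->.
by [].
Qed.

Lemma prodg_invl p E s : all (fun k => k < p)%N s ->
  exists2 Zi : op p, Zi ** prodg p E s = mone F _ & slides Zi.
Proof.
elim: s => [|k s IH] /=.
  by exists (mone F _); [rewrite mul1mat | exact: slides1].
case/andP=> kp /IH[Zi ZiP sZi]; exists (Zi ** gen p k (~~ E)).
  rewrite -mmulA (mmulA (gen p k _)).
  by rewrite (mmul1C (gen_inv E kp)) mul1mat.
by apply: slidesM => //; exact: slides_gen.
Qed.

(** Moving a crossing of the strands j and j + 1 around the closure moves the cut
    from one to the other. In s_0 .. s_(p-1) = A s_j D, the factor A only involves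
    strands closed to the left when j + 1 is cut, and D only strands closed to
    the right when j is cut: by cyclicity both can be absorbed in Z, which
    [tau_pass_all] leaves arbitrary. *)
Lemma tau_rot p j Y E (W : op p) : slides W -> (j < p)%N ->
  tr E * tau j.+1 Y (gen p j E ** W) = tl E * tau j Y (W ** gen p j E).
Proof.
move=> sW jp.
have splitE : iota 0 p = iota 0 j ++ j :: iota j.+1 (p - j.+1).
  have {1}-> : p = (j + (1 + (p - j.+1)))%N by lia.
  by rewrite !iotaD add0n addn1.
have [Ai AiP sAi] : exists2 Zi : op p, Zi ** prodg p E (iota 0 j) = mone F _ & slides Zi.
  by apply: prodg_invl; apply/allP => k; rewrite mem_iota; lia.
have [Di DiP sDi] : exists2 Zi : op p,
    Zi ** prodg p E (iota j.+1 (p - j.+1)) = mone F _ & slides Zi.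
  by apply: prodg_invl; apply/allP => k; rewrite mem_iota; lia.
have := @tau_pass_all p j Y E (Di ** (W ** Ai)) (slidesM sDi (slidesM sW sAi)) jp.
rewrite /pass_all splitE prodg_cat /=.
set A := prodg p E (iota 0 j) in AiP *; set D := prodg p E (iota j.+1 _) in DiP *.
have -> : tau j.+1 Y (A ** (gen p j E ** D) ** (Di ** (W ** Ai))) = tau j.+1 Y (gen p j E ** W).
  rewrite -!mmulA tau_prodg; last by move=> k; rewrite mem_iota; lia.
  rewrite -/A (mmulA D) (mmul1C DiP) mul1mat -!mmulA AiP mulmat1 //.
have -> : tau j Y (Di ** (W ** Ai) ** (A ** (gen p j E ** D))) = tau j Y (W ** gen p j E).
  rewrite -!mmulA (mmulA Ai) AiP mul1mat !mmulA -tau_prodg; last first.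
    by move=> k; rewrite mem_iota; lia.
  by rewrite -/D -!mmulA (mmulA D) (mmul1C DiP) mul1mat.
by [].
Qed.

(** The previous lemma for the inverse crossing, solved for the opposite cut. *)
Lemma tau_rotV p j Y E (W : op p) : slides W -> (j < p)%N ->
  tr (~~ E) * tau j.+1 Y (W ** gen p j E) = tl (~~ E) * tau j Y (gen p j E ** W).
Proof.
move=> sW jp; have sg b := @slides_gen p j b jp.
have := @tau_rot p j Y (~~ E) (gen p j E ** (W ** gen p j E))
  (slidesM (sg _) (slidesM sW (sg _))) jp.
rewrite mmulA (mmul1C (gen_inv E jp)) mul1mat.
by rewrite -!mmulA (gen_inv E jp) mulmat1.
Qed.

(** The vanishing of every endomorphism of V obtained by cutting a strand. *)
Definition cuts0 p (Z : op p) := forall j Y, (j <= p)%N -> tau j Y Z = 0.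

Lemma cuts0_conj_gen p k E (W : op p) : slides W -> (k < p)%N ->
  cuts0 (gen p k E ** W) <-> cuts0 (W ** gen p k E).
Proof.
move=> sW kp; split=> H j Y jp.
- have [far | /norP[]] := boolP ((k.+1 < j)%N || (j < k)%N); first by rewrite -tau_cyc ?H.
  rewrite -!leqNgt => jk kj; have [jE | jE] : j = k \/ j = k.+1 by lia.
    apply: (mulfI (tl0 E)); rewrite jE -tau_rot // H ?mulr0 //; lia.
  apply: (mulfI (tr0 (~~ E))); rewrite jE tau_rotV // H ?mulr0 //; lia.
- have [far | /norP[]] := boolP ((k.+1 < j)%N || (j < k)%N); first by rewrite tau_cyc ?H.
  rewrite -!leqNgt => jk kj; have [jE | jE] : j = k \/ j = k.+1 by lia.
    apply: (mulfI (tl0 (~~ E))); rewrite jE -tau_rotV // H ?mulr0 //; lia.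
  apply: (mulfI (tr0 E)); rewrite jE tau_rot // H ?mulr0 //; lia.
Qed.

Definition word p (w : seq ('I_p * bool)) : op p :=
  foldr (fun (x : 'I_p * bool) Z => gen p x.1 x.2 ** Z) (mone F _) w.

Lemma word_cat p (u w : seq ('I_p * bool)) : word (u ++ w) = word u ** word w.
Proof. by elim: u => [|x u IH] /=; rewrite ?mul1mat // IH mmulA. Qed.

Lemma slides_word p (w : seq ('I_p * bool)) : slides (word w).
Proof.
elim: w => [|x w IH] /=; first exact: slides1.
by apply: slidesM => //; exact: slides_gen.
Qed.

Lemma cuts0_conj p (u w : seq ('I_p * bool)) :
  cuts0 (word (u ++ w)) <-> cuts0 (word (w ++ u)).
Proof.
elim/last_ind: u w => [|u x IH] w; first by rewrite cats0.
rewrite cat_rcons IH /= cuts0_conj_gen //; last exact: slides_word.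
by rewrite -cats1 catA [word (_ ++ [:: x])]word_cat /= mulmat1.
Qed.

Lemma word_widen p (w : seq ('I_p * bool)) :
  word [seq (widen_ord (leqnSn p) x.1, x.2) | x <- w] = idle ord_max (word w).
Proof.
elim: w => [|x w IH] /=; first by rewrite idle1.
by rewrite IH gen_idle_max // idleM.
Qed.

Lemma cuts0_stab p (w : seq ('I_p * bool)) b :
  cuts0 (word w) <->
  cuts0 (word (rcons [seq (widen_ord (leqnSn p) x.1, x.2) | x <- w] (ord_max, b))).
Proof.
rewrite -cats1 word_cat word_widen /= mulmat1.
have stabE j Y : (j <= p)%N ->
    tau j Y (idle ord_max (word w) ** gen p.+1 p b) = tr b * tau j Y (word w).
  move=> jp; rewrite -[gen p.+1 p b]mulmat1 -(idle1 F B ord_max).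
  by rewrite tau_stab_max // mulmat1.
split=> H j Y jp; last by apply: (mulfI (tr0 b)); rewrite -stabE // H ?mulr0 //; lia.
have [jp' | jp'] := leqP j p; first by rewrite stabE // H // mulr0.
(* The cut strand is the new one: rotating the new crossing moves the cut to
   the strand p, and the new strand becomes a kink on the right. *)
have -> : j = p.+1 by lia.
have sW : slides (idle ord_max (word w)) by rewrite -word_widen; exact: slides_word.
apply: (mulfI (tr0 (~~ b))); rewrite tau_rotV // mulr0.
have -> : gen p.+1 p b ** idle ord_max (word w) =
  idle ord_max (mone F _) ** (gen p.+1 p b ** idle ord_max (word w)) by rewrite idle1 mul1mat.
by rewrite tau_stab_max // mul1mat H // !mulr0.
Qed.

Definition all_cuts_vanish (b : braid) := cuts0 (word (bword b)).

Lemma markov_step_vanish b b' : markov_step b b' -> all_cuts_vanish b <-> all_cuts_vanish b'.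
Proof.
case=> [p u w i c | p u w i j c d ij | p u w i j ij | p u w | p w c]; rewrite /all_cuts_vanish /=.
- by rewrite !word_cat /= (mmulA (gen _ _ _)) gen_inv // mul1mat.
- by rewrite !word_cat /= !(mmulA (gen _ _ _)) gen_far.
- rewrite !word_cat /= -ij; set W := word w.
  suff -> : gen p i true ** (gen p i.+1 true ** (gen p i true ** W)) =
            gen p i.+1 true ** (gen p i true ** (gen p i.+1 true ** W)) by [].
  by rewrite !mmulA gen_braid // ij.
- exact: cuts0_conj.
- exact: cuts0_stab.
Qed.

Lemma same_link_vanish b b' : same_link b b' -> all_cuts_vanish b <-> all_cuts_vanish b'.
Proof.
elim=> {b b'} [b b' /markov_step_vanish // | b // | b b' _ -> // | b b' b'' _ -> _ -> //].
Qed.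

End Markov.
Arguments gen {F B} X Xi p k E _ _.

(** * Closing a block of strands *)

(** In this section [e] and [e'] stand for the two odd generators of some index,
    acting on the strands selected by [blk]; [kp] and [ki] are the two diagonal
    factors of their coproduct. *)
Section Block.
Variables (F : fieldType) (B : finType) (n : nat).
Variables (kp ki : B -> F) (blk : pred 'I_n).
Notation Omega := {ffun 'I_n -> B}.

(** The term of the iterated coproduct with e at the site i. *)
Definition coproduct_term (e : mat F B B) (i l : 'I_n) : mat F B B :=
  if ~~ blk l then mone F B
  else if (l < i)%N then mdiag kp else if l == i then e else mdiag ki.

Definition blockop (e : mat F B B) : mat F Omega Omega :=
  fun f g => \sum_(i | blk i) tensor_op (coproduct_term e i) f g.

Lemma blockop_mull e (Z : mat F Omega Omega) f g :
  (Z ** blockop e) f g = \sum_(i | blk i) (Z ** tensor_op (coproduct_term e i)) f g.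
Proof.
rewrite /mmul /blockop; under eq_bigr => h _ do rewrite mulr_sumr.
by rewrite exchange_big.
Qed.

Lemma blockop_mulr e (Z : mat F Omega Omega) f g :
  (blockop e ** Z) f g = \sum_(i | blk i) (tensor_op (coproduct_term e i) ** Z) f g.
Proof.
rewrite /mmul /blockop; under eq_bigr => h _ do rewrite mulr_suml.
by rewrite exchange_big.
Qed.

(** Only the terms with e at l or r do not commute one by one with the crossing;
    together they form the coproduct on two strands. *)
Lemma blockop_on_sites (X : mat F (B * B)%type (B * B)%type) e (l r : 'I_n) :
  r = l.+1 :> nat -> blk l = blk r ->
  X ** kron (mdiag kp) (mdiag kp) = kron (mdiag kp) (mdiag kp) ** X ->
  X ** kron (mdiag ki) (mdiag ki) = kron (mdiag ki) (mdiag ki) ** X ->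
  X ** madd (kron e (mdiag ki)) (kron (mdiag kp) e) =
    madd (kron e (mdiag ki)) (kron (mdiag kp) e) ** X ->
  on_sites l r X ** blockop e = blockop e ** on_sites l r X.
Proof.
move=> rl blr Xp Xk Xe; apply: matP => f g; rewrite blockop_mull blockop_mulr.
have lr : l != r by rewrite -val_eqE /=; lia.
have far i : i != l -> i != r -> (on_sites l r X ** tensor_op (coproduct_term e i)) f g =
    (tensor_op (coproduct_term e i) ** on_sites l r X) f g.
  move=> il ir; rewrite on_sites_tensor_comm // /coproduct_term -blr.
  case: (blk l) => /=; last by rewrite kron11 mulmat1 mul1mat.
  rewrite eq_sym (negPf il) eq_sym (negPf ir).
  have -> : (r < i)%N = (l < i)%N by move: il ir; rewrite -!val_eqE /=; lia.
  by case: ifP.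
case bl : (blk l); last first.
  by apply: eq_bigr => i bi; apply: far; apply: contraTneq bi => ->; rewrite -?blr bl.
rewrite (bigD1 l) // (bigD1 r) /=; last by rewrite -blr bl eq_sym.
rewrite [RHS](bigD1 l) // [X in _ = _ + X](bigD1 r) /=; last by rewrite -blr bl eq_sym.
rewrite !addrA; congr (_ + _); last first.
  by apply: eq_bigr => i /andP[/andP[_ il] ir]; exact: far.
rewrite !(on_sites_tensor _ _ _ _ lr) !(tensor_on_sites _ _ _ _ lr).
have tl : coproduct_term e l l = e by rewrite /coproduct_term bl ltnn eqxx.
have tlr : coproduct_term e l r = mdiag ki.
  by rewrite /coproduct_term -blr bl /= eq_sym (negPf lr) ifF //; lia.
have trl : coproduct_term e r l = mdiag kp by rewrite /coproduct_term bl /= ifT //; lia.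
have tr : coproduct_term e r r = e by rewrite /coproduct_term -blr bl ltnn eqxx.
rewrite tl tlr trl tr.
set Q := \prod_(j | _) coproduct_term e l j _ _; set Q' := \prod_(j | _) _.
have <- : Q = Q'.
  apply: eq_bigr => j /andP[jl jr]; rewrite /coproduct_term (negPf jl) (negPf jr).
  by have -> : (j < r)%N = (j < l)%N by move: jl jr; rewrite -!val_eqE /=; lia.
rewrite -!mulrDl; congr (_ * _).
by have := congr1 (fun Z : mat F _ _ => Z (f l, f r) (g l, g r)) Xe; rewrite mmulDl mmulDr.
Qed.

Lemma tensor_op_opp (M M' : 'I_n -> mat F B B) i f g : (forall l, l != i -> M l = M' l) ->
  (forall x y, M i x y = - M' i x y) -> tensor_op M f g = - tensor_op M' f g.
Proof.
move=> Ml Mi; rewrite /tensor_op (bigD1 i) // [in RHS](bigD1 i) //= Mi mulNr.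
by congr (- (_ * _)); apply: eq_bigr => l li; rewrite Ml.
Qed.

Section Anti.
Variable e : mat F B B.
Hypothesis e_kp : forall x y, e x y != 0 -> kp x = - kp y.
Hypothesis e_ki : forall x y, e x y != 0 -> ki x = ki y.

Lemma e_kpC x y : (mdiag kp ** e) x y = - (e ** mdiag kp) x y.
Proof.
rewrite mdiag_mull mdiag_mulr; have [-> | e0] := eqVneq (e x y) 0.
  by rewrite mulr0 mul0r oppr0.
by rewrite (e_kp e0) mulNr mulrC.
Qed.

Lemma e_kiC : mdiag ki ** e = e ** mdiag ki.
Proof.
apply: matP => x y; rewrite mdiag_mull mdiag_mulr; have [-> | e0] := eqVneq (e x y) 0.
  by rewrite mulr0 mul0r.
by rewrite (e_ki e0) mulrC.
Qed.

(** The sign in the closing matrix makes it anticommute with an odd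
    generator. *)
Lemma tensor_op_blockop (M : 'I_n -> mat F B B) (c : B -> F) f g :
  (forall l, blk l -> M l = mdiag c) -> (forall x y, e x y != 0 -> c x = - c y) ->
  (tensor_op M ** blockop e) f g = - (blockop e ** tensor_op M) f g.
Proof.
move=> Mc ec; rewrite blockop_mull blockop_mulr -sumrN; apply: eq_bigr => i bi.
rewrite !tensor_opM; apply: (tensor_op_opp (i := i)) => [l li | x y].
  rewrite /coproduct_term (negPf li); case bl: (blk l) => /=; last by rewrite mulmat1 mul1mat.
  by rewrite Mc //; case: ifP => _; rewrite mdiagC.
rewrite /coproduct_term bi ltnn eqxx Mc //= mdiag_mull mdiag_mulr.
have [-> | e0] := eqVneq (e x y) 0; first by rewrite mulr0 mul0r oppr0.
by rewrite (ec _ _ e0) mulNr mulrC.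
Qed.

Lemma blockop_const (h : B -> F) f g : (forall x y, e x y != 0 -> h x = h y) ->
  blockop e f g != 0 -> forall l, blk l -> h (f l) = h (g l).
Proof.
move=> eh; rewrite /blockop => /eqP E0 l bl; apply/eqP/negPn/negP => hl.
case: E0; apply: big1 => i bi; rewrite /tensor_op (bigD1 l) //=.
suff -> : coproduct_term e i l (f l) (g l) = 0 by rewrite mul0r.
have fgl : f l != g l by apply: contra hl => /eqP ->.
rewrite /coproduct_term bl /=; case: ifP => _; first by rewrite /mdiag (negPf fgl).
case: eqP => _; last by rewrite /mdiag (negPf fgl).
by apply/eqP/negPn/negP => /eh /eqP; rewrite (negPf hl).
Qed.
End Anti.

Variables (e e' : mat F B B) (c : F).
Hypothesis e_kp : forall x y, e x y != 0 -> kp x = - kp y.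
Hypothesis e_ki : forall x y, e x y != 0 -> ki x = ki y.
Hypothesis e_kp' : forall x y, e' x y != 0 -> kp x = - kp y.
Hypothesis e_ki' : forall x y, e' x y != 0 -> ki x = ki y.
Hypothesis ee' : forall x y, (e ** e') x y + (e' ** e) x y =
  (x == y)%:R * (c * (kp x ^+ 2 - ki x ^+ 2)).

(** For i < j, the factor [kp] of the second operator meets e at the site i and
    brings a sign, while [ki] commutes with e' at the site j. *)
Lemma distinct_sites_anti i j f g : blk i -> blk j -> i != j ->
  (tensor_op (coproduct_term e i) ** tensor_op (coproduct_term e' j)) f g = - (tensor_op (coproduct_term e' j) ** tensor_op (coproduct_term e i)) f g.
Proof.
move=> bi bj ij; rewrite !tensor_opM.
pose k := if (i < j)%N then i else j.
apply: (tensor_op_opp (i := k)) => [l lk | x y].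
- rewrite /coproduct_term; case bl: (blk l) => /=; last by rewrite mulmat1.
  have [li | li] := eqVneq l i; have [lj | lj] := eqVneq l j.
  + by rewrite -li -lj eqxx in ij.
  + have lj' : (l < j)%N = false.
      by apply: contraNF lk => lj'; rewrite /k -li lj'.
    by rewrite li ltnn -li lj' e_kiC.
  + have li' : (l < i)%N = false.
      by apply: contraNF lk => li'; rewrite /k -lj ltnNge (ltnW li').
    by rewrite lj ltnn -lj li' e_kiC.
  + by case: ifP => _; case: ifP => _; rewrite mdiagC.
- rewrite /k; case: ltnP => kij; rewrite /coproduct_term ?bi ?bj /= ?ltnn ?eqxx /= ?kij.
    by rewrite (e_kpC e_kp) opprK.
  have -> : (j < i)%N by move: ij kij; rewrite -val_eqE /=; lia.
  by rewrite (e_kpC e_kp').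
Qed.

Definition block_scalar (f : Omega) : F :=
  c * (\prod_(l | blk l) kp (f l) ^+ 2 - \prod_(l | blk l) ki (f l) ^+ 2).

(** Written as a difference of two consecutive values, to be summed over i by
    telescoping. *)
Lemma same_site_anti i f g : blk i ->
  (tensor_op (coproduct_term e i) ** tensor_op (coproduct_term e' i)) f g + (tensor_op (coproduct_term e' i) ** tensor_op (coproduct_term e i)) f g =
  (f == g)%:R * (c * (\prod_(l | blk l) (if (l < i.+1)%N then kp (f l) else ki (f l)) ^+ 2
                      - \prod_(l | blk l) (if (l < i)%N then kp (f l) else ki (f l)) ^+ 2)).
Proof.
move=> bi; rewrite !tensor_opM.
pose d l x := if ~~ blk l then 1 else if (l < i)%N then kp x ^+ 2 else ki x ^+ 2.
have N1 (u u' : mat F B B) (l : 'I_n) : l != i -> coproduct_term u i l ** coproduct_term u' i l = mdiag (d l).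
  move=> /negPf li; rewrite /coproduct_term /d li; case: (blk l) => /=; last by rewrite mulmat1.
  by case: ifP => _; rewrite mdiagM; congr mdiag; apply: functional_extensionality => x.
rewrite /tensor_op !(bigD1 i (P := xpredT)) //=.
rewrite [X in _ + _ * X](_ : _ = \prod_(l | l != i) (coproduct_term e i l ** coproduct_term e' i l) (f l) (g l)); last first.
  by apply: eq_bigr => l li; rewrite !N1.
rewrite -mulrDl /coproduct_term bi ltnn eqxx /= -/(coproduct_term _ _ _) ee'.
rewrite [X in _ * X](_ : _ = \prod_(l | l != i) mdiag (d l) (f l) (g l)); last first.
  by apply: eq_bigr => l li; rewrite -(N1 e e').
have prod_S : \prod_(l | blk l) (if (l < i.+1)%N then kp (f l) else ki (f l)) ^+ 2 =
    kp (f i) ^+ 2 * \prod_(l | blk l && (l != i)) d l (f l).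
  rewrite (bigD1 i) //= ltnSn; congr (_ * _); apply: eq_bigr => l /andP[bl li].
  rewrite /d bl /= ltnS leq_eqVlt (inj_eq val_inj) (negPf li) /=.
  by case: ifP.
have prod_i : \prod_(l | blk l) (if (l < i)%N then kp (f l) else ki (f l)) ^+ 2 =
    ki (f i) ^+ 2 * \prod_(l | blk l && (l != i)) d l (f l).
  rewrite (bigD1 i) //= ltnn; congr (_ * _); apply: eq_bigr => l /andP[bl li].
  by rewrite /d bl /=; case: ifP.
rewrite prod_S prod_i {prod_S prod_i}.
have [-> | fg] := eqVneq f g; last first.
  rewrite mul0r; have [fgi | fgi] := eqVneq (f i) (g i); last by rewrite !mul0r.
  have [l fgl] : exists l, f l != g l.
    apply/existsP; apply: contraR fg; rewrite negb_exists => /forallP fg.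
    by apply/eqP/ffunP => l; apply/eqP; have := fg l; rewrite negbK.
  have li : l != i by apply: contraNneq fgl => ->; rewrite fgi.
  by rewrite (bigD1 l) //= /mdiag (negPf fgl) mul0r mulr0.
rewrite eqxx !mul1r.
rewrite [\prod_(l | l != i) _](_ : _ = \prod_(l | blk l && (l != i)) d l (g l)); last first.
  rewrite (bigID blk) /= [X in _ * X]big1 ?mulr1 => [|l /andP[_ bl]]; last first.
    by rewrite /mdiag eqxx /d bl.
  by apply: eq_big => [l | l _]; [rewrite andbC | rewrite /mdiag eqxx].
by ring.
Qed.

Lemma blockop_anti :
  madd (blockop e ** blockop e') (blockop e' ** blockop e) = mdiag block_scalar.
Proof.
apply: matP => f g; rewrite /madd blockop_mulr blockop_mull.
under eq_bigr => i _ do rewrite blockop_mull.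
under [X in _ + X]eq_bigr => i _ do rewrite blockop_mulr.
rewrite -big_split /=.
transitivity (\sum_(i | blk i) ((tensor_op (coproduct_term e i) ** tensor_op (coproduct_term e' i)) f g +
                                (tensor_op (coproduct_term e' i) ** tensor_op (coproduct_term e i)) f g)).
  apply: eq_bigr => i bi; rewrite -big_split (bigD1 i) //= big1 ?addr0 // => j /andP[bj ji].
  by rewrite distinct_sites_anti // 1?eq_sym // addNr.
pose G (f : Omega) t := \prod_(l | blk l) (if (l < t)%N then kp (f l) else ki (f l)) ^+ 2.
transitivity (\sum_(i < n) (f == g)%:R * (c * (G f i.+1 - G f i))).
  rewrite big_mkcond; apply: eq_bigr => i _; case: ifP => bi; first exact: same_site_anti.
  rewrite (_ : G f i.+1 = G f i) ?subrr ?mulr0 //; apply: eq_bigr => l bl.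
  by rewrite ltnS leq_eqVlt (inj_eq val_inj); case: eqP bl => [-> | //]; rewrite bi.
rewrite -!mulr_sumr -(big_mkord xpredT (fun i => G f i.+1 - G f i)) telescope_sumr //.
rewrite /mdiag /block_scalar; case: eqP => _; rewrite ?mul0r // mul1r; congr (_ * (_ - _)).
by apply: eq_bigr => l _; rewrite ltn_ord.
Qed.

(** With H = E F + F E and H^-1 commuting with E, the trace of D Z is the sum of
    those of D H^-1 E F Z and of D H^-1 F E Z. The second one is the
    opposite of the first: take E around the trace, across Z and then D. *)
Lemma block_trace0 (M : 'I_n -> mat F B B) (d : B -> F) (Z : mat F Omega Omega) :
  (forall f, block_scalar f != 0) ->
  (forall l, blk l -> M l = mdiag d) -> (forall x y, e x y != 0 -> d x = - d y) ->
  Z ** blockop e = blockop e ** Z -> mtr (tensor_op M ** Z) = 0.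
Proof.
move=> H0 Md ed ZE.
pose Hi := mdiag (fun f => (block_scalar f)^-1).
have HiE : Hi ** blockop e = blockop e ** Hi.
  apply: matP => f g; rewrite mdiag_mull mdiag_mulr.
  have [-> | E0] := eqVneq (blockop e f g) 0; first by rewrite mulr0 mul0r.
  rewrite mulrC; congr (_ * (_ * (_ - _))^-1); apply: eq_bigr => l bl.
    apply: (blockop_const (h := fun x => kp x ^+ 2) _ E0 bl) => x y exy.
    by rewrite (e_kp exy) sqrrN.
  by apply: (blockop_const (h := fun x => ki x ^+ 2) _ E0 bl) => x y /e_ki ->.
have HiH : Hi ** mdiag block_scalar = mone F Omega by apply: mmul1C; exact: mdiagV.
have -> : tensor_op M ** Z = tensor_op M ** Hi ** (mdiag block_scalar ** Z).
  by rewrite -mmulA (mmulA Hi) HiH mul1mat.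
rewrite -blockop_anti mmulDl mmulDr.
have trD (P Q : mat F Omega Omega) : mtr (madd P Q) = mtr P + mtr Q by rewrite /mtr -big_split.
rewrite trD -(mmulA (blockop e')) -ZE.
rewrite -[blockop e ** blockop e' ** Z]mmulA.
have -> : mtr (tensor_op M ** Hi ** (blockop e' ** (Z ** blockop e))) =
    mtr (blockop e ** tensor_op M ** (Hi ** (blockop e' ** Z))).
  by rewrite 2!mmulA mtrC !mmulA.
have -> : blockop e ** tensor_op M = mscal (-1) (tensor_op M ** blockop e).
  by apply: matP => f g; rewrite /mscal (tensor_op_blockop _ _ Md ed) mulN1r opprK.
rewrite mscalAl -(mmulA (tensor_op M) (blockop e)) (mmulA (blockop e) Hi) -HiE.
have trN (P : mat F Omega Omega) : mtr (mscal (-1) P) = - mtr P.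
  by rewrite /mtr -sumrN; apply: eq_bigr => f _; rewrite /mscal mulN1r.
by rewrite trN -!mmulA subrr.
Qed.
End Block.

(** * Split links *)

Section Tangle.
Variables (F : fieldType) (B : finType) (X : mat F (B * B)%type (B * B)%type).

Lemma gen_crossing p (i : 'I_p) E :
  gen X (minv X) p i E = crossing i (if E then X else minv X).
Proof.
rewrite /gen; have -> : inord i = lift ord_max i.
  by apply: val_inj; have ip := ltn_ord i; rewrite /= ?inordK /bump; lia.
have -> // : inord i.+1 = lift ord0 i.
by apply: val_inj; have ip := ltn_ord i; rewrite /= ?inordK /bump; lia.
Qed.

Lemma braid_opE b : @braid_op F B X b = word X (minv X) (bword b).
Proof.
rewrite /braid_op; elim: (bword b) => [//|x w IH] /=.
by rewrite IH gen_crossing.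
Qed.

Lemma tensor_op_diag n (d : 'I_n -> B -> F) (M : 'I_n -> mat F B B) :
  (forall i, M i = mdiag (d i)) -> tensor_op M = mdiag (fun f : {ffun 'I_n -> B} => \prod_i d i (f i)).
Proof.
move=> Md; apply: matP => f g; rewrite /tensor_op /mdiag; case: (f =P g) => [-> | fg].
  by apply: eq_bigr => i _; rewrite Md /mdiag eqxx.
have [i fgi] : exists i, f i != g i.
  apply/existsP; apply: contra_notT fg; rewrite negb_exists => /forallP fg.
  by apply/ffunP => i; apply/eqP; have := fg i; rewrite negbK.
by rewrite (bigD1 i) //= Md /mdiag (negPf fgi) mul0r.
Qed.

(** The last strand is cut, and the entry at v is selected by the projection on
    v. *)
Lemma tangle_op_tau (C C' : B -> F) b v :
  tangle_op C X b v v =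
  tau C C' (pstr b) (mdiag (fun x => (x == v)%:R)) (word X (minv X) (bword b)).
Proof.
rewrite /tangle_op /tau -braid_opE.
rewrite (@mtr_site _ _ _ ord_max _ (fun x => (x == v)%:R)); last first.
  by rewrite /sites /= ltnn eqxx.
rewrite (@tensor_op_diag _ (fun _ => C)) => [|i]; last by rewrite /sites lift_max ltn_ord.
rewrite /mtr; apply: eq_bigr => h _; rewrite !mdiag_mull; congr (_ * _).
  by apply: eq_bigr => j _; rewrite ffunE liftK.
rewrite /site_tr (bigD1 v) //= eqxx mul1r big1 ?addr0 // => c /negPf ->.
by rewrite mul0r.
Qed.
End Tangle.

(** The braiding up to a nonzero factor s, closed on the left by S up to a nonzero
    factor t: the normalization of the invariant is of this form. *)
Section Instance.
Variables (F : fieldType) (qp : F -> F) (alpha : F) (m n : nat).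
Variables (R : univ_family F m n) (V : gmod F m n) (z : F).
Arguments R : clear implicits.
Hypotheses (m1 : (1 <= m)%N) (n1 : (1 <= n)%N).
Hypotheses (Hqp : is_qpow qp) (Hgen : generic qp alpha) (HR : universal_R qp R).
Hypotheses (repV : is_rep qp V) (irrV : irreducible qp V).
Hypotheses (hwV : has_highest_weight alpha V) (z0 : z != 0).

Lemma odd_root_proof : (m.-1 < (m + n).-1)%N. Proof. by lia. Qed.
Definition odd_root := Ordinal odd_root_proof.
Lemma spar_odd_root : spar odd_root.
Proof. by rewrite /spar /gpar /= (ltn_predK m1) leqnn; lia. Qed.

Let a := odd_root.
Let nontriv : qp 1 != 1 := generic_q1 Hqp Hgen.
Let kp (v : V) : F := (-1) ^+ (spar a && par V v) * qp (2%:R^-1 * kwt V a v).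
Let ki (v : V) : F := qp (- 2%:R^-1 * kwt V a v).

Lemma cart_odd : cart F a a = 0.
Proof. by rewrite cart_self; have [-> ->] := gsgn_odd F spar_odd_root; rewrite subrr. Qed.

Section Homog.
Variables (s : F) (e : 'I_(m + n).-1 -> mat F V V).
Hypothesis He : homog s e.

Lemma odd_kwt x y : e a x y != 0 -> kwt V a x = kwt V a y.
Proof. by move/(homog_kwt a He); rewrite cart_odd mulr0 addr0. Qed.

Lemma odd_sign x y : e a x y != 0 -> (-1) ^+ par V x = - (-1) ^+ par V y :> F.
Proof. by case/He=> -> _; rewrite signr_addb spar_odd_root expr1 mulrN1. Qed.

Lemma odd_kp x y : e a x y != 0 -> kp x = - kp y.
Proof. by move=> e0; rewrite /kp spar_odd_root /= (odd_sign e0) (odd_kwt e0) mulNr. Qed.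

Lemma odd_ki x y : e a x y != 0 -> ki x = ki y.
Proof. by move=> e0; rewrite /ki (odd_kwt e0). Qed.

Lemma odd_rdiag u x y : e a x y != 0 -> rdiag qp u x = - rdiag qp u y.
Proof.
move=> e0; rewrite /rdiag (odd_sign e0) (rho2_shift He e0) cart_odd mulr0 addr0.
by rewrite mulNr.
Qed.
End Homog.

Let c : F := (qp 1 - qp (-1))^-1.
Lemma c_neq0 : c != 0. Proof. by rewrite invr_neq0 // (generic_qsym Hqp Hgen). Qed.

Let two0 : 2%:R != 0 :> F := generic_natr Hgen (isT : (0 < 2)%N).

Lemma kp2 v : kp v ^+ 2 = qp (kwt V a v).
Proof.
rewrite /kp exprMn sqrr_sign mul1r expr2 -(qpD Hqp); congr qp; field; exact: two0.
Qed.

Lemma ki2 v : ki v ^+ 2 = qp (- kwt V a v).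
Proof. rewrite /ki expr2 -(qpD Hqp); congr qp; field; exact: two0. Qed.

Lemma odd_anti x y : (up V a ** dn V a) x y + (dn V a ** up V a) x y =
  (x == y)%:R * (c * (kp x ^+ 2 - ki x ^+ 2)).
Proof.
have := rep_up_dn repV a a x y; rewrite spar_odd_root /= expr1 mulN1r opprK => ->.
rewrite eqxx mul1r !kpowE // /mdiag kp2 ki2 mulN1r mul1r /qi.
have [-> _] := gsgn_odd F spar_odd_root; rewrite !mul1r.
by case: eqP => _; rewrite ?mul1r ?mul0r ?subrr ?mul0r // mulrC.
Qed.

(** The exponent is alpha times the number of strands of the block, plus an
    integer: this is where the genericity of alpha matters. *)
Lemma block_scalar_neq0 k (blk : pred 'I_k) l f : blk l -> block_scalar kp ki blk c f != 0.
Proof.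
move=> bl; rewrite /block_scalar mulf_neq0 ?c_neq0 // subr_eq0.
under eq_bigr => i _ do rewrite kp2.
under [X in _ != X]eq_bigr => i _ do rewrite ki2.
rewrite -!(big_morph qp (qpD Hqp) (qp0 Hqp)) sumrN.
set s := \sum_(i | _) _.
have [w sE] : exists w : int, s = alpha * (\sum_(i | blk i) 1)%:R + w%:~R.
  rewrite natr_sum mulr_sumr; apply: (big_ind2 (fun x y => exists w : int, x = y + w%:~R)).
  - by exists 0; rewrite addr0.
  - by move=> x1 x2 y1 y2 [w1 ->] [w2 ->]; exists (w1 + w2); rewrite rmorphD /=; ring.
  - move=> i _; have [w ->] := kwt_odd irrV Hqp repV Hgen hwV spar_odd_root (f i).
    by exists w; rewrite mulr1.
have := @generic_alpha _ _ _ Hqp Hgen ((\sum_(i | blk i) 1) * 2)%N (w * 2).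
move=> /(_ _)/contra => H; apply: H; last first.
  by rewrite muln_gt0 andbT (bigD1 l).
move=> /eqP ss; rewrite natrM rmorphM /= mulrA -mulrDl -sE.
have -> : s * 2%:R = s + s by ring.
by rewrite (qpD Hqp) {1}ss -(qpD Hqp) addNr (qp0 Hqp).
Qed.

Let X := Rcheck R V z.
Variables (s t : F).
Hypotheses (s0 : s != 0) (t0 : t != 0).
Let sigma : mat F (V * V)%type (V * V)%type := mscal s X.
Let C (v : V) : F := t * rdiag qp 1 v.
Let C' : V -> F := rdiag qp (-1).

Lemma sigma_inv : sigma ** mscal s^-1 (Rcheck_inv R V z) = mone F (V * V)%type.
Proof.
rewrite /sigma mscalAl mscalAr (Rcheck_invP HR repV z0).
by apply: matP => i j; rewrite /mscal mulrA mulfV // mul1r.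
Qed.

Lemma minv_sigma : minv sigma = mscal s^-1 (Rcheck_inv R V z).
Proof. exact: minv_eq sigma_inv. Qed.

Lemma sigma_braid : on12 sigma ** on23 sigma ** on12 sigma =
  on23 sigma ** on12 sigma ** on23 sigma.
Proof.
have e12 : on12 sigma = mscal s (on12 X).
  by apply: matP => i j; rewrite /on12 /kron /sigma /mscal mulrA.
have e23 : on23 sigma = mscal s (on23 X).
  apply: matP => i j; rewrite /on23 /sigma /mscal; case: ifP => _ //.
  by rewrite mulr0.
rewrite e12 e23 !(mscalAl, mscalAr); congr (mscal _ (mscal _ (mscal _ _))).
exact: (Rcheck_braid z Hqp Hgen HR repV).
Qed.

Lemma sigma_comm Y : X ** Y = Y ** X -> sigma ** Y = Y ** sigma.
Proof. by move=> XY; rewrite /sigma mscalAl mscalAr XY. Qed.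

Lemma sigma_CC : sigma ** kron (mdiag C) (mdiag C) = kron (mdiag C) (mdiag C) ** sigma.
Proof.
apply: sigma_comm.
have -> : kron (mdiag C) (mdiag C) = mscal (t * t) (kron (mdiag (rdiag qp 1)) (mdiag (rdiag qp 1))).
  apply: matP => i j; rewrite /kron /mscal /mdiag /C.
  by case: eqP; case: eqP => _ _; rewrite ?mulr0 ?mul0r ?mulr0 //; ring.
by rewrite (mscalAl (t * t)) (mscalAr (t * t)) (Rcheck_rdiag z Hqp HR repV).
Qed.

Lemma ptr_scale d (r u : F) (Y : mat F (V * V)%type (V * V)%type) :
  ptr (mdiag (fun v => r * d v)) (mscal u Y) = mscal (r * u) (ptr (mdiag d) Y).
Proof.
apply: matP => i j; rewrite /ptr /mscal !mulr_sumr; apply: eq_bigr => x _.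
rewrite !mulr_sumr; apply: eq_bigr => y _; rewrite /mdiag.
by case: eqP => _; [ring | rewrite !mul0r mulr0].
Qed.

Lemma sigma_ptr_l : exists tl : bool -> F, (forall E, tl E != 0) /\
  forall E, ptr (mdiag C) (if E then sigma else minv sigma) = mdiag (fun _ => tl E).
Proof.
have [u u0 uE] := ptr_left_Rcheck Hqp Hgen HR repV z0 irrV hwV.
have [w w0 wE] := ptr_left_Rcheck_inv Hqp Hgen HR repV z0 irrV hwV.
exists (fun E : bool => if E then t * s * u else t * s^-1 * w); split.
  by case; rewrite !mulf_neq0 ?invr_neq0.
case; rewrite ?minv_sigma /C /sigma ptr_scale ?uE ?wE; apply: matP => i j;
  by rewrite /mscal /mdiag; case: eqP; rewrite ?mulr0.
Qed.

Lemma sigma_ptr_r : exists tr : bool -> F, (forall E, tr E != 0) /\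
  forall E, ptr (mdiag C') (swapm (if E then sigma else minv sigma)) = mdiag (fun _ => tr E).
Proof.
have [u u0 uE] := ptr_right_Rcheck Hqp Hgen HR repV z0 irrV hwV.
have [w w0 wE] := ptr_right_Rcheck_inv Hqp Hgen HR repV z0 irrV hwV.
have C'E : mdiag C' = mdiag (fun v => 1 * rdiag qp (-1) v).
  by congr mdiag; apply: functional_extensionality => v; rewrite mul1r.
exists (fun E : bool => if E then 1 * s * u else 1 * s^-1 * w); split.
  by case; rewrite !mulf_neq0 ?invr_neq0 ?oner_eq0.
case; rewrite ?minv_sigma C'E.
- rewrite (_ : swapm sigma = mscal s (swapm X)) // ptr_scale uE; apply: matP => i j.
  by rewrite /mscal /mdiag; case: eqP; rewrite ?mulr0.
- rewrite (_ : swapm (mscal _ _) = mscal s^-1 (swapm (Rcheck_inv R V z))) // ptr_scale wE.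
  by apply: matP => i j; rewrite /mscal /mdiag; case: eqP; rewrite ?mulr0.
Qed.

Lemma XE_blockop p (blk : pred 'I_p.+1) k E : (k < p)%N ->
  blk (inord k) = blk (inord k.+1) ->
  gen sigma (minv sigma) p k E ** blockop kp ki blk (up V a) =
  blockop kp ki blk (up V a) ** gen sigma (minv sigma) p k E.
Proof.
move=> kp' bk; have XE Y : X ** Y = Y ** X ->
    (if E then sigma else minv sigma) ** Y = Y ** (if E then sigma else minv sigma).
  move=> /sigma_comm XY; case: E => //; rewrite minv_sigma.
  exact: comm_inv sigma_inv XY.
apply: blockop_on_sites => //; first by rewrite !inordK //; lia.
- exact/XE/(Rcheck_kpar z Hqp HR repV).
- exact/XE/(Rcheck_kinv z Hqp HR repV).
- apply: XE; have := Rcheck_up z Hqp HR repV a; by rewrite copE.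
Qed.

Lemma word_blockop p (blk : pred 'I_p.+1) (w : seq ('I_p * bool)) :
  (forall x, x \in w -> blk (inord x.1) = blk (inord x.1.+1)) ->
  word sigma (minv sigma) w ** blockop kp ki blk (up V a) =
  blockop kp ki blk (up V a) ** word sigma (minv sigma) w.
Proof.
elim: w => [|x w IH] H /=; first by rewrite mul1mat mulmat1.
rewrite -mmulA IH; last by move=> y yw; apply: H; rewrite inE yw orbT.
by rewrite mmulA XE_blockop ?mmulA // H ?mem_head.
Qed.

(** The block is the part of the split union that does not contain the cut
    strand. *)
Lemma split_union_vanish b1 b2 : all_cuts_vanish sigma (minv sigma) C C' (split_union b1 b2).
Proof.
case: b1 b2 => [p1 w1] [p2 w2]; rewrite /all_cuts_vanish /=; set w := _ ++ _.
move=> j Y jp.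
have wP x : x \in w -> (x.1 < p1)%N || (p1 < x.1)%N.
  rewrite mem_cat => /orP[] /mapP[[i E] _ ->] /=; first by rewrite ltn_ord.
  by rewrite addSn ltnS leq_addr orbT.
have He := homog_up Hqp nontriv repV; have Hd := homog_dn Hqp nontriv repV.
pose blk : pred 'I_(p1.+1 + p2).+1 := fun l => (l <= p1)%N == (p1 < j)%N.
have bw x : x \in w -> blk (inord x.1) = blk (inord x.1.+1).
  move=> /wP xp; rewrite /blk !inordK; try by have := ltn_ord x.1; lia.
have [l bl] : exists l, blk l.
  have [pj | jp1] := ltnP p1 j; [exists ord0 | exists ord_max]; rewrite /blk /=; lia.
rewrite /tau; have [pj | jp1] := ltnP p1 j.
- apply: (block_trace0 (blk := blk) (odd_kp He) (odd_ki He) (odd_kp Hd) (odd_ki Hd)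
    odd_anti (d := C)).
  + by move=> f; exact: block_scalar_neq0 bl.
  + by move=> i; rewrite /blk pj /sites => /eqP ip; rewrite ifT //; lia.
  + by move=> x y exy; rewrite /C (odd_rdiag He 1 exy) mulrN.
  + exact: word_blockop.
- apply: (block_trace0 (blk := blk) (odd_kp He) (odd_ki He) (odd_kp Hd) (odd_ki Hd)
    odd_anti (d := C')).
  + by move=> f; exact: block_scalar_neq0 bl.
  + by move=> i; rewrite /blk ltnNge jp1 /= /sites => /eqP ip; rewrite !ifF //; lia.
  + by move=> x y exy; rewrite /C' (odd_rdiag He (-1) exy).
  + exact: word_blockop.
Qed.

Lemma same_link_vanish_sigma b b' : same_link b b' ->
  all_cuts_vanish sigma (minv sigma) C C' b <-> all_cuts_vanish sigma (minv sigma) C C' b'.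
Proof.
have [tl [tl0 tlE]] := sigma_ptr_l; have [tr [tr0 trE]] := sigma_ptr_r.
have sV : sigma ** minv sigma = mone F (V * V)%type by rewrite minv_sigma sigma_inv.
apply: (same_link_vanish sV sigma_braid sigma_CC _ tl0 tr0 tlE trE).
apply: sigma_comm; exact: (Rcheck_rdiag z Hqp HR repV).
Qed.

End Instance.

Theorem theorem2 (F : fieldType) (qp : F -> F) (alpha : F) (m n : nat)
    (R : univ_family F m n) (V : gmod F m n) (v1 : V) (z r1 r2 : F)
    (b b1 b2 : braid) :
  (1 <= m)%N -> (1 <= n)%N ->
  is_qpow qp -> generic qp alpha ->
  universal_R qp R ->
  is_rep qp V -> irreducible qp V -> has_highest_weight alpha V ->
  z != 0 ->
  r1 ^+ 2 = Xconst qp v1 (Rcheck R V z) ->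
  r2 ^+ 2 = Xconst qp v1 (minv (Rcheck R V z)) ->
  same_link b (split_union b1 b2) ->
  LG qp R v1 z r1 r2 b = 0.
Proof.
move=> m1 n1 Hqp Hgen HR repV irrV hwV z0 r1E r2E bb.
have XconstE Y : Xconst qp v1 Y = ptr (mdiag (rdiag qp 1)) Y v1 v1.
  rewrite /Xconst SdiagE // /ptr; apply: eq_bigr => c _.
  rewrite (bigD1 c) //= /mdiag eqxx big1 ?addr0 // => d /negPf dc.
  by rewrite eq_sym dc mul0r.
have sq_neq0 (r t : F) : t != 0 -> r ^+ 2 = t -> r != 0.
  by move=> t0 rt; apply: contra_neq t0 => r0; rewrite -rt r0 expr0n.
have r10 : r1 != 0.
  have [u u0 uE] := ptr_left_Rcheck Hqp Hgen HR repV z0 irrV hwV.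
  by apply: (sq_neq0 _ u) => //; rewrite r1E XconstE uE /mdiag eqxx.
have r20 : r2 != 0.
  have [u u0 uE] := ptr_left_Rcheck_inv Hqp Hgen HR repV z0 irrV hwV.
  by apply: (sq_neq0 _ u) => //; rewrite r2E XconstE (minv_Rcheck HR repV z0) uE /mdiag eqxx.
rewrite /LG SdiagE // (tangle_op_tau _ _ (rdiag qp (-1))).
have s0 : r1^-1 * r2 != 0 by rewrite mulf_neq0 ?invr_neq0.
have t0 : r1^-1 * r2^-1 != 0 by rewrite mulf_neq0 ?invr_neq0.
have cuts := split_union_vanish m1 n1 Hqp Hgen HR repV irrV hwV z0 s0.
have := same_link_vanish_sigma Hqp Hgen HR repV irrV hwV z0 s0 t0 bb.
by case=> _ /(_ (cuts _ t0 b1 b2)); apply.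
Qed.
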